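(* Let $G$ be a second-countable locally compact Hausdorff groupoid with a (left) Haar system $\lambda=\{\lambda^u: u\in G^{(0)}\}$. Let $\Gamma$ be a discrete group with identity $e$ and let $c\colon G\to\Gamma$ be a continuous homomorphism. Set $G_e := c^{-1}(\{e\})$, an open and closed subgroupoid of $G$, equipped with the Haar system $\{\lambda^u|_{G_e}: u\in G^{(0)}\}$. Define $i\colon C_c(G_e)\to C_c(G)$ by $i(f)(x)=f(x)$ if $x\in G_e$ and $i(f)(x)=0$ otherwise. Then $i$ extends to injective $*$-homomorphisms $i_{\mathrm f}\colon C^*(G_e)\to C^*(G)$ and $i_{\mathrm r}\colon C^*_{\mathrm r}(G_e)\to C^*_{\mathrm r}(G)$.
   Context: For a groupoid $G$ with Haar system $\lambda$, $C_c(G)$ (continuous compactly supported complex functions) is a $*$-algebra under convolution $(a*b)(x)=\int_G a(y)\,b(y^{-1}x)\,d\lambda^{r(x)}(y)$ and involution $a^*(x)=\overline{a(x^{-1})}$. Let $\lambda_u$ be the push-forward of $\lambda^u$ under inversion. The $I$-norm is $\|a\|_I=\max\{\sup_u\int|a|\,d\lambda^u,\ \sup_u\int|a|\,d\lambda_u\}$. The full $C^*$-algebra $C^*(G)$ is the completion of $C_c(G)$ in the norm $\|a\|=\sup\{\|\pi(a)\|\}$, the supremum over $I$-norm-decreasing $*$-representations $\pi$ of $C_c(G)$ on Hilbert spaces. The reduced $C^*$-algebra $C^*_{\mathrm r}(G)$ is the completion of $C_c(G)$ in the norm $\|a\|_{\mathrm r}=\sup_{u\in G^{(0)}}\|\pi_u(a)\|$,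 where $\pi_u$ is the regular representation on $L^2(Gu,\lambda_u)$, $Gu=\{x\in G: s(x)=u\}$, given by $\pi_u(a)h=a*h$. The same definitions apply to $G_e$. *)

(* Defs.v *)
From HB Require Import structures.
From mathcomp Require Import all_boot all_order all_algebra complex.
From mathcomp Require Import all_classical all_reals all_analysis measurable_realfun.

Set Implicit Arguments.
Unset Strict Implicit.
Unset Printing Implicit Defensive.

Import Order.TTheory GRing.Theory Num.Theory.
Import numFieldNormedType.Exports.

Local Open Scope classical_set_scope.
Local Open Scope ring_scope.
Local Open Scope complex_scope.

(* A groupoid is identified with its set of arrows: the unit space G^(0) is the
   subset [range rng], and [gmul] is total but constrained only on composable
   pairs ([src x = rng y]).  The type is pointed because measurable types are;
   this only excludes the empty groupoid. *)
HB.mixin Record isGroupoid G := {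
  rng : G -> G;
  src : G -> G;
  gmul : G -> G -> G;
  ginv : G -> G;
  rng_rng : forall x, rng (rng x) = rng x;
  src_rng : forall x, src (rng x) = rng x;
  rng_src : forall x, rng (src x) = src x;
  src_src : forall x, src (src x) = src x;
  rng_gmul : forall x y, src x = rng y -> rng (gmul x y) = rng x;
  src_gmul : forall x y, src x = rng y -> src (gmul x y) = src y;
  gmulA : forall x y z, src x = rng y -> src y = rng z ->
    gmul x (gmul y z) = gmul (gmul x y) z;
  gmul_rng : forall x, gmul (rng x) x = x;
  gmul_src : forall x, gmul x (src x) = x;
  rng_ginv : forall x, rng (ginv x) = src x;
  src_ginv : forall x, src (ginv x) = rng x;
  gmulxV : forall x, gmul x (ginv x) = rng x;
  gmulVx : forall x, gmul (ginv x) x = src x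
}.

#[short(type="groupoidType")]
HB.structure Definition Groupoid := {G of PointedTopological G & isGroupoid G}.

Definition composable (G : groupoidType) : set (G * G) :=
  [set p | src p.1 = rng p.2].

HB.mixin Record isTopGroupoid G of Groupoid G := {
  ginv_continuous : continuous (ginv : G -> G);
  gmul_continuous :
    {within @composable G, continuous (fun p : G * G => gmul p.1 p.2)}
}.

#[short(type="topGroupoidType")]
HB.structure Definition TopGroupoid := {G of Groupoid G & isTopGroupoid G}.

Notation borel T := (g_sigma_algebraType (@open T)).

Section groupoid_notions.
Variable G : topGroupoidType.

Definition unit_space : set G := range rng.
Definition rfiber (u : G) : set G := [set x | rng x = u].
Definition sfiber (u : G) : set G := [set x | src x = u].

Lemma measurable_ginv : measurable_fun [set: borel G] (ginv : borel G -> borel G).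
Proof.
apply: (@measurability _ _ (borel G) (borel G) _ _ (@open G)) => //.
move=> _ [U oU <-]; rewrite setTI; apply: sub_sigma_algebra.
by apply: open_comp => // x _; exact: ginv_continuous.
Qed.

End groupoid_notions.
Arguments unit_space : clear implicits.

Section haar.
Variables (R : realType) (G : topGroupoidType).
Implicit Types (lam : G -> {measure set (borel G) -> \bar R}).

(* Integral of complex-valued functions, componentwise. *)
Definition cintegral d (T : measurableType d) (mu : {measure set T -> \bar R})
    (D : set T) (f : T -> R[i]) : R[i] :=
  (\int[mu]_(x in D) complex.Re (f x)) +i* (\int[mu]_(x in D) complex.Im (f x)).

Definition Cc (T : topologicalType) : set (T -> R[i]) :=
  [set a | continuous (a : T -> R[i]^o) /\ compact (closure [set x | a x != 0])].

Definition msupport (T : ptopologicalType)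
    (mu : {measure set (borel T) -> \bar R}) : set T :=
  [set x | forall U : set T, open_nbhs x U -> (0 < mu U)%E].

(* On a second countable locally compact Hausdorff space a Borel measure is
   Radon iff it is finite on compact sets.  Only the [lam u] with [u] a unit
   are meaningful. *)
Record is_haar_system lam : Prop := {
  haar_finite : forall u, unit_space G u ->
    forall K : set G, compact K -> (lam u K < +oo)%E;
  haar_support : forall u, unit_space G u -> msupport (lam u) = rfiber u;
  haar_continuous : forall f, Cc f ->
    {within unit_space G,
       continuous (fun u => cintegral (lam u) (rfiber u) f : R[i]^o)};
  haar_left_invariant : forall (x : G) f, Cc f ->
    cintegral (lam (src x)) (rfiber (src x)) (fun y => f (gmul x y)) =
    cintegral (lam (rng x)) (rfiber (rng x)) f
}.

(* lam_u, the push-forward of lam^u under inversion. *)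
Definition haar_inv lam (u : G) : set (borel G) -> \bar R :=
  pushforward (lam u) (ginv : borel G -> borel G).

Section haar_inv_measure.
Variables (lam : G -> {measure set (borel G) -> \bar R}) (u : G).
Let mginv := @measurable_ginv G.

Let haar_inv0 : haar_inv lam u set0 = 0%E.
Proof. by rewrite /haar_inv /pushforward preimage_set0 measure0. Qed.

Let haar_inv_ge0 A : (0 <= haar_inv lam u A)%E.
Proof. exact: measure_ge0. Qed.

Let haar_inv_sigma_additive : semi_sigma_additive (haar_inv lam u).
Proof. exact: measure_semi_sigma_additive. Qed.

HB.instance Definition _ := isMeasure.Build _ _ _ (haar_inv lam u)
  haar_inv0 haar_inv_ge0 haar_inv_sigma_additive.

End haar_inv_measure.

Definition conv lam (a b : G -> R[i]) : G -> R[i] := fun x =>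
  cintegral (lam (rng x)) (rfiber (rng x))
    (fun y => a y * b (gmul (ginv y) x)).

Definition invol (a : G -> R[i]) : G -> R[i] := fun x => (a (ginv x))^*.

Definition Inorm lam (a : G -> R[i]) : \bar R :=
  Order.max
    (ereal_sup [set (\int[lam u]_(x in rfiber u) (complex.Re `|a x|)%:E)%E
               | u in unit_space G])
    (ereal_sup [set (\int[haar_inv lam u]_(x in sfiber u) (complex.Re `|a x|)%:E)%E
               | u in unit_space G]).

End haar.

Arguments Cc {R}.

(* The norm of a module over [R[i]] is itself a (nonnegative real) element of
   [R[i]]; [rnorm] is its value in [R]. *)
Definition rnorm (R : realType) (V : normedModType R[i]) (x : V) : R :=
  complex.Re `|x|.

Definition opnorm (R : realType) (V W : normedModType R[i]) (T : V -> W) : \bar R :=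
  ereal_sup [set (rnorm (T x))%:E | x in [set x | rnorm x <= 1]].

Record hilbertSpace (R : realType) := HilbertSpace {
  hilbert_sort :> completeNormedModType R[i];
  inner : hilbert_sort -> hilbert_sort -> R[i];
  inner_linear : forall k x y z,
    inner (k *: x + y) z = k * inner x z + inner y z;
  inner_conj : forall x y, inner y x = (inner x y)^*;
  inner_norm : forall x, inner x x = `|x| ^+ 2
}.

(* C*-algebras need not be unital. *)
Record cstarAlgebra (R : realType) := CstarAlgebra {
  cstar_sort :> completeNormedModType R[i];
  cmul : cstar_sort -> cstar_sort -> cstar_sort;
  cstar : cstar_sort -> cstar_sort;
  cmulA : forall x y z, cmul x (cmul y z) = cmul (cmul x y) z;
  cmul_linearl : forall k x y z, cmul (k *: x + y) z = k *: cmul x z + cmul y z;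
  cmul_linearr : forall k x y z, cmul z (k *: x + y) = k *: cmul z x + cmul z y;
  cstarK : forall x, cstar (cstar x) = x;
  cstar_antilinear : forall k x y, cstar (k *: x + y) = k^* *: cstar x + cstar y;
  cstar_cmul : forall x y, cstar (cmul x y) = cmul (cstar y) (cstar x);
  cmul_norm : forall x y, `|cmul x y| <= `|x| * `|y|;
  cstar_norm : forall x, `|cmul (cstar x) x| = `|x| ^+ 2
}.

Record is_star_hom (R : realType) (A B : cstarAlgebra R) (phi : A -> B) : Prop := {
  star_hom_linear : linear phi;
  star_hom_mul : forall x y, phi (cmul x y) = cmul (phi x) (phi y);
  star_hom_star : forall x, phi (cstar x) = cstar (phi x)
}.

Section groupoid_cstar.
Variables (R : realType) (G : topGroupoidType).
Variable lam : G -> {measure set (borel G) -> \bar R}.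

(* [pi] is constrained only on C_c(G). *)
Record is_star_rep (H : hilbertSpace R) (pi : (G -> R[i]) -> H -> H) : Prop := {
  rep_linear : forall a, Cc G a -> linear (pi a);
  rep_bounded : forall a, Cc G a -> (opnorm (pi a) < +oo)%E;
  rep_scale_add : forall k a b, Cc G a -> Cc G b -> forall h,
    pi (fun x => k * a x + b x) h = k *: pi a h + pi b h;
  rep_conv : forall a b, Cc G a -> Cc G b -> forall h,
    pi (conv lam a b) h = pi a (pi b h);
  rep_invol : forall a, Cc G a -> forall h k,
    inner (pi a h) k = inner h (pi (invol a) k)
}.

Definition full_norm (a : G -> R[i]) : \bar R :=
  ereal_sup [set y | exists (H : hilbertSpace R) (pi : (G -> R[i]) -> H -> H),
    [/\ is_star_rep pi,
        forall b, Cc G b -> (opnorm (pi b) <= Inorm lam b)%E &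
        y = opnorm (pi a)]].

Definition L2norm d (T : measurableType d) (mu : {measure set T -> \bar R})
    (D : set T) (h : T -> R[i]) : \bar R :=
  ((\int[mu]_(x in D) ((complex.Re `|h x|) ^+ 2)%:E) `^ 2^-1)%E.

Definition L2 d (T : measurableType d) (mu : {measure set T -> \bar R})
    (D : set T) : set (T -> R[i]) :=
  [set h | [/\ measurable_fun D (fun x => complex.Re (h x)),
               measurable_fun D (fun x => complex.Im (h x)) &
               (L2norm mu D h < +oo)%E]].

(* The operator norm of h |-> a * h on L^2(Gu, lam_u), computed on
   representatives: elements of [L2] are functions on G of which only the
   values on Gu = [sfiber u] are used. *)
Definition reg_norm (u : G) (a : G -> R[i]) : \bar R :=
  ereal_sup [set L2norm (haar_inv lam u) (sfiber u) (conv lam a h)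
            | h in [set h | L2 (haar_inv lam u) (sfiber u) h /\
                            (L2norm (haar_inv lam u) (sfiber u) h <= 1)%E]].

Definition reduced_norm (a : G -> R[i]) : \bar R :=
  ereal_sup [set reg_norm u a | u in unit_space G].

(* [j : C_c(G) -> A] exhibits A as the C*-algebra completion of the *-algebra
   C_c(G) for the norm [nrm] (which determines A up to isometric
   *-isomorphism); [j] is constrained only on C_c(G). *)
Record is_completion (nrm : (G -> R[i]) -> \bar R) (A : cstarAlgebra R)
    (j : (G -> R[i]) -> A) : Prop := {
  compl_scale_add : forall k a b, Cc G a -> Cc G b ->
    j (fun x => k * a x + b x) = k *: j a + j b;
  compl_conv : forall a b, Cc G a -> Cc G b -> j (conv lam a b) = cmul (j a) (j b);
  compl_invol : forall a, Cc G a -> j (invol a) = cstar (j a);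
  compl_norm : forall a, Cc G a -> (rnorm (j a))%:E = nrm a;
  compl_dense : dense (j @` Cc G)
}.

End groupoid_cstar.

Record contHom (G : topGroupoidType) (Gam : groupType) := ContHom {
  hom_fun :> G -> Gam;
  hom_continuous : continuous (hom_fun : G -> discrete_topology Gam);
  hom_gmul : forall x y, composable (x, y) ->
    hom_fun (gmul x y) = (hom_fun x * hom_fun y)%g
}.

Definition kerset (G : topGroupoidType) (Gam : groupType) (c : contHom G Gam) :
  set G := c @^-1` [set 1%g].

(* G_e, with the subspace topology inherited from G. *)
Definition kergrp (G : topGroupoidType) (Gam : groupType) (c : contHom G Gam) :=
  set_type (kerset c).

Section kernel_groupoid.
Variables (G : topGroupoidType) (Gam : groupType) (c : contHom G Gam).
Local Notation Ge := (kergrp c).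

Lemma kerset_rng x : rng x \in kerset c.
Proof.
rewrite inE /kerset /=; have := @hom_gmul _ _ c (rng x) (rng x).
rewrite /composable /= src_rng rng_rng => /(_ erefl).
have -> : gmul (rng x) (rng x) = rng x by rewrite -{1}[rng x]rng_rng gmul_rng.
by move/(congr1 (fun z => z * (c (rng x))^-1)%g); rewrite mulgV mulgK.
Qed.

Lemma kerset_src x : src x \in kerset c.
Proof. by rewrite -rng_src kerset_rng. Qed.

Lemma kerset_gmul x y : x \in kerset c -> y \in kerset c -> src x = rng y ->
  gmul x y \in kerset c.
Proof.
rewrite !inE /kerset /= => cx cy xy.
by rewrite hom_gmul// cx cy mulg1.
Qed.

Lemma kerset_ginv x : x \in kerset c -> ginv x \in kerset c.
Proof.
rewrite !inE /kerset /= => cx; have := @hom_gmul _ _ c x (ginv x).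
rewrite /composable/= rng_ginv => /(_ erefl).
rewrite gmulxV cx mul1g => <-.
by have := kerset_rng x; rewrite inE.
Qed.

Lemma open_kerset : open (kerset c).
Proof.
have /continuousP := @hom_continuous _ _ c; apply; exact: discrete_open.
Qed.

Lemma closed_kerset : closed (kerset c).
Proof.
apply: (@preimage_closed _ (discrete_topology Gam) c); last exact: discrete_closed.
by move=> x _; exact: hom_continuous.
Qed.

Definition to_ker (x : G) (cx : x \in kerset c) : Ge := exist _ x cx.

HB.instance Definition _ := SubChoice.copy Ge (set_type (kerset c)).
HB.instance Definition _ := Topological.copy Ge (set_type (kerset c)).
HB.instance Definition _ := isPointed.Build Ge (to_ker (kerset_rng point)).

Definition ker_rng (x : Ge) : Ge := to_ker (kerset_rng (val x)).
Definition ker_src (x : Ge) : Ge := to_ker (kerset_src (val x)).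
Definition ker_ginv (x : Ge) : Ge := to_ker (kerset_ginv (valP x)).
(* The default value [x] is used only when x and y are not composable. *)
Definition ker_gmul (x y : Ge) : Ge := insubd x (gmul (val x) (val y)).

Lemma val_ker_gmul x y : src (val x) = rng (val y) ->
  val (ker_gmul x y) = gmul (val x) (val y).
Proof. by move=> xy; rewrite val_insubd kerset_gmul ?(valP x) ?(valP y). Qed.

Let ker_rng_gmul x y : ker_src x = ker_rng y ->
  ker_rng (ker_gmul x y) = ker_rng x.
Proof.
by move=> /(congr1 val)/= xy; apply: val_inj; rewrite /= val_ker_gmul// rng_gmul.
Qed.

Let ker_src_gmul x y : ker_src x = ker_rng y ->
  ker_src (ker_gmul x y) = ker_src y.
Proof.
by move=> /(congr1 val)/= xy; apply: val_inj; rewrite /= val_ker_gmul// src_gmul.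
Qed.

Let ker_gmulA x y z : ker_src x = ker_rng y -> ker_src y = ker_rng z ->
  ker_gmul x (ker_gmul y z) = ker_gmul (ker_gmul x y) z.
Proof.
move=> /(congr1 val)/= xy /(congr1 val)/= yz; apply: val_inj.
rewrite !val_ker_gmul ?gmulA//.
  by rewrite src_gmul.
by rewrite rng_gmul.
Qed.

Let ker_gmul_rng x : ker_gmul (ker_rng x) x = x.
Proof. by apply: val_inj; rewrite val_ker_gmul /= ?gmul_rng ?src_rng. Qed.

Let ker_gmul_src x : ker_gmul x (ker_src x) = x.
Proof. by apply: val_inj; rewrite val_ker_gmul /= ?gmul_src ?rng_src. Qed.

Let ker_gmulxV x : ker_gmul x (ker_ginv x) = ker_rng x.
Proof. by apply: val_inj; rewrite val_ker_gmul /= ?gmulxV ?rng_ginv. Qed.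

Let ker_gmulVx x : ker_gmul (ker_ginv x) x = ker_src x.
Proof. by apply: val_inj; rewrite val_ker_gmul /= ?gmulVx ?src_ginv. Qed.

Let ker_rng_rng x : ker_rng (ker_rng x) = ker_rng x.
Proof. by apply: val_inj; exact: rng_rng. Qed.

Let ker_src_rng x : ker_src (ker_rng x) = ker_rng x.
Proof. by apply: val_inj; exact: src_rng. Qed.

Let ker_rng_src x : ker_rng (ker_src x) = ker_src x.
Proof. by apply: val_inj; exact: rng_src. Qed.

Let ker_src_src x : ker_src (ker_src x) = ker_src x.
Proof. by apply: val_inj; exact: src_src. Qed.

Let ker_rng_ginv x : ker_rng (ker_ginv x) = ker_src x.
Proof. by apply: val_inj; exact: rng_ginv. Qed.

Let ker_src_ginv x : ker_src (ker_ginv x) = ker_rng x.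
Proof. by apply: val_inj; exact: src_ginv. Qed.

HB.instance Definition _ := @isGroupoid.Build Ge
  ker_rng ker_src ker_gmul ker_ginv
  ker_rng_rng
  ker_src_rng
  ker_rng_src
  ker_src_src
  ker_rng_gmul ker_src_gmul ker_gmulA ker_gmul_rng ker_gmul_src
  ker_rng_ginv
  ker_src_ginv
  ker_gmulxV ker_gmulVx.

Lemma val_ker_continuous : continuous (val : Ge -> G).
Proof. exact: initial_continuous. Qed.

Let cvg_ker (T : topologicalType) (F : set_system T) (f : T -> Ge) (l : Ge) :
  Filter F -> (fun t => val (f t)) @ F --> val l -> f @ F --> l.
Proof.
move=> FF cf U [_ [[W oW <-] Wl /filterS]]; apply; apply: cf.
exact: open_nbhs_nbhs.
Qed.

Let ker_ginv_continuous : continuous (ginv : Ge -> Ge).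
Proof.
have h : continuous ((ginv : G -> G) \o (val : Ge -> G)).
  move=> y; apply: continuous_comp; first exact: val_ker_continuous.
  exact: ginv_continuous.
by move=> x; apply: cvg_ker; [exact: nbhs_filter|exact: (h x)].
Qed.

Let ker_gmul_continuous :
  {within @composable Ge, continuous (fun p : Ge * Ge => gmul p.1 p.2)}.
Proof.
apply/subspace_continuousP => -[x y] /= xy; apply: cvg_ker => U.
have vxy : composable (val x, val y) by exact: (congr1 val (xy : src x = rng y)).
rewrite val_ker_gmul//.
have /subspace_continuousP/(_ (val x, val y) vxy) gc :=
  @gmul_continuous G.
move=> /gc /= gcU.
case: gcU => -[A B] /= [nA nB] AB.
exists (val @^-1` A, val @^-1` B).
  by split; exact: val_ker_continuous.
move=> [p q] /= [Ap Bq] pq.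
have vpq : composable (val p, val q) by exact: (congr1 val (pq : src p = rng q)).
by rewrite val_ker_gmul//; exact: (AB (val p, val q)).
Qed.

HB.instance Definition _ :=
  isTopGroupoid.Build Ge ker_ginv_continuous ker_gmul_continuous.

Lemma open_val_image (A : set Ge) : open A -> open (val @` A : set G).
Proof.
move=> [W oW <-].
have -> : val @` ((val : Ge -> G) @^-1` W) = W `&` kerset c.
  apply/seteqP; split=> [_ [x Wx <-]|x [Wx cx]].
    by split=> //; have := valP x; rewrite inE.
  by exists (to_ker (mem_set cx)).
exact: openI open_kerset.
Qed.

Lemma measurable_val_image (A : set Ge) :
  measurable (A : set (borel Ge)) -> measurable (val @` A : set (borel G)).
Proof.
move=> mA; apply: (mA [set B | measurable (val @` B : set (borel G))]).
split=> [|B /= oB]; last by apply: sub_sigma_algebra; exact: open_val_image.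
split=> /= [|B mB|F mF].
- by rewrite image_set0; exact: measurable0.
- have -> : val @` (setT `\` B) = kerset c `\` (val @` B : set (borel G)).
    apply/seteqP; split=> [_ [x [_ Bx] <-]|x [cx Bx]].
      split; first by have := valP x; rewrite inE.
      by move=> [y By] /val_inj yx; apply: Bx; rewrite -yx.
    exists (to_ker (mem_set cx)) => //; split=> // Bx'; apply: Bx.
    by exists (to_ker (mem_set cx)).
  apply: measurableD => //; apply: sub_sigma_algebra; exact: open_kerset.
- by rewrite image_bigcup; exact: bigcup_measurable.
Qed.

Lemma measurable_val_ker : measurable_fun [set: borel Ge] (val : borel Ge -> borel G).
Proof.
apply: (@measurability _ _ (borel Ge) (borel G) _ _ (@open G)) => //.
move=> _ [U oU <-]; rewrite setTI; apply: sub_sigma_algebra.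
by apply: open_comp => // x _; exact: val_ker_continuous.
Qed.

Section haar_restriction.
Variables (R : realType) (lam : G -> {measure set (borel G) -> \bar R}).

(* lam^u restricted to the Borel subsets of G_e. *)
Definition haar_restr (u : Ge) : set (borel Ge) -> \bar R :=
  fun A => lam (val u) (val @` A).

Let haar_restr0 u : haar_restr u set0 = 0%E.
Proof. by rewrite /haar_restr image_set0 measure0. Qed.

Let haar_restr_ge0 u A : (0 <= haar_restr u A)%E.
Proof. exact: measure_ge0. Qed.

Let haar_restr_sigma_additive u : semi_sigma_additive (haar_restr u).
Proof.
move=> F mF tF mUF; rewrite /haar_restr image_bigcup.
apply: measure_semi_sigma_additive.
- by move=> n; exact: measurable_val_image.
- apply/trivIsetP => i j _ _ ij; rewrite -subset0 => _ [[x Fx <-]] [y Fy].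
  move=> /val_inj yx; move/trivIsetP : tF => /(_ i j Logic.I Logic.I ij).
  by rewrite -subset0; apply; split; [exact: Fx|rewrite -yx].
- by apply: bigcup_measurable => n _; exact: measurable_val_image.
Qed.

HB.instance Definition _ u := isMeasure.Build _ _ _ (haar_restr u)
  (haar_restr0 u) (haar_restr_ge0 u) (@haar_restr_sigma_additive u).

End haar_restriction.

End kernel_groupoid.

(* The extension by zero i : C_c(G_e) -> C_c(G). *)
Definition ker_extend (R : realType) (G : topGroupoidType) (Gam : groupType)
    (c : contHom G Gam) (f : kergrp c -> R[i]) : G -> R[i] :=
  fun x => if insub x is Some y then f y else 0.

Section haar_restriction_is_haar.
Variables (R : realType) (G : topGroupoidType) (Gam : groupType).
Variable c : contHom G Gam.
Local Notation Ge := (kergrp c).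
Implicit Types (f : Ge -> R[i]) (lam : G -> {measure set (borel G) -> \bar R}).

Lemma ker_extend_val f (x : Ge) : ker_extend f (val x) = f x.
Proof. by rewrite /ker_extend valK. Qed.

Lemma ker_extend_out f (x : G) : ~ kerset c x -> ker_extend f x = 0.
Proof. by move=> cx; rewrite /ker_extend insubN// notin_setE. Qed.

Lemma ker_extend_neq0 f :
  [set x | ker_extend f x != 0] = val @` [set x | f x != 0].
Proof.
apply/seteqP; split=> [x /=|_ [x fx <-] /=]; last by rewrite ker_extend_val.
rewrite /ker_extend; case: insubP => [y _ <- fy|]; last by rewrite eqxx.
by exists y.
Qed.

Lemma ker_extend_Cc f : hausdorff_space G -> Cc Ge f -> Cc G (ker_extend f).
Proof.
move=> hG [cf sf]; split.
  move=> x; have [cx|cx] := pselect (kerset c x).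
    pose y : Ge := to_ker (mem_set cx).
    move=> U /=; rewrite (ker_extend_val f y : ker_extend f x = f y).
    move=> /(cf y) nU.
    have : nbhs y (f @^-1` U) by exact: nU.
    rewrite nbhsE => -[V [oV Vy] VU].
    rewrite nbhs_simpl nbhsE; exists (val @` V).
      split; first exact: open_val_image.
      by exists y.
    by move=> _ [z Vz <-] /=; rewrite ker_extend_val; exact: VU.
  move=> U /=; rewrite ker_extend_out// => /nbhs_singleton U0.
  rewrite nbhs_simpl nbhsE; exists (~` kerset c).
    by split=> //; rewrite openC; exact: closed_kerset.
  by move=> z cz /=; rewrite ker_extend_out.
have cv : compact (val @` closure [set x | f x != 0] : set G).
  apply: continuous_compact sf; apply: continuous_subspaceT.
  exact: val_ker_continuous.
apply: (subclosed_compact _ cv); first exact: closed_closure.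
rewrite ker_extend_neq0 closureE; apply: smallest_sub.
  exact: (compact_closed hG cv).
by apply: image_subset; exact: subset_closure.
Qed.

Lemma rng_continuous : continuous (rng : G -> G).
Proof.
move=> x; have /subspace_continuousP/(_ (x, ginv x)) := @gmul_continuous G.
rewrite /composable /= rng_ginv => /(_ erefl) gc U.
rewrite -[rng x]gmulxV => /gc [[A B] /= [nA nB] AB].
have := @ginv_continuous G _ _ nB; rewrite /= !nbhs_simpl => nB'.
apply: filterS2 nA nB' => y Ay By /=.
have /= := AB (y, ginv y) (conj Ay By); rewrite rng_ginv => /(_ erefl).
by rewrite /from_subspace /= gmulxV.
Qed.

Lemma closed_rfiber : hausdorff_space G -> forall u : G, closed (rfiber u).
Proof.
move=> hG u; apply: (@preimage_closed _ _ (rng : G -> G) [set u]).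
  by move=> x _; exact: rng_continuous.
by apply: accessible_closed_set1; exact: hausdorff_accessible.
Qed.

Lemma measurable_rfiber : hausdorff_space G ->
  forall u : G, measurable (rfiber u : set (borel G)).
Proof.
move=> hG u; rewrite -[rfiber u]setCK; apply: measurableC.
by apply: sub_sigma_algebra; rewrite openC; exact: closed_rfiber.
Qed.

Lemma continuous_Re : continuous (@complex.Re R : R[i]^o -> R).
Proof.
move=> x U /= [e e0 eU]; exists e%:C; first by rewrite /= (ltcR 0 e).
move=> t /= xt; apply: eU => /=; rewrite -ltcR; apply: le_lt_trans xt.
have := normc_ge_Re (x - t); rewrite raddfB; exact.
Qed.

Lemma continuous_Im : continuous (@complex.Im R : R[i]^o -> R).
Proof.
move=> x U /= [e e0 eU]; exists e%:C; first by rewrite /= (ltcR 0 e).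
move=> t /= xt; apply: eU => /=; rewrite -ltcR; apply: le_lt_trans xt.
have := normc_ge_Re ((x - t) * (- 'i)); rewrite normrM normrN normCi mulr1.
have -> : complex.Re ((x - t) * (- 'i)) = complex.Im (x - t).
  by case: (x - t) => a b; rewrite mulrN mulrC; simpc.
by rewrite raddfB.
Qed.

Lemma measurable_within (T : ptopologicalType) (D : set T) (g : T -> R) :
  {within D, continuous g} ->
  measurable_fun (D : set (borel T)) (g : borel T -> R).
Proof.
move=> /continuousP cg mD.
apply: (@measurability _ _ (borel T) R D g _ (RGenOpens.measurableE R)) => //.
move=> _ [_ [a [b ->]] <-].
have /open_subspaceP[V oV VD] := cg _ (@interval_open R (BRight a) (BLeft b) isT isT).
rewrite setIC -VD; apply: measurableI => //; exact: sub_sigma_algebra.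
Qed.

Lemma ge0_integral_haar_restr lam (u : Ge) (D : set Ge) (h : G -> \bar R) :
  measurable (D : set (borel Ge)) ->
  measurable_fun (val @` D : set (borel G)) h ->
  (forall x, 0 <= h x)%E ->
  (\int[haar_restr lam u]_(x in D) h (val x) =
   \int[lam (val u)]_(x in val @` D) h x)%E.
Proof.
move=> mD mh h0; have mV := measurable_val_image mD.
pose nu : {measure set (borel Ge) -> \bar R} := haar_restr lam u.
pose mv := @measurable_val_ker _ _ c.
pose pm : {measure set (borel G) -> \bar R} :=
  pushforward nu (val : borel Ge -> borel G).
rewrite (@eq_measure_integral _ _ _ _ (pm mv)); last first.
  move=> A mA AD; rewrite /pm /= /pushforward /nu /= /haar_restr.
  congr (lam _ _); apply/seteqP; split=> [x Ax|_ [x Ax <-]//].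
  by have [y _ yx] := AD _ Ax; exists y => //; rewrite /preimage/= yx.
rewrite ge0_integral_pushforward//.
have -> // : (val : borel Ge -> borel G) @^-1` (val @` D) = D.
by apply/seteqP; split=> [x [y Dy /val_inj <-]//|x Dx]; exists x.
Qed.

Lemma integral_haar_restr lam (u : Ge) (D : set Ge) (g : G -> R) :
  measurable (D : set (borel Ge)) ->
  measurable_fun (val @` D : set (borel G)) (g : borel G -> R) ->
  \int[haar_restr lam u]_(x in D) g (val x) =
  \int[lam (val u)]_(x in val @` D) g x.
Proof.
move=> mD mg; have /measurable_EFinP mg' := mg; rewrite /Rintegral; congr fine.
rewrite integralE [RHS]integralE; congr (_ - _)%E.
  rewrite -(@ge0_integral_haar_restr lam u D ((EFin \o g)^\+)%E)//; first last.
  - exact: measurable_funepos.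
  - by apply: eq_integral => x _; rewrite !funeposE.
rewrite -(@ge0_integral_haar_restr lam u D ((EFin \o g)^\-)%E)//; first last.
- exact: measurable_funeneg.
- by apply: eq_integral => x _; rewrite !funenegE.
Qed.

Lemma cintegral_haar_restr lam (u : Ge) (D : set Ge) (g : G -> R[i]) :
  measurable (D : set (borel Ge)) ->
  {within val @` D, continuous (g : G -> R[i]^o)} ->
  cintegral (haar_restr lam u) D (fun x => g (val x)) =
  cintegral (lam (val u)) (val @` D) g.
Proof.
move=> mD cg; congr (_ +i* _).
  apply: (@integral_haar_restr lam u D (fun x => complex.Re (g x))) => //.
  apply: measurable_within => x.
  apply: (@continuous_comp (subspace (val @` D)) R[i]^o R g (@complex.Re R)).
    exact: cg.
  exact: continuous_Re.
apply: (@integral_haar_restr lam u D (fun x => complex.Im (g x))) => //.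
apply: measurable_within => x.
apply: (@continuous_comp (subspace (val @` D)) R[i]^o R g (@complex.Im R)).
  exact: cg.
exact: continuous_Im.
Qed.

Lemma cintegral_mkcond lam (u : G) (D : set G) (g : G -> R[i]) :
  (forall x, D x -> ~ kerset c x -> g x = 0) ->
  cintegral (lam u) (D `&` kerset c) g = cintegral (lam u) D g.
Proof.
move=> g0; congr (_ +i* _); congr fine; rewrite integral_mkcond [RHS]integral_mkcond;
  congr integral; apply/funext => x; rewrite /patch in_setI;
  case: (boolP (x \in D)) => //=; rewrite inE => Dx;
  case: ifPn => //; rewrite notin_setE => cx; by rewrite g0.
Qed.

Lemma haar_restr_is_haar_system lam : hausdorff_space G ->
  is_haar_system lam -> is_haar_system (haar_restr lam : Ge -> _).
Proof.
move=> hG [fin supp cont inv].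
have unitV (u : Ge) : unit_space Ge u -> unit_space G (val u).
  by move=> [v _ <-]; exists (val v).
have valr (u : Ge) : val @` rfiber u = rfiber (val u) `&` kerset c.
  apply/seteqP; split=> [_ [x <- <-]|x [/= xu cx]].
    by split=> //=; have := valP x; rewrite inE.
  by exists (to_ker (mem_set cx)) => //; apply: val_inj.
have mr (u : Ge) : measurable (rfiber u : set (borel Ge)).
  have -> : rfiber u = (val : borel Ge -> borel G) @^-1` rfiber (val u).
    apply/seteqP; split=> [x <-//|x /= xu]; exact: val_inj.
  rewrite -[X in measurable X]setTI; apply: (@measurable_val_ker _ _ c) => //.
  exact: measurable_rfiber.
have E f (u : Ge) : Cc Ge f ->
    cintegral (haar_restr lam u) (rfiber u) f =
    cintegral (lam (val u)) (rfiber (val u)) (ker_extend f).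
  move=> Cf; have [cF _] := ker_extend_Cc hG Cf.
  rewrite -cintegral_mkcond; last by move=> x _; exact: ker_extend_out.
  rewrite -valr -cintegral_haar_restr//; last exact: continuous_subspaceT.
  by congr cintegral; apply/funext => x; rewrite ker_extend_val.
split.
- move=> u /unitV uu K cK; rewrite /= /haar_restr; apply: fin => //.
  apply: continuous_compact cK; apply: continuous_subspaceT.
  exact: val_ker_continuous.
- move=> u /unitV uu; apply/seteqP; split=> [x xs|x xu].
    suff : rfiber (val u) (val x) by move=> ?; apply: val_inj.
    rewrite -supp// => W [oW Wx].
    have oV : open_nbhs x (val @^-1` W).
      by split=> //; apply: open_comp => // y _; exact: val_ker_continuous.
    apply: lt_le_trans (xs _ oV) _; rewrite /= /haar_restr.
    apply: le_measure; rewrite ?inE.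
    + by apply: sub_sigma_algebra; apply: open_val_image; case: oV.
    + exact: sub_sigma_algebra.
    + by move=> _ [y Wy <-].
  move=> U [oU Ux]; rewrite /= /haar_restr.
  have : rfiber (val u) (val x) by rewrite -xu.
  rewrite -supp//; apply; split; first exact: open_val_image.
  by exists x.
- move=> f Cf; under eq_fun do rewrite (E _ _ Cf).
  apply/subspace_continuousP => u uu U /=.
  have /subspace_continuousP/(_ _ (unitV _ uu)) := cont _ (ker_extend_Cc hG Cf).
  move=> /[apply] /= nU.
  have := @val_ker_continuous _ _ c u _ nU.
  apply: (@filterS Ge (nbhs u) (nbhs_filter u)) => v /= + uv.
  by rewrite ?(E _ _ Cf); apply; exact: unitV.
- move=> x f Cf; have [cF _] := ker_extend_Cc hG Cf.
  transitivity (cintegral (lam (val (src x))) (rfiber (val (src x)))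
      (fun y => ker_extend f (gmul (val x) y))).
    rewrite -cintegral_mkcond; last first.
      move=> y /= yx cy; apply: ker_extend_out => cxy; apply: cy.
      have xy : composable (val x, y) by [].
      have cx : c (val x) = 1%g by have := valP x; rewrite inE.
      by move: cxy; rewrite /kerset /= (hom_gmul c xy) /= cx mul1g.
    have cg : {within val @` rfiber (src x), continuous
        ((fun y => ker_extend f (gmul (val x) y)) : G -> R[i]^o)}.
      apply/subspace_continuousP => y; rewrite valr => -[/= yx cy] U /=.
      move=> /cF; rewrite nbhs_simpl /= => nU.
      have xy : composable (val x, y) by [].
      have /subspace_continuousP/(_ _ xy)/(_ _ nU) := @gmul_continuous G.
      move=> [[A B] /= [nA nB] AB].
      apply: (@filterS G (nbhs y) (nbhs_filter y) _ _ _ nB) => z Bz [/= zx _].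
      by apply: (AB (val x, z)) => //; split=> //; exact: nbhs_singleton nA.
    rewrite -(valr (src x)) -(cintegral_haar_restr lam (src x) (mr (src x)) cg).
    have fE y : rfiber (src x) y ->
        f (gmul x y) = ker_extend f (gmul (val x) (val y)).
      move=> yx; rewrite -ker_extend_val val_ker_gmul//.
      exact: (congr1 val (esym (yx : rng y = src x))).
    by congr (_ +i* _); apply: eq_Rintegral => y; rewrite inE => /fE ->.
  rewrite (E _ (rng x) Cf); exact: (inv (val x) _ (ker_extend_Cc hG Cf)).
Qed.

End haar_restriction_is_haar.

(* Main.v *)
(* Both maps come from equalities of norms: |i(f)| = |f| for the full and for the
   reduced norms on C_c(G_e); the isometry then extends by density.

   Full norm.  Representations of G restrict along i, which gives |i(f)| <= |f|.
   For the converse, let pi be a representation of C_c(G_e) and k a unit vector.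
   The functional phi(a) = <pi(a|G_e) k, k> on C_c(G) is positive: by compactness a is
   a finite sum of pieces a_g supported on the cosets c^-1(g), cross terms a_g^* a_h
   vanish on G_e, and a_g^* a_g is a limit in the I-norm of sums of elements b^* b with
   b = psi^* a_g supported in G_e, because finite sums of the operators
   psi * (psi^* * _), with psi of small support in the coset of g, approximate the
   identity.  The GNS representation of phi is bounded by the I-norm (iterate the
   Cauchy-Schwarz inequality) and restricts on the cyclic part to pi, so it
   witnesses |f| <= |i(f)|.

   Reduced norm.  G is a countable disjoint union of cosets of c, and right translation
   by z identifies L^2 of the fiber of G_e at r(z) with L^2 of the part of G_u,
   u = s(z), lying in the coset of z, intertwining convolution by f and by i(f).  So
   the regular representation of G at u restricts to a direct sum of regular
   representations of G_e. *)

(* A representation of C_c(G_e) need not extend to C_c(G) on the same Hilbert space, so only its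
   vector states are extended, by restricting functions to G_e. Positivity is the obstacle: for g !=
   e the element a_g^* a_g is not visibly of the form b^* b with b on G_e. Inserting psi psi^* in
   the middle turns it into (psi^* a_g)^* (psi^* a_g), and psi^* moves the coset of g back to G_e;
   hence an approximate unit of exactly this square form. The extended functional is known to be
   continuous for the I-norm only, hence a pointwise error e |beta| with beta in C_c(G) independent
   of e. C_c(G_e) has no unit, so the GNS space holds copies of the vectors pi(g) k but not
   evidently of k. Testing i(f) on the vector of f^* gives N^2 <= C N, a bound for f^* and not for
   f; the star of a C*-algebra being isometric, this is enough. In the reduced case elements of L^2
   are functions, and a convolution may diverge at some points and take a default value there. The
   arguments therefore rest on nonnegative integrals, pointwise equal integrands and scaling by
   positive reals. *)
From HB Require Import structures.
Require Import Defs.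
From mathcomp Require Import all_boot all_order all_algebra complex.
From mathcomp Require Import ring lra.
From mathcomp Require Import all_classical all_reals all_analysis measurable_realfun.

Set Implicit Arguments.
Unset Strict Implicit.
Unset Printing Implicit Defensive.

Import Order.TTheory GRing.Theory Num.Theory.
Import numFieldNormedType.Exports.

Local Open Scope classical_set_scope.
Local Open Scope ring_scope.
Local Open Scope complex_scope.
Local Notation conv := Defs.conv.

(** * Isometric extensions of *-homomorphisms *)

Section rnorm_theory.
Variables (R : realType) (V : normedModType R[i]).
Implicit Types x y : V.

Lemma norm_rnorm x : `|x| = (rnorm x)%:C.
Proof. by rewrite /rnorm RRe_real// ger0_real. Qed.

Lemma rnorm_ge0 x : 0 <= rnorm x.
Proof. by rewrite -ler0c -norm_rnorm. Qed.

Lemma rnormD x y : rnorm (x + y) <= rnorm x + rnorm y.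
Proof. by rewrite -lecR rmorphD /= -!norm_rnorm ler_normD. Qed.

Lemma rnormN x : rnorm (- x) = rnorm x.
Proof. by rewrite /rnorm normrN. Qed.

Lemma rnormZ (k : R[i]) x : rnorm (k *: x) = complex.Re `|k| * rnorm x.
Proof.
by apply: complexI; rewrite rmorphM /= -!norm_rnorm normrZ.
Qed.

Lemma rnorm0 : rnorm (0 : V) = 0.
Proof. by rewrite /rnorm normr0. Qed.

Lemma rnorm_eq0 x : rnorm x = 0 -> x = 0.
Proof. by move=> x0; apply/eqP; rewrite -normr_eq0 norm_rnorm x0. Qed.

Lemma rnormB x y : rnorm (x - y) = rnorm (y - x).
Proof. by rewrite -rnormN opprB. Qed.

Lemma ball_rnorm x (e : R) y : ball x e%:C y <-> rnorm (x - y) < e.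
Proof. by rewrite -ball_normE /= norm_rnorm ltcR. Qed.

Lemma rnorm_dist_le x y : rnorm x <= rnorm y + rnorm (x - y).
Proof. by rewrite -{1}(subrK y x) addrC (le_trans (rnormD _ _)). Qed.

Lemma rnorm_ballP x (A : set V) :
  nbhs x A <-> exists2 e : R, 0 < e & forall y, rnorm (x - y) < e -> A y.
Proof.
split=> [/nbhs_ballP[e /= e0 eA]|[e e0 eA]].
  have eE : e = (complex.Re e)%:C by rewrite RRe_real// gtr0_real.
  exists (complex.Re e); first by rewrite -ltcR -eE.
  by move=> y /ball_rnorm; rewrite -eE; exact: eA.
apply/nbhs_ballP; exists e%:C; first by rewrite /= (ltcR 0 e).
by move=> y /ball_rnorm; exact: eA.
Qed.

End rnorm_theory.

Lemma rnorm_complete (R : realType) (V : completeNormedModType R[i])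
    (u : nat -> V) :
  (forall e : R, 0 < e ->
     exists N, forall n m, (N <= n)%N -> (N <= m)%N -> rnorm (u n - u m) < e) ->
  exists l, forall e : R, 0 < e ->
    exists N, forall n, (N <= n)%N -> rnorm (l - u n) < e.
Proof.
move=> uC; have : cvg (u @ \oo).
  apply: cauchy_cvg; apply/cauchy_ballP => e /= e0.
  have eE : e = (complex.Re e)%:C by rewrite RRe_real// gtr0_real.
  have [|N NP] := uC (complex.Re e); first by rewrite -ltcR -eE.
  exists ([set y | exists2 n, (N <= n)%N & y = u n],
          [set y | exists2 n, (N <= n)%N & y = u n]).
    by split; exists N => // n /= Nn; exists n.
  by move=> [_ _] [/= [n Nn ->] [m Nm ->]]; rewrite eE; apply/ball_rnorm/NP.
move=> /cvg_ex[l ul]; exists l => e e0.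
have : nbhs l (ball l e%:C) by apply: nbhsx_ballx; rewrite (ltcR 0 e).
by move=> /ul[N _ NP]; exists N => n Nn; apply/ball_rnorm; exact: NP.
Qed.

Lemma rnorm_dense (R : realType) (V : normedModType R[i]) (S : set V) :
  dense S -> forall x (e : R), 0 < e -> exists2 y, S y & rnorm (x - y) < e.
Proof.
move=> dS x e e0.
have e0' : 0 < e%:C :> R[i] by rewrite (ltcR 0 e).
have [||y [/interior_subset/ball_rnorm xy Sy]] := dS (interior (ball x e%:C)).
- by exists x; exact: nbhsx_ballx.
- exact: open_interior.
by exists y.
Qed.

Lemma half_triangle (R : realType) (V : normedModType R[i]) (x y z : V) (e : R) :
  rnorm (x - z) < e / 2 -> rnorm (y - z) < e / 2 -> rnorm (x - y) < e.
Proof.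
move=> xz yz; have -> : x - y = (x - z) + (z - y) by rewrite addrA subrK.
by rewrite (le_lt_trans (rnormD _ _))// (splitr e) ltrD// rnormB.
Qed.

Lemma rnorm_sub_lt_eq (R : realType) (V : normedModType R[i]) (x y : V) :
  (forall e : R, 0 < e -> rnorm (x - y) < e) -> x = y.
Proof.
move=> xy; apply/eqP; rewrite -subr_eq0; apply/eqP/rnorm_eq0/eqP.
rewrite eq_le rnorm_ge0 andbT leNgt; apply/negP => /xy.
by rewrite ltxx.
Qed.

Section isometric_extension.
Variables (R : realType) (X : Type) (P : set X).
Variables (A1 : normedModType R[i]) (A2 : completeNormedModType R[i]).
Variables (j1 : X -> A1) (j2 : X -> A2).
Hypothesis dense1 : dense (j1 @` P).
Hypothesis lin : forall (k : R[i]) a b, P a -> P b -> exists c,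
  [/\ P c, j1 c = k *: j1 a + j1 b & j2 c = k *: j2 a + j2 b].
Hypothesis iso : forall a, P a -> rnorm (j1 a) = rnorm (j2 a).

(* The extension is the closure of the graph of [j1 a |-> j2 a]. *)
Let near_graph (x : A1) (y : A2) := forall e : R, 0 < e ->
  exists a, [/\ P a, rnorm (x - j1 a) < e & rnorm (y - j2 a) < e].

Lemma iso_sub a b : P a -> P b -> rnorm (j1 a - j1 b) = rnorm (j2 a - j2 b).
Proof.
move=> Pa Pb; have [c [Pc c1 c2]] := lin (-1) Pb Pa.
by move: (iso Pc); rewrite c1 c2 !scaleN1r [- _ + j1 _]addrC [- _ + j2 _]addrC.
Qed.

(** Elements [a n] with [j1 (a n)] within [1/(n+1)] of [x] are sent by [j2] to a Cauchy sequence,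
    because [iso_sub] equates distances; its limit is the required point. *)
Let near_graph_ex x : exists y, near_graph x y.
Proof.
have H n : exists a, P a /\ rnorm (x - j1 a) < n.+1%:R^-1.
  have [|_ [a Pa <-] xa] := rnorm_dense dense1 x (e := n.+1%:R^-1).
    by rewrite invr_gt0 ltr0n.
  by exists a.
have [a aP] := choice H.
have inv_lt (e : R) : 0 < e -> exists N, forall n, (N <= n)%N -> n.+1%:R^-1 < e.
  move=> e0; exists (Num.trunc e^-1) => n Nn.
  rewrite invf_plt ?posrE ?ltr0n// (lt_le_trans (truncnS_gt _))//.
  by rewrite ler_nat ltnS.
have [e e0|y yP] := @rnorm_complete _ _ (fun n => j2 (a n)).
  have [N NP] := inv_lt (e / 2) (divr_gt0 e0 (ltr0Sn _ 1)).
  exists N => n m Nn Nm; rewrite -(iso_sub (aP n).1 (aP m).1).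
  apply: (@half_triangle _ _ _ _ x); rewrite rnormB;
    by rewrite (lt_trans (aP _).2)// NP.
exists y => e e0; have [N1 N1P] := inv_lt _ e0; have [N2 N2P] := yP _ e0.
exists (a (maxn N1 N2)); split; first exact: (aP _).1.
  by rewrite (lt_trans (aP _).2)// N1P// leq_maxl.
by rewrite N2P// leq_maxr.
Qed.

Let near_graph_lin k x x' y y' :
  near_graph x y -> near_graph x' y' -> near_graph (k *: x + x') (k *: y + y').
Proof.
move=> xy xy' e e0.
(* The denominator [|k| + 1] makes [|k| * d] at most [e / 2] and stays positive when [k = 0]. *)
pose d := (e / 2) / (complex.Re `|k| + 1).
have k0 : 0 <= complex.Re `|k| by exact: (@rnorm_ge0 R R[i]^o k).
have d0 : 0 < d by rewrite !divr_gt0// ltr_wpDl.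
have [a [Pa a1 a2]] := xy _ d0.
have [b [Pb b1 b2]] := xy' _ (divr_gt0 e0 (ltr0Sn _ 1)).
have [c [Pc c1 c2]] := lin k Pa Pb.
have est (W : normedModType R[i]) (u u' v v' : W) :
    rnorm (u - v) < d -> rnorm (u' - v') < e / 2 ->
    rnorm (k *: u + u' - (k *: v + v')) < e.
  move=> uv uv'; rewrite opprD addrACA -scalerBr (le_lt_trans (rnormD _ _))//.
  rewrite (splitr e) ler_ltD// rnormZ.
  apply: (@le_trans _ _ (complex.Re `|k| * d)); first by rewrite ler_wpM2l// ltW.
  rewrite /d mulrCA ler_piMr ?divr_ge0// ?ltW//.
  by rewrite ltr_pdivrMr ?ltr_wpDl// mul1r ltrDl.
by exists c; split; rewrite // ?c1 ?c2; exact: est.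
Qed.

Let near_graph_norm x y : near_graph x y -> rnorm x = rnorm y.
Proof.
move=> xy; apply/eqP; rewrite -subr_eq0 -normr_eq0 eq_le normr_ge0 andbT.
rewrite leNgt; apply/negP => d0.
have [a [Pa a1 a2]] := xy _ (divr_gt0 d0 (ltr0Sn _ 1)).
suff : `|rnorm x - rnorm y| < `|rnorm x - rnorm y| by rewrite ltxx.
rewrite {1}(_ : rnorm x - rnorm y =
  (rnorm x - rnorm (j1 a)) + (rnorm (j2 a) - rnorm y)); last first.
  by rewrite (iso Pa) addrA subrK.
rewrite (le_lt_trans (ler_normD _ _))// [ltRHS]splitr ltrD//.
  apply: le_lt_trans a1; rewrite ler_norml lerBlDl rnorm_dist_le andbT.
  by rewrite lerNl opprB lerBlDl rnormB rnorm_dist_le.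
apply: le_lt_trans a2; rewrite ler_norml lerBlDl rnormB rnorm_dist_le andbT.
by rewrite lerNl opprB lerBlDl rnormB rnorm_dist_le.
Qed.

Lemma isometric_extension : exists phi : A1 -> A2,
  [/\ linear phi, forall x, rnorm (phi x) = rnorm x,
      forall a, P a -> phi (j1 a) = j2 a &
      forall x (e : R), 0 < e ->
        exists a, [/\ P a, rnorm (x - j1 a) < e & rnorm (phi x - j2 a) < e]].
Proof.
have [phi phiP] := choice near_graph_ex.
(* Single-valuedness comes from the norm: the difference of two values over [x] is related to [0],
   hence has norm [0]. *)
have uniq x y : near_graph x y -> phi x = y.
  move=> xy; apply/eqP; rewrite -subr_eq0; apply/eqP/rnorm_eq0.
  have := near_graph_lin (-1) xy (phiP x).
  rewrite !scaleN1r addNr [- y + _]addrC => /near_graph_norm <-.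
  exact: rnorm0.
exists phi; split.
- by move=> k x y; apply: uniq; apply: near_graph_lin; exact: phiP.
- by move=> x; rewrite (near_graph_norm (phiP x)).
- by move=> a Pa; apply: uniq => e e0; exists a; rewrite !subrr !rnorm0.
- by move=> x e e0; exact: phiP.
Qed.

End isometric_extension.

Section cstar_extension.
Variables (R : realType) (X : Type) (P : set X) (A1 A2 : cstarAlgebra R).
Variables (j1 : X -> A1) (j2 : X -> A2).
Hypothesis dense1 : dense (j1 @` P).
Hypothesis lin : forall (k : R[i]) a b, P a -> P b -> exists c,
  [/\ P c, j1 c = k *: j1 a + j1 b & j2 c = k *: j2 a + j2 b].
Hypothesis mul : forall a b, P a -> P b -> exists c,
  [/\ P c, j1 c = cmul (j1 a) (j1 b) & j2 c = cmul (j2 a) (j2 b)].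
Hypothesis star : forall a, P a -> exists c,
  [/\ P c, j1 c = cstar (j1 a) & j2 c = cstar (j2 a)].
Hypothesis iso : forall a, P a -> rnorm (j1 a) = rnorm (j2 a).

Lemma rnorm_cmul (A : cstarAlgebra R) (x y : A) :
  rnorm (cmul x y) <= rnorm x * rnorm y.
Proof. by rewrite -lecR rmorphM /= -!norm_rnorm cmul_norm. Qed.

(** The C*-identity and submultiplicativity give [|y|^2 <= |y^*| |y|], so [|y| <= |y^*|]; the
    reverse is the same inequality for [y^*]. The full-norm estimate is proved for [invol f] and
    reaches [f] through this lemma. *)
Lemma rnorm_cstar (A : cstarAlgebra R) (x : A) : rnorm (cstar x) = rnorm x.
Proof.
have H (y : A) : rnorm y <= rnorm (cstar y).
  have [->|y0] := eqVneq (rnorm y) 0; first exact: rnorm_ge0.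
  have y1 : 0 < rnorm y by rewrite lt_def y0 rnorm_ge0.
  rewrite -(ler_pM2r y1) (le_trans _ (rnorm_cmul _ _))// -expr2.
  by rewrite -lecR rmorphXn /= -!norm_rnorm cstar_norm.
by apply/eqP; rewrite eq_le H andbT -{2}(cstarK x) H.
Qed.

Lemma cmulBl (A : cstarAlgebra R) (x y z : A) :
  cmul (x - y) z = cmul x z - cmul y z.
Proof. by have := cmul_linearl (-1) y x z; rewrite !scaleN1r addrC [RHS]addrC. Qed.

Lemma cmulBr (A : cstarAlgebra R) (x y z : A) :
  cmul z (x - y) = cmul z x - cmul z y.
Proof. by have := cmul_linearr (-1) y x z; rewrite !scaleN1r addrC [RHS]addrC. Qed.

Lemma cstarB (A : cstarAlgebra R) (x y : A) : cstar (x - y) = cstar x - cstar y.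
Proof.
have := cstar_antilinear (-1) y x; rewrite rmorphN rmorph1 !scaleN1r.
by rewrite addrC [RHS]addrC.
Qed.

(** The bound involves [x] and [y] alone, so that [d] can be fixed before the approximants [x'] and
    [y'] are known; [d <= 1] is what replaces [|x'|] by [|x| + 1]. *)
Lemma cmul_close (A : cstarAlgebra R) (x y x' y' : A) (d : R) : d <= 1 ->
  rnorm (x - x') <= d -> rnorm (y - y') <= d ->
  rnorm (cmul x y - cmul x' y') <= d * (rnorm x + rnorm y + 1).
Proof.
move=> d1 xx yy.
have d0 : 0 <= d by rewrite (le_trans _ xx)// rnorm_ge0.
have -> : cmul x y - cmul x' y' = cmul (x - x') y + cmul x' (y - y').
  by rewrite cmulBl cmulBr addrA subrK.
rewrite (le_trans (rnormD _ _))//.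
have -> : d * (rnorm x + rnorm y + 1) = d * rnorm y + (rnorm x + 1) * d by ring.
rewrite lerD//.
  by rewrite (le_trans (rnorm_cmul _ _))// ler_wpM2r ?rnorm_ge0.
rewrite (le_trans (rnorm_cmul _ _))// ler_pM ?rnorm_ge0//.
by rewrite (le_trans (rnorm_dist_le _ x))// lerD2l rnormB (le_trans xx).
Qed.

Lemma cstar_extension : exists phi : A1 -> A2,
  [/\ is_star_hom phi, injective phi & forall a, P a -> phi (j1 a) = j2 a].
Proof.
have [phi [phil phin phij phia]] := isometric_extension dense1 lin iso.
have phiB x y : phi (x - y) = phi x - phi y.
  by rewrite addrC -scaleN1r phil scaleN1r addrC.
exists phi; split => //; last first.
  move=> x y xy; apply/eqP; rewrite -subr_eq0; apply/eqP/rnorm_eq0.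
  by rewrite -phin phiB xy subrr rnorm0.
split=> // [x y|x].
- apply: rnorm_sub_lt_eq => e e0.
  pose C := rnorm x + rnorm y + 1.
  have C0 : 0 < C by rewrite ltr_wpDl// addr_ge0// rnorm_ge0.
  (* The quarter, where a half would do, makes [d * C < e / 2] strict. The same [d] serves in both
     algebras because [phi] preserves the norms of [x] and [y]. *)
  pose d := Num.min 1 (e / 4 / C).
  have d0 : 0 < d by rewrite lt_min ltr01 !divr_gt0.
  have [a [Pa a1 a2]] := phia x _ d0; have [b [Pb b1 b2]] := phia y _ d0.
  have [c [Pc c1 c2]] := mul Pa Pb.
  have dC : d * C < e / 2.
    rewrite (@le_lt_trans _ _ (e / 4))//.
      by rewrite -ler_pdivlMr// ge_min lexx orbT.
    by rewrite ltr_pM2l// ltf_pV2 ?posrE// ltr_nat.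
  have d1 : d <= 1 by rewrite ge_min lexx.
  apply: (@half_triangle _ _ _ _ (j2 c)).
    rewrite -phij// -phiB phin c1; apply: le_lt_trans dC.
    by apply: cmul_close => //; exact: ltW.
  rewrite c2; apply: le_lt_trans dC; rewrite /C -(phin x) -(phin y).
  by apply: cmul_close => //; exact: ltW.
- apply: rnorm_sub_lt_eq => e e0.
  have [a [Pa a1 a2]] := phia x _ (divr_gt0 e0 (ltr0Sn _ 1)).
  have [c [Pc c1 c2]] := star Pa.
  apply: (@half_triangle _ _ _ _ (j2 c)).
    by rewrite -phij// -phiB phin c1 -cstarB rnorm_cstar.
  by rewrite c2 -cstarB rnorm_cstar.
Qed.

End cstar_extension.

(** * Semi-inner products *)

Section cabs_theory.
Variable R : realType.
Implicit Types z w : R[i].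

Definition cabs z : R := complex.Re `|z|.

Lemma normc_cabs z : `|z| = (cabs z)%:C.
Proof. exact: (@norm_rnorm R R[i]^o). Qed.

Lemma cabs_ge0 z : 0 <= cabs z.
Proof. exact: (@rnorm_ge0 R R[i]^o). Qed.

Lemma cabsD z w : cabs (z + w) <= cabs z + cabs w.
Proof. exact: (@rnormD R R[i]^o). Qed.

Lemma cabsN z : cabs (- z) = cabs z.
Proof. exact: (@rnormN R R[i]^o). Qed.

Lemma cabsB z w : cabs (z - w) = cabs (w - z).
Proof. exact: (@rnormB R R[i]^o). Qed.

Lemma cabs0 : cabs 0 = 0.
Proof. exact: (@rnorm0 R R[i]^o). Qed.

Lemma cabs_eq0 z : cabs z = 0 -> z = 0.
Proof. exact: (@rnorm_eq0 R R[i]^o). Qed.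

Lemma cabsM z w : cabs (z * w) = cabs z * cabs w.
Proof. exact: (@rnormZ R R[i]^o). Qed.

Lemma cabs_conj z : cabs z^*%C = cabs z.
Proof. by rewrite /cabs normcJ. Qed.

Lemma cabs_real (x : R) : cabs x%:C = `|x|.
Proof. by rewrite /cabs normc_def /= expr0n addr0 sqrtr_sqr. Qed.

Lemma cabs_sqr z : (cabs z) ^+ 2 = complex.Re (z * z^*%C).
Proof.
apply: complexI; rewrite rmorphXn /= -normc_cabs sqr_normc.
by rewrite RRe_real// ger0_real// mulcJ_ge0.
Qed.

Lemma cabs_Re z : `|complex.Re z| <= cabs z.
Proof. by rewrite -lecR -normc_cabs normc_ge_Re. Qed.

Lemma Re_cabs z : complex.Re z <= cabs z.
Proof. exact: le_trans (ler_norm _) (cabs_Re z). Qed.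

Lemma cabs_Im z : `|complex.Im z| <= cabs z.
Proof.
have -> : complex.Im z = - complex.Re (z * 'i%C) by rewrite ReiNIm opprK.
rewrite normrN (le_trans (cabs_Re _))// cabsM.
suff -> : cabs 'i%C = 1 by rewrite mulr1.
by rewrite /cabs normc_def /= expr0n expr1n add0r sqrtr1.
Qed.

Lemma cabs_le_ReIm z : cabs z <= `|complex.Re z| + `|complex.Im z|.
Proof.
case: z => a b; have -> : a +i* b = a%:C + 'i%C * b%:C by simpc.
rewrite (le_trans (cabsD _ _))// cabsM !cabs_real.
have -> : cabs 'i%C = 1 by rewrite /cabs normc_def /= expr0n expr1n add0r sqrtr1.
by rewrite mul1r; simpc; rewrite /= ?mul0r ?subr0 ?addr0 ?add0r ?mul1r.
Qed.

Lemma Re_ge0_real z : 0 <= z -> z = (complex.Re z)%:C.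
Proof. by move=> z0; rewrite RRe_real// ger0_real. Qed.

End cabs_theory.

Section semi_inner.
Variables (R : realType) (V : lmodType R[i]) (B : V -> V -> R[i]).
Hypothesis Blin : forall k x y z, B (k *: x + y) z = k * B x z + B y z.
Hypothesis Bconj : forall x y, B y x = (B x y)^*%C.
Hypothesis Bpos : forall x, 0 <= B x x.

Definition seminorm (x : V) : R := Num.sqrt (complex.Re (B x x)).

Lemma form0l z : B 0 z = 0.
Proof.
have := Blin 1 0 0 z; rewrite scaler0 addr0 mul1r => /eqP.
by rewrite -subr_eq subrr eq_sym => /eqP.
Qed.

Lemma formDl x y z : B (x + y) z = B x z + B y z.
Proof. by rewrite -{1}[x]scale1r Blin mul1r. Qed.

Lemma formZl k x z : B (k *: x) z = k * B x z.
Proof. by rewrite -[k *: x]addr0 Blin form0l addr0. Qed.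

Lemma formNl x z : B (- x) z = - B x z.
Proof. by rewrite -scaleN1r formZl mulN1r. Qed.

Lemma formBl x y z : B (x - y) z = B x z - B y z.
Proof. by rewrite formDl formNl. Qed.

Lemma formDr x y z : B z (x + y) = B z x + B z y.
Proof. by rewrite Bconj formDl rmorphD /= -!Bconj. Qed.

Lemma formZr k x z : B z (k *: x) = k^*%C * B z x.
Proof. by rewrite Bconj formZl rmorphM /= -Bconj. Qed.

Lemma formNr x z : B z (- x) = - B z x.
Proof. by rewrite Bconj formNl rmorphN /= -Bconj. Qed.

Lemma formBr x y z : B z (x - y) = B z x - B z y.
Proof. by rewrite formDr formNr. Qed.

Lemma form_sqr x : B x x = (seminorm x ^+ 2)%:C.
Proof.
rewrite /seminorm sqr_sqrtr; first exact: Re_ge0_real.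
by rewrite -ler0c -Re_ge0_real.
Qed.

Lemma seminorm_ge0 x : 0 <= seminorm x.
Proof. exact: sqrtr_ge0. Qed.

Lemma seminorm0 : seminorm 0 = 0.
Proof. by rewrite /seminorm form0l sqrtr0. Qed.

Lemma seminormZ k x : seminorm (k *: x) = cabs k * seminorm x.
Proof.
apply/eqP; rewrite -(eqrXn2 (n := 2))// ?mulr_ge0 ?cabs_ge0 ?seminorm_ge0//.
apply/eqP/complexI; rewrite -form_sqr formZl formZr form_sqr exprMn [in RHS]rmorphM.
by rewrite mulrA; congr (_ * _); rewrite rmorphXn /= -normc_cabs sqr_normc.
Qed.

Lemma cauchy_schwarz x y : cabs (B x y) <= seminorm x * seminorm y.
Proof.
set a := seminorm x; set b := seminorm y; set m := cabs (B x y).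
have a0 : 0 <= a by exact: seminorm_ge0.
have b0 : 0 <= b by exact: seminorm_ge0.
have m0 : 0 <= m by exact: cabs_ge0.
have key (s t : R) :
    0 <= s ^+ 2 * a ^+ 2 - 2 * s * t * m ^+ 2 + t ^+ 2 * b ^+ 2 * m ^+ 2.
  pose w := s%:C *: x - (t%:C * B x y) *: y.
  have := Bpos w.
  rewrite /w formBl !formBr !formZl !formZr !form_sqr -/a -/b (Bconj x y).
  have -> : (t%:C * B x y)^*%C = t%:C * (B x y)^*%C by rewrite rmorphM /= ?oppr0.
  rewrite conjc_real.
  have mE : B x y * (B x y)^*%C = (m ^+ 2)%:C.
    by rewrite rmorphXn /= -normc_cabs sqr_normc.
  have -> : s%:C * (s%:C * (a ^+ 2)%:C) - s%:C * (t%:C * (B x y)^*%C * B x y) -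
     (t%:C * B x y * (s%:C * (B x y)^*%C) -
      t%:C * B x y * (t%:C * (B x y)^*%C * (b ^+ 2)%:C)) =
     (s%:C * s%:C * (a ^+ 2)%:C - 2%:R * s%:C * t%:C * (B x y * (B x y)^*%C) +
      t%:C * t%:C * (b ^+ 2)%:C * (B x y * (B x y)^*%C)) by ring.
  rewrite mE -[2%:R](rmorph_nat (real_complex R)).
  by rewrite -!(rmorphM, rmorphB, rmorphD) /= ler0c !expr2 => /le_trans; apply.
have [b_eq0|bn0] := eqVneq b 0.
  have [->|mn0] := eqVneq m 0; first by rewrite mulr_ge0.
  have mp : 0 < m ^+ 2 by rewrite exprn_gt0// lt_def mn0.
  (* This [t] makes the cross term equal to [a^2 + 1], so that a null vector [y] with [m != 0] would
     give [0 <= -1]. *)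
  have := key 1 ((a ^+ 2 + 1) / (2 * m ^+ 2)).
  rewrite b_eq0 expr0n /= mulr0 mul0r addr0 expr1n mul1r mulr1.
  have -> : 2 * ((a ^+ 2 + 1) / (2 * m ^+ 2)) * m ^+ 2 = a ^+ 2 + 1.
    by field.
  by rewrite opprD addrA subrr sub0r oppr_ge0 ler10.
have bp : 0 < b by rewrite lt_def bn0.
have := key (b ^+ 2) 1.
have -> : (b ^+ 2) ^+ 2 * a ^+ 2 - 2 * b ^+ 2 * 1 * m ^+ 2 + 1 ^+ 2 * b ^+ 2 * m ^+ 2
  = b ^+ 2 * ((a * b) ^+ 2 - m ^+ 2) by ring.
by rewrite pmulr_rge0 ?exprn_gt0// subr_ge0 ler_pXn2r// nnegrE mulr_ge0.
Qed.

Lemma seminormD x y : seminorm (x + y) <= seminorm x + seminorm y.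
Proof.
rewrite -(@ler_pXn2r _ 2)// ?nnegrE ?addr_ge0 ?seminorm_ge0//.
have /(congr1 (@complex.Re R)) /= <- := form_sqr (x + y).
rewrite formDl !formDr !form_sqr (Bconj x y) sqrrD.
have -> : complex.Re ((seminorm x ^+ 2)%:C + B x y + ((B x y)^*%C + (seminorm y ^+ 2)%:C)) =
  seminorm x ^+ 2 + complex.Re (B x y) *+ 2 + seminorm y ^+ 2.
  by case: (B x y) => p q; rewrite -[_%:C]/(_ +i* _) /=; ring.
rewrite lerD2r lerD2l lerMn2r /= (le_trans _ (cauchy_schwarz x y))//.
exact: Re_cabs.
Qed.

End semi_inner.

(** * Hilbert space completion *)

Section norm_limits.
Variables (R : realType) (V : normedModType R[i]).
Implicit Types (u v : nat -> V) (l m : V).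

Definition rcvg u l := forall e : R, 0 < e -> \forall n \near \oo, rnorm (l - u n) < e.

Lemma rcvg_near u v l :
  (forall e : R, 0 < e -> \forall n \near \oo, rnorm (u n - v n) < e) ->
  rcvg u l -> rcvg v l.
Proof.
move=> uv ul e e0; near=> n.
have -> : l - v n = (l - u n) + (u n - v n) by rewrite addrA subrK.
rewrite (le_lt_trans (rnormD _ _))// (splitr e) ltrD//.
  by near: n; apply: ul; rewrite divr_gt0.
by near: n; apply: uv; rewrite divr_gt0.
Unshelve. all: by end_near. Qed.

Lemma rcvg_lin (k : R[i]) u v l m :
  rcvg u l -> rcvg v m -> rcvg (fun n => k *: u n + v n) (k *: l + m).
Proof.
move=> ul vm e e0.
have k0 := cabs_ge0 k.
have kp : 0 < cabs k + 1 by rewrite ltr_wpDl.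
near=> n.
rewrite opprD addrACA -scalerBr (le_lt_trans (rnormD _ _))// (splitr e).
rewrite ler_ltD//; last by near: n; apply: vm; rewrite divr_gt0.
rewrite rnormZ -/(cabs k).
rewrite (@le_trans _ _ ((cabs k + 1) * rnorm (l - u n)))//.
  by rewrite ler_wpM2r ?rnorm_ge0// lerDl.
rewrite mulrC -ler_pdivlMr// ltW//; near: n; apply: ul.
by rewrite !divr_gt0.
Unshelve. all: by end_near. Qed.

Lemma rcvg_uniq u l m : rcvg u l -> rcvg u m -> l = m.
Proof.
move=> ul um; apply: rnorm_sub_lt_eq => e e0.
have e2 : 0 < e / 2 by rewrite divr_gt0.
have [n [ln mn]] : exists n, rnorm (l - u n) < e / 2 /\ rnorm (m - u n) < e / 2.
  by near \oo => n; exists n; split; near: n; [exact: ul|exact: um].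
exact: (half_triangle ln mn).
Unshelve. all: by end_near. Qed.

Lemma rcvg_cst l : rcvg (fun=> l) l.
Proof. by move=> e e0; apply: nearW => n; rewrite subrr rnorm0. Qed.

Lemma rcvg_norm_le u l (C : R) :
  (forall e : R, 0 < e -> \forall n \near \oo, rnorm (u n) <= C + e) ->
  rcvg u l -> rnorm l <= C.
Proof.
move=> uC ul; apply/ler_addgt0Pr => e e0.
have e2 : 0 < e / 2 by rewrite divr_gt0.
have [n [ln mn]] : exists n, rnorm (l - u n) < e / 2 /\ rnorm (u n) <= C + e / 2.
  by near \oo => n; exists n; split; near: n; [exact: ul|exact: uC].
rewrite (le_trans (rnorm_dist_le _ (u n)))// (splitr e) addrA lerD//.
exact: ltW.
Unshelve. all: by end_near. Qed.

End norm_limits.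

Lemma rcvg_conj (R : realType) (u : nat -> R[i]^o) (l : R[i]^o) :
  rcvg u l -> rcvg (fun n => (u n)^*%C : R[i]^o) (l^*%C : R[i]^o).
Proof.
move=> ul e /ul; apply: filterS => n.
by rewrite -[rnorm (l - u n)]/(cabs (l - u n)) -cabs_conj raddfB.
Qed.

Lemma real_cauchy_limit (R : realType) (u : nat -> R) :
  (forall e : R, 0 < e ->
     exists N, forall n m, (N <= n)%N -> (N <= m)%N -> `|u n - u m| < e) ->
  exists l, forall e : R, 0 < e -> \forall n \near \oo, `|l - u n| < e.
Proof.
move=> uC; have : cvg (u @ \oo).
  apply: R_complete; apply/cauchy_ballP => e /= /uC[N NP].
  exists ([set y | exists2 n, (N <= n)%N & y = u n],
          [set y | exists2 n, (N <= n)%N & y = u n]).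
    by split; exists N => // n /= Nn; exists n.
  by move=> [_ _] [/= [n Nn ->] [m Nm ->]]; exact: NP.
move=> /cvg_ex[l ul]; exists l => e e0.
by move/cvgrPdist_lt : ul; exact.
Qed.

Lemma complex_cauchy_limit (R : realType) (u : nat -> R[i]^o) :
  (forall e : R, 0 < e ->
     exists N, forall n m, (N <= n)%N -> (N <= m)%N -> rnorm (u n - u m) < e) ->
  exists l, rcvg u l.
Proof.
move=> uC.
have [e /uC[N NP]|a au] := @real_cauchy_limit R (fun n => complex.Re (u n)).
  exists N => n m Nn Nm; rewrite -raddfB.
  by rewrite (le_lt_trans (cabs_Re _))//; exact: NP.
have [e /uC[N NP]|b bu] := @real_cauchy_limit R (fun n => complex.Im (u n)).
  exists N => n m Nn Nm; rewrite -raddfB.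
  by rewrite (le_lt_trans (cabs_Im _))//; exact: NP.
exists (a +i* b) => e e0; near=> n.
rewrite (le_lt_trans (cabs_le_ReIm _))// (splitr e) !raddfB /= ltrD//; near: n.
  by apply: au; rewrite divr_gt0.
by apply: bu; rewrite divr_gt0.
Unshelve. all: by end_near. Qed.

(** A Cauchy filter contains a ball of radius [1/(n+1)] for every [n]. Two members of a proper
    filter meet, so the centres form a Cauchy sequence, and the filter converges to its limit. *)
Lemma rnorm_complete_ax (R : realType) (V : normedModType R[i]) :
  (forall u : nat -> V, (forall e : R, 0 < e ->
     exists N, forall n m, (N <= n)%N -> (N <= m)%N -> rnorm (u n - u m) < e) ->
   exists l, rcvg u l) ->
  forall F : set_system V, ProperFilter F -> cauchy F -> cvg F.
Proof.
move=> sc F FF /cauchyP Fc.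
have inv_lt (e : R) : 0 < e -> exists N, forall n, (N <= n)%N -> n.+1%:R^-1 < e.
  move=> e0; exists (Num.trunc e^-1) => n Nn.
  rewrite invf_plt ?posrE ?ltr0n// (lt_le_trans (truncnS_gt _))//.
  by rewrite ler_nat ltnS.
have H n : exists x : V, F (ball x (n.+1%:R^-1)%:C).
  by apply: Fc; rewrite (ltcR 0) invr_gt0 ltr0n.
have [u uP] := choice H.
have uu n m : rnorm (u n - u m) < n.+1%:R^-1 + m.+1%:R^-1.
  have [x [/ball_rnorm nx /ball_rnorm mx]] := filter_ex (filterI (uP n) (uP m)).
  have -> : u n - u m = (u n - x) + (x - u m) by rewrite addrA subrK.
  by rewrite (le_lt_trans (rnormD _ _))// ltrD// rnormB.
have [e e0|l ul] := sc u.
  have [N NP] := inv_lt _ (divr_gt0 e0 (ltr0Sn _ 1)).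
  exists N => n m Nn Nm; rewrite (lt_trans (uu n m))//.
  by rewrite [ltRHS]splitr ltrD// NP.
apply/cvg_ex; exists l => A /rnorm_ballP[e e0 eA].
have e2 : 0 < e / 2 by rewrite divr_gt0.
have [n [ln n2]] : exists n, rnorm (l - u n) < e / 2 /\ n.+1%:R^-1 < e / 2.
  near \oo => n; exists n; split; near: n; first exact: ul.
  by have [N NP] := inv_lt _ e2; exists N.
apply: filterS (uP n) => y /ball_rnorm uny; apply: eA.
have -> : l - y = (l - u n) + (u n - y) by rewrite addrA subrK.
by rewrite (le_lt_trans (rnormD _ _))// (splitr e) ltrD// (lt_trans uny).
Unshelve. all: by end_near. Qed.

Record semiInner (R : realType) (V : lmodType R[i]) := SemiInner {
  form :> V -> V -> R[i];
  form_lin : forall k x y z, form (k *: x + y) z = k * form x z + form y z;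
  form_conj : forall x y, form y x = (form x y)^*%C;
  form_pos : forall x, 0 <= form x x
}.

Section hilbert_completion.
Variables (R : realType) (V : lmodType R[i]) (B : semiInner V).
Local Notation sn := (seminorm B).
Let lin := form_lin B.
Let hconj := form_conj B.
Let pos := form_pos B.

Definition bcauchy (x : nat -> V) := forall e : R, 0 < e ->
  exists N, forall n m, (N <= n)%N -> (N <= m)%N -> sn (x n - x m) < e.

Definition represents (x : nat -> V) (F : V -> R[i]^o) :=
  bcauchy x /\ forall v, rcvg (fun n => B (x n) v : R[i]^o) (F v).

Lemma bcauchy_lin k x y : bcauchy x -> bcauchy y ->
  bcauchy (fun n => k *: x n + y n).
Proof.
move=> cx cy e e0.
have kp : 0 < cabs k + 1 by rewrite ltr_wpDl// cabs_ge0.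
have [|N NP] := cx (e / 2 / (cabs k + 1)); first by rewrite !divr_gt0.
have [|M MP] := cy (e / 2); first by rewrite !divr_gt0.
exists (maxn N M) => n m; rewrite !geq_max => /andP[Nn Mn] /andP[Nm Mm].
rewrite opprD addrACA -scalerBr.
rewrite (le_lt_trans (seminormD lin hconj pos _ _))// (splitr e) ler_ltD//.
  rewrite (seminormZ lin hconj pos).
  rewrite (@le_trans _ _ ((cabs k + 1) * sn (x n - x m)))//.
    by rewrite ler_wpM2r ?seminorm_ge0// lerDl.
  by rewrite mulrC -ler_pdivlMr// ltW// NP.
exact: MP.
Qed.

Lemma represents_lin k x y F K : represents x F -> represents y K ->
  represents (fun n => k *: x n + y n) (fun v => k *: F v + K v).
Proof.
move=> [cx xF] [cy yK]; split; first exact: bcauchy_lin.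
move=> v; have := rcvg_lin k (xF v) (yK v).
by under eq_fun do rewrite -[_ *: _ + _]/(k * B (x _) v + B (y _) v) -lin.
Qed.

Lemma bcauchy_bounded x : bcauchy x ->
  exists2 C : R, 0 < C & \forall n \near \oo, sn (x n) <= C.
Proof.
move=> /(_ 1 ltr01)[N NP]; exists (sn (x N) + 1).
  by rewrite ltr_wpDl// seminorm_ge0.
exists N => // n /= Nn; rewrite -(subrK (x N) (x n)) addrC.
rewrite (le_trans (seminormD lin hconj pos _ _))// lerD2l.
by rewrite ltW// NP.
Qed.

(** A [B]-Cauchy sequence that is weakly null is null: [B (z n) (z n)] splits as
    [B (z n) (z n - z N) + B (z n) (z N)], where the first term is small against [sn (z n)] and the
    second tends to [0] for fixed [N]. Everything said about independence of representatives rests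
    on this. *)
Lemma represents_null z : represents z (fun=> 0) ->
  forall e : R, 0 < e -> \forall n \near \oo, sn (z n) < e.
Proof.
move=> [cz z0] e e0.
have e2 : 0 < e / 2 by rewrite divr_gt0.
have [N NP] := cz _ e2.
have zN := z0 (z N) _ (mulr_gt0 e0 e2).
near=> n; have Nn : (N <= n)%N by near: n; exists N.
rewrite ltNge; apply/negP => en.
have : cabs (B (z n) (z N)) < e * (e / 2).
  by near: n; apply: filterS zN => n; rewrite sub0r rnormN.
apply/negP; rewrite -leNgt.
have s0 := seminorm_ge0 B (z n).
have /(congr1 (@complex.Re R)) /= h1 := form_sqr pos (z n).
have h2 : sn (z n) ^+ 2 <= sn (z n) * (e / 2) + cabs (B (z n) (z N)).
  rewrite -h1 (le_trans (Re_cabs _))//.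
  have -> : B (z n) (z n) = B (z n) (z n - z N) + B (z n) (z N).
    by rewrite (formBr lin hconj) subrK.
  rewrite (le_trans (cabsD _ _))// lerD2r.
  rewrite (le_trans (cauchy_schwarz lin hconj pos _ _))// ler_wpM2l//.
  by rewrite ltW// NP.
have : e * (e / 2) <= sn (z n) * (sn (z n) - e / 2).
  apply: ler_pM => //; [exact: ltW|exact: ltW|].
  by rewrite lerBrDr -splitr.
by rewrite mulrBr -expr2 => /le_trans; apply; rewrite lerBlDl.
Unshelve. all: by end_near. Qed.

Lemma bcauchy_form x y : bcauchy x -> bcauchy y ->
  forall e : R, 0 < e -> exists N, forall n m, (N <= n)%N -> (N <= m)%N ->
  @rnorm R R[i]^o (B (x n) (y n) - B (x m) (y m)) < e.
Proof.
move=> cx cy e e0.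
have [C C0 [N1 _ xC]] := bcauchy_bounded cx.
have [D D0 [N2 _ yD]] := bcauchy_bounded cy.
have [|N3 xx] := cx (e / 2 / D); first by rewrite !divr_gt0.
have [|N4 yy] := cy (e / 2 / C); first by rewrite !divr_gt0.
exists (maxn (maxn N1 N2) (maxn N3 N4)) => n m.
rewrite !geq_max => /andP[/andP[n1 n2] /andP[n3 n4]] /andP[/andP[m1 m2] /andP[m3 m4]].
have -> : B (x n) (y n) - B (x m) (y m) =
    B (x n - x m) (y n) + B (x m) (y n - y m).
  by rewrite (formBl lin) (formBr lin hconj) addrA subrK.
rewrite (le_lt_trans (cabsD _ _))// (splitr e) ltr_leD//.
  rewrite (le_lt_trans (cauchy_schwarz lin hconj pos _ _))//.
  rewrite (@le_lt_trans _ _ (sn (x n - x m) * D))//.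
    by rewrite ler_wpM2l ?seminorm_ge0// yD.
  by rewrite -ltr_pdivlMr// xx.
rewrite (le_trans (cauchy_schwarz lin hconj pos _ _))// mulrC.
rewrite (@le_trans _ _ (sn (y n - y m) * C))//.
  by rewrite ler_wpM2l ?seminorm_ge0// xC.
by rewrite -ler_pdivlMr// ltW// yy.
Qed.

(* A point of the completion is encoded as the functional [lim_n B (x n)] attached to
   a [B]-Cauchy sequence [x], which also quotients out the null vectors of [B]. *)
Definition hcompl_pred : {pred (V -> R[i]^o)} :=
  fun F => `[< exists x, represents x F >].

Fact hcompl_submod : submod_closed hcompl_pred.
Proof.
split.
  apply/asboolP; exists (fun=> 0); split; last first.
    by move=> v; rewrite (form0l lin); exact: rcvg_cst.
  by move=> e e0; exists 0%N => n m _ _; rewrite subrr (seminorm0 lin).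
move=> k F K /asboolP[x xF] /asboolP[y yK]; apply/asboolP.
by exists (fun n => k *: x n + y n); exact: represents_lin.
Qed.

HB.instance Definition _ :=
  GRing.isSubmodClosed.Build R[i] (V -> R[i]^o) hcompl_pred hcompl_submod.

Record hcompl := HCompl { hcompl_fun :> V -> R[i]^o ; _ : hcompl_fun \in hcompl_pred }.

HB.instance Definition _ := [isSub for hcompl_fun].
HB.instance Definition _ := [Choice of hcompl by <:].
HB.instance Definition _ := [SubChoice_isSubLmodule of hcompl by <:].

Lemma hcompl_rep (F : hcompl) : exists x, represents x F.
Proof. by have /asboolP := valP F. Qed.

Definition hrep (F : hcompl) : nat -> V := projT1 (cid (hcompl_rep F)).

Lemma hrepP F : represents (hrep F) F.
Proof. exact: projT2 (cid (hcompl_rep F)). Qed.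

Fact hinner_ex (F K : hcompl) :
  exists l : R[i]^o, rcvg (fun n => B (hrep F n) (hrep K n) : R[i]^o) l.
Proof.
by apply: complex_cauchy_limit; apply: bcauchy_form; exact: (hrepP _).1.
Qed.

Definition hinner (F K : hcompl) : R[i] := projT1 (cid (hinner_ex F K)).

(** Independence of the chosen sequences [hrep]: the difference of two sequences representing the
    same functional is null by [represents_null], so any other choice has the same limit. *)
Lemma hinnerP (x y : nat -> V) (F K : hcompl) :
  represents x F -> represents y K ->
  rcvg (fun n => B (x n) (y n) : R[i]^o) (hinner F K).
Proof.
have sub x1 x2 L : represents x1 L -> represents x2 L ->
    represents (fun n => x1 n - x2 n) (fun=> 0).
  move=> r1 r2; have := represents_lin (-1) r2 r1.
  under eq_fun do rewrite scaleN1r addrC.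
  by under [X in represents _ X]eq_fun do rewrite scaleN1r addNr.
move=> xF yK; have xF' := hrepP F; have yK' := hrepP K.
apply: rcvg_near (projT2 (cid (hinner_ex F K))) => e e0 /=.
have [C C0 xC] := bcauchy_bounded xF.1.
have [D D0 yD] := bcauchy_bounded yK'.1.
have dx := represents_null (sub _ _ _ xF' xF).
have dy := represents_null (sub _ _ _ yK' yK).
near=> n.
have -> : B (hrep F n) (hrep K n) - B (x n) (y n) =
    B (hrep F n - x n) (hrep K n) + B (x n) (hrep K n - y n).
  by rewrite (formBl lin) (formBr lin hconj) addrA subrK.
rewrite (le_lt_trans (cabsD _ _))// (splitr e) ltr_leD//.
  rewrite (le_lt_trans (cauchy_schwarz lin hconj pos _ _))//.
  rewrite (@le_lt_trans _ _ (sn (hrep F n - x n) * D))//.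
    by rewrite ler_wpM2l ?seminorm_ge0//; near: n.
  rewrite -ltr_pdivlMr//; near: n; apply: dx; by rewrite !divr_gt0.
rewrite (le_trans (cauchy_schwarz lin hconj pos _ _))// mulrC.
rewrite (@le_trans _ _ (sn (hrep K n - y n) * C))//.
  by rewrite ler_wpM2l ?seminorm_ge0//; near: n.
rewrite -ler_pdivlMr// ltW//; near: n; apply: dy; by rewrite !divr_gt0.
Unshelve. all: by end_near. Qed.

Lemma hinner_linear k F K L : hinner (k *: F + K) L = k * hinner F L + hinner K L.
Proof.
have r := represents_lin k (hrepP F) (hrepP K).
apply: (rcvg_uniq (@hinnerP _ _ (k *: F + K) L r (hrepP L))).
have := rcvg_lin k (hinnerP (hrepP F) (hrepP L)) (hinnerP (hrepP K) (hrepP L)).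
by under eq_fun do rewrite -[_ *: _ + _]/(k * B _ _ + B _ _) -lin.
Qed.

Lemma hinner_conj F K : hinner K F = (hinner F K)^*%C.
Proof.
apply: (rcvg_uniq (hinnerP (hrepP K) (hrepP F))).
have := rcvg_conj (hinnerP (hrepP F) (hrepP K)).
by under eq_fun do rewrite -hconj.
Qed.

Lemma hinner_pos F : 0 <= hinner F F.
Proof.
have h := hinnerP (hrepP F) (hrepP F).
have im0 : complex.Im (hinner F F) = 0.
  apply/eqP; rewrite -normr_le0; apply/ler_addgt0Pr => e e0; rewrite add0r.
  have [n hn] := filter_ex (h e e0).
  rewrite (le_trans _ (ltW hn))// (le_trans _ (cabs_Im _))// raddfB /=.
  by rewrite (form_sqr pos) subr0.
rewrite lecE im0 eqxx /=; rewrite leNgt; apply/negP => r0.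
have r1 : 0 < - complex.Re (hinner F F) by rewrite oppr_gt0.
have [n hn] := filter_ex (h _ r1).
move: hn; apply/negP; rewrite -leNgt (le_trans _ (cabs_Re _))// raddfB /=.
rewrite -normrN opprB (form_sqr pos) /= ger0_norm; last first.
  by rewrite subr_ge0 (le_trans (ltW r0))// sqr_ge0.
by rewrite lerBrDr addrC subrr sqr_ge0.
Qed.

Definition hnorm (F : hcompl) : R[i] := (seminorm hinner F)%:C.

(** Definiteness comes from the encoding by functionals: if the seminorms of a representing sequence
    tend to [0], then so does its pairing with every [v], and the functional itself is zero. *)
Lemma hnorm_eq0 F : hnorm F = 0 -> F = 0.
Proof.
move=> /complexI F0; have h := hinnerP (hrepP F) (hrepP F).
have hF0 : hinner F F = 0 by rewrite (form_sqr hinner_pos) F0 expr0n.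
apply/val_inj/funext => v; apply: (rcvg_uniq ((hrepP F).2 v)) => e e0.
have vp : 0 < sn v + 1 by rewrite ltr_wpDl// seminorm_ge0.
have dp : 0 < e / (sn v + 1) by rewrite divr_gt0.
have := h _ (exprn_gt0 2 dp); apply: filterS => n.
rewrite hF0 sub0r rnormN sub0r rnormN {1}/rnorm (form_sqr pos) -/(cabs _).
rewrite cabs_real ger0_norm ?sqr_ge0// ltr_pXn2r// ?nnegrE ?seminorm_ge0 ?ltW//.
move=> hn; rewrite (le_lt_trans (cauchy_schwarz lin hconj pos _ _))//.
rewrite (@le_lt_trans _ _ (sn (hrep F n) * (sn v + 1)))//.
  by rewrite ler_wpM2l ?seminorm_ge0// lerDl.
by rewrite -ltr_pdivlMr.
Qed.

Lemma hnormD F K : hnorm (F + K) <= hnorm F + hnorm K.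
Proof.
rewrite /hnorm -rmorphD /= lecR.
exact: (seminormD hinner_linear hinner_conj hinner_pos).
Qed.

Lemma hnormZ k F : hnorm (k *: F) = `|k| * hnorm F.
Proof.
rewrite /hnorm (seminormZ hinner_linear hinner_conj hinner_pos).
by rewrite rmorphM /= -normc_cabs.
Qed.

HB.instance Definition _ :=
  @Lmodule_isNormed.Build R[i] hcompl hnorm hnormD hnormZ hnorm_eq0.

End hilbert_completion.

Section hilbert_completion_complete.
Variables (R : realType) (V : lmodType R[i]) (B : semiInner V).
Local Notation sn := (seminorm B).
Let lin := form_lin B.
Let pos := form_pos B.
Let H := hcompl B.

Lemma rnorm_hcompl (F : H) : rnorm F = seminorm (@hinner _ _ B) F.
Proof. by []. Qed.

Lemma represents_cst v : represents B (fun=> v) (B v).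
Proof.
split; last by move=> w; exact: rcvg_cst.
by move=> e e0; exists 0%N => n m _ _; rewrite subrr (seminorm0 lin).
Qed.

Fact hcompl_iota_subproof v : (B v : V -> R[i]^o) \in hcompl_pred B.
Proof. by apply/asboolP; exists (fun=> v); exact: represents_cst. Qed.

Definition hiota v : H := HCompl (hcompl_iota_subproof v).

Lemma hiota_linear : linear hiota.
Proof. by move=> k x y; apply/val_inj/funext => w; rewrite /= lin. Qed.

Lemma hinner_iota x y : hinner (hiota x) (hiota y) = B x y.
Proof.
apply: (rcvg_uniq (V := R[i]^o)); last exact: rcvg_cst.
exact: (@hinnerP _ _ B _ _ (hiota x) (hiota y) (represents_cst x) (represents_cst y)).
Qed.

(** Pairing with an embedded vector evaluates the functional. Elements of the completion can thus be
    compared, and operators on it defined, through values on [V]. *)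
Lemma hinner_eval (F : H) y : hinner F (hiota y) = F y.
Proof.
have r := hrepP F; apply: (rcvg_uniq (V := R[i]^o)); last exact: r.2.
exact: (@hinnerP _ _ B _ _ F (hiota y) r (represents_cst y)).
Qed.

Lemma rnorm_hiota x : rnorm (hiota x) = sn x.
Proof. by rewrite rnorm_hcompl /seminorm hinner_iota. Qed.

(** For fixed [n], the element [F - hiota (x n)] is represented by [m |-> x m - x n], whose
    seminorms are eventually below [e / 2]; the bound passes to the limit. Density of [V] is a
    consequence. *)
Lemma represents_cvg x (F : H) : represents B x F -> rcvg (hiota \o x) F.
Proof.
move=> xF e e0; have [N NP] := xF.1 _ (divr_gt0 e0 (ltr0Sn _ 1)).
exists N => // n /= Nn.
have z : represents B (fun m => x m - x n) (F - hiota (x n)).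
  have := represents_lin (-1) (represents_cst (x n)) xF.
  under eq_fun do rewrite scaleN1r addrC.
  by under [X in represents _ _ X]eq_fun do rewrite scaleN1r addrC.
set D := F - hiota (x n) in z *.
have DD := @hinnerP _ _ B _ _ D D z z.
have e2 : 0 < e / 2 by rewrite divr_gt0.
apply: (@le_lt_trans _ _ (e / 2)); last by rewrite [ltRHS]splitr ltrDl.
rewrite -(@ler_pXn2r _ 2)// ?nnegrE ?rnorm_ge0 ?(ltW e2)//.
rewrite rnorm_hcompl.
have -> : seminorm (@hinner _ _ B) D ^+ 2 = @rnorm R R[i]^o (hinner D D).
  rewrite (form_sqr (@hinner_pos _ _ B)) -[rnorm _]/(cabs _) cabs_real.
  by rewrite ger0_norm// sqr_ge0.
apply: (rcvg_norm_le (V := R[i]^o) _ DD) => d d0; exists N => // m /= Nm.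
rewrite (form_sqr pos) -[rnorm _]/(cabs _) cabs_real ger0_norm ?sqr_ge0//.
rewrite ler_wpDr ?(ltW d0)// ler_pXn2r// ?nnegrE ?seminorm_ge0 ?(ltW e2)//.
by rewrite ltW// NP.
Qed.

(** Each [u n] is replaced by a vector [x n] of [V] within [1/(n+1)]. The sequence [x] is
    [B]-Cauchy, so it represents an element of the completion, and that element is the limit. *)
Fact hcompl_complete (u : nat -> H) : (forall e : R, 0 < e ->
    exists N, forall n m, (N <= n)%N -> (N <= m)%N -> rnorm (u n - u m) < e) ->
  exists l, rcvg u l.
Proof.
move=> uC.
have P n : exists v, rnorm (u n - hiota v) < n.+1%:R^-1.
  have [|N _ NP] := represents_cvg (hrepP (u n)) (e := n.+1%:R^-1).
    by rewrite invr_gt0 ltr0n.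
  by exists (hrep (u n) N); exact: NP (leqnn N).
have [x xP] := choice P.
have inv_lt (e : R) : 0 < e -> exists N, forall n, (N <= n)%N -> n.+1%:R^-1 < e.
  move=> e0; exists (Num.trunc e^-1) => n Nn.
  rewrite invf_plt ?posrE ?ltr0n// (lt_le_trans (truncnS_gt _))//.
  by rewrite ler_nat ltnS.
have ux (e : R) : 0 < e -> \forall n \near \oo, rnorm (u n - hiota (x n)) < e.
  move=> /inv_lt[N NP]; exists N => // n /= Nn.
  by rewrite (lt_trans (xP n))// NP.
have cx : bcauchy B x.
  move=> e e0; have e3 : 0 < e / 3 by rewrite divr_gt0.
  have [N1 N1P] := uC _ e3; have [N2 _ N2P] := ux _ e3.
  exists (maxn N1 N2) => n m; rewrite !geq_max => /andP[n1 n2] /andP[m1 m2].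
  have iB : hiota (x n - x m) = hiota (x n) - hiota (x m).
    by apply/val_inj/funext => w; rewrite /= (formBl lin).
  rewrite -rnorm_hiota iB.
  have -> : hiota (x n) - hiota (x m) =
      (hiota (x n) - u n) + ((u n - u m) + (u m - hiota (x m))).
    by rewrite !addrA !subrK.
  have -> : e = e / 3 + (e / 3 + e / 3) by field.
  rewrite (le_lt_trans (rnormD _ _))// ltrD//; first by rewrite rnormB N2P.
  by rewrite (le_lt_trans (rnormD _ _))// ltrD//; [exact: N1P|exact: N2P].
have L v : exists l : R[i]^o, rcvg (fun n => B (x n) v : R[i]^o) l.
  apply: complex_cauchy_limit; apply: (bcauchy_form cx) => e e0.
  by exists 0%N => n m _ _; rewrite subrr (seminorm0 lin).
have [f fP] := choice L.
have fH : (f : V -> R[i]^o) \in hcompl_pred B by apply/asboolP; exists x.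
exists (HCompl fH).
apply: rcvg_near (represents_cvg (F := HCompl fH) (x := x) _); last by [].
by move=> e e0; apply: filterS (ux _ e0) => n; rewrite rnormB.
Qed.

HB.instance Definition _ :=
  Uniform_isComplete.Build (hcompl B) (rnorm_complete_ax hcompl_complete).

Fact hcompl_inner_norm (F : H) : hinner F F = `|F| ^+ 2.
Proof.
by rewrite norm_rnorm rnorm_hcompl (form_sqr (@hinner_pos _ _ B)) rmorphXn.
Qed.

Definition hcompl_space : hilbertSpace R := @HilbertSpace R (hcompl B)
  (@hinner _ _ B) (@hinner_linear _ _ B) (@hinner_conj _ _ B) hcompl_inner_norm.

(** On functionals the extension of [T] is precomposition with its formal adjoint [S], with no limit
    to take. The bound on [T] shows that [F \o S] is again represented, by [T \o x], and controls
    the norm. *)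
Lemma hcompl_adjoint_op (T S : V -> V) (C : R) : linear T -> 0 <= C ->
  (forall x y, B (T x) y = B x (S y)) -> (forall x, sn (T x) <= C * sn x) ->
  exists T' : H -> H,
    (forall F v, T' F v = F (S v)) /\ (forall F, rnorm (T' F) <= C * rnorm F).
Proof.
move=> Tlin C0 adj bnd.
have TB x y : T (x - y) = T x - T y.
  by rewrite addrC -scaleN1r Tlin scaleN1r addrC.
have rT x F : represents B x F -> represents B (T \o x) (F \o S).
  move=> [cx xF]; split; last first.
    move=> v; have := xF (S v).
    by under eq_fun do rewrite -adj.
  move=> e e0; have C1 : 0 < C + 1 by rewrite ltr_wpDl.
  have [N NP] := cx _ (divr_gt0 e0 C1); exists N => n m Nn Nm /=.
  rewrite -TB (le_lt_trans (bnd _))//.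
  rewrite (@le_lt_trans _ _ ((C + 1) * sn (x n - x m)))//.
    by rewrite ler_wpM2r ?seminorm_ge0// lerDl.
  by rewrite mulrC -ltr_pdivlMr// NP.
have inH (F : H) : (F \o S : V -> R[i]^o) \in hcompl_pred B.
  by apply/asboolP; exists (T \o hrep F); apply: rT; exact: hrepP.
exists (fun F => HCompl (inH F)); split => // F.
have r := hrepP F; apply: (rcvg_norm_le _ (represents_cvg (F := HCompl (inH F)) (rT _ _ r))).
move=> e e0; have C1 : 0 < C + 1 by rewrite ltr_wpDl.
have := represents_cvg r (divr_gt0 e0 C1); apply: filterS => n /= h.
rewrite rnorm_hiota (le_trans (bnd _))// -rnorm_hiota.
rewrite (@le_trans _ _ (C * (rnorm F + e / (C + 1))))//.
  rewrite ler_wpM2l// (le_trans (rnorm_dist_le _ F))// lerD2l rnormB.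
  exact: ltW.
rewrite mulrDr lerD2l mulrCA ler_piMr// ?ltW//.
by rewrite ltr_pdivrMr// mul1r ltrDl.
Qed.

End hilbert_completion_complete.

(** The GNS construction sees the completion only through these five properties. Separation by the
    vectors [iota v] reduces most operator identities to inner products, without limits. *)
Lemma hilbert_completion (R : realType) (V : lmodType R[i]) (B : semiInner V) :
  exists (H : hilbertSpace R) (iota : V -> H),
  [/\ linear iota,
      forall x y, inner (iota x) (iota y) = B x y,
      forall F K : H, (forall v, inner F (iota v) = inner K (iota v)) -> F = K,
      forall (F : H) (e : R), 0 < e -> exists v, rnorm (F - iota v) < e &
      forall (T S : V -> V) (C : R), linear T -> 0 <= C ->
        (forall x y, B (T x) y = B x (S y)) ->
        (forall x, seminorm B (T x) <= C * seminorm B x) ->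
        exists T' : H -> H,
          (forall F v, inner (T' F) (iota v) = inner F (iota (S v))) /\
          (forall F, rnorm (T' F) <= C * rnorm F)].
Proof.
exists (hcompl_space B), (@hiota _ _ B); split.
- exact: hiota_linear.
- exact: hinner_iota.
- move=> F K FK; apply/val_inj/funext => v.
  by have := FK v; rewrite /= !hinner_eval.
- move=> F e e0; have [x xF] : exists x, represents B x F by exact: hcompl_rep.
  have /(_ e e0)[n _ /(_ n (leqnn n)) nF] := represents_cvg xF.
  by exists (x n).
- move=> T S C Tlin C0 adj bnd.
  have [T' [T'E T'n]] := hcompl_adjoint_op Tlin C0 adj bnd.
  exists T'; split; last exact: T'n.
  by move=> F v; rewrite /= !hinner_eval T'E.
Qed.

(** * Topology and product Borel sets *)

Section complex_continuity.
Variables (R : realType) (T : topologicalType).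

Lemma cvg_complex (F : set_system T) (f : T -> R[i]^o) (l : R[i]^o) {FF : Filter F} :
  complex.Re (f x) @[x --> F] --> complex.Re l ->
  complex.Im (f x) @[x --> F] --> complex.Im l -> f @ F --> l.
Proof.
move=> /cvgrPdist_lt fr /cvgrPdist_lt fi A /rnorm_ballP[e e0 eA].
have e2 : 0 < e / 2 by rewrite divr_gt0.
suff : F [set x | A (f x)] by [].
have H : F [set x | `|complex.Re l - complex.Re (f x)| < e / 2 /\
                    `|complex.Im l - complex.Im (f x)| < e / 2].
  exact: filterI (fr _ e2) (fi _ e2).
apply: filterS H => x [/= xr xi].
apply: eA; rewrite (le_lt_trans (cabs_le_ReIm _))// (splitr e) !raddfB /=.
exact: ltrD.
Qed.

Lemma cvg_Re (F : set_system T) (f : T -> R[i]^o) (l : R[i]^o) {FF : Filter F} :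
  f @ F --> l -> complex.Re (f x) @[x --> F] --> complex.Re l.
Proof. by move=> fl; exact: (@cvg_comp _ _ _ f (@complex.Re R) F (nbhs l) (nbhs (complex.Re l)) fl (@continuous_Re R l)). Qed.

Lemma cvg_Im (F : set_system T) (f : T -> R[i]^o) (l : R[i]^o) {FF : Filter F} :
  f @ F --> l -> complex.Im (f x) @[x --> F] --> complex.Im l.
Proof. by move=> fl; exact: (@cvg_comp _ _ _ f (@complex.Im R) F (nbhs l) (nbhs (complex.Im l)) fl (@continuous_Im R l)). Qed.

Lemma cvg_conj (F : set_system T) (f : T -> R[i]^o) (l : R[i]^o) {FF : Filter F} :
  f @ F --> l -> ((f x)^*%C : R[i]^o) @[x --> F] --> (l^*%C : R[i]^o).
Proof.
have ReJ (z : R[i]) : complex.Re z^*%C = complex.Re z by case: z.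
have ImJ (z : R[i]) : complex.Im z^*%C = - complex.Im z by case: z.
move=> fl; apply: cvg_complex.
  by rewrite ReJ; under eq_fun do rewrite ReJ; exact: cvg_Re.
by rewrite ImJ; under eq_fun do rewrite ImJ; apply: cvgN; exact: cvg_Im.
Qed.

Lemma cvg_cabs (F : set_system T) (f : T -> R[i]^o) (l : R[i]^o) {FF : Filter F} :
  f @ F --> l -> cabs (f x) @[x --> F] --> cabs l.
Proof.
move=> fl; apply/cvgrPdist_lt => e e0.
have H : F [set x | rnorm (l - f x) < e].
  by apply: (fl [set z : R[i]^o | rnorm (l - z) < e]); apply/rnorm_ballP; exists e.
apply: filterS H => x /=; apply: le_lt_trans.
rewrite ler_norml lerBlDl (rnorm_dist_le (l : R[i]^o)) andbT.
by rewrite lerNl opprB lerBlDl rnormB (rnorm_dist_le (f x : R[i]^o)).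
Qed.

Lemma cvg_real_complex (F : set_system T) (f : T -> R) (l : R) {FF : Filter F} :
  f @ F --> l -> ((f x)%:C : R[i]^o) @[x --> F] --> (l%:C : R[i]^o).
Proof. by move=> fl; apply: cvg_complex => //=; exact: cvg_cst. Qed.

End complex_continuity.

Lemma second_countable_enum (T : topologicalType) : @second_countable T ->
  exists e : nat -> set T, (forall n, open (e n)) /\
    forall x A, nbhs x A -> exists n, e n x /\ e n `<=` A.
Proof.
move=> [B cB [Bo Bb]].
have [B0|/set0P[b0 Bb0]] := eqVneq B set0.
  exists (fun=> set0); split=> [_|x A /(Bb x)[b []]]; first exact: open0.
  by rewrite B0.
have /countable_injP[f finj] := cB.
pose e n := xget b0 [set b | B b /\ f b = n].
have eB n : B (e n) by rewrite /e; case: xgetP => // b _ [].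
exists e; split=> [n|x A /(Bb x)[b [Bb' bx] bA]]; first exact: Bo.
exists (f b); suff -> : e (f b) = b by [].
rewrite /e; case: xgetP => [b' _ [Bb2 fb]|/(_ b)]; last by case.
by apply: finj => //; rewrite inE.
Qed.

(** * Urysohn functions, Tietze extension and exhaustion by compact sets *)

Section locally_compact_functions.
Variables (R : realType) (T : topologicalType).
Hypothesis T_hausdorff : hausdorff_space T.
Hypothesis T_lc : locally_compact [set: T].

Let opc := one_point_compactification T.

Let opc_hausdorff : hausdorff_space opc.
Proof. exact: one_point_compactification_hausdorff. Qed.

Let opc_normal : normal_space opc.
Proof.
by apply: compact_normal opc_hausdorff _; exact: one_point_compactification_compact.
Qed.

Let closed_Some (K : set T) : compact K -> closed (Some @` K : set opc).
Proof.
move=> cK; apply: (compact_closed opc_hausdorff).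
apply: continuous_compact cK; apply: continuous_subspaceT.
exact: one_point_compactification_some_continuous.
Qed.

(** Urysohn's lemma is applied in the one-point compactification, which is compact Hausdorff and so
    normal. It gives a function vanishing off [U], whose support need be neither compact nor inside
    [U] until it is truncated. *)
Lemma compact_open_urysohn (K U : set T) : compact K -> open U -> K `<=` U ->
  exists f : T -> R, [/\ continuous f, forall x, 0 <= f x <= 1,
    forall x, K x -> f x = 1, compact (closure [set x | f x != 0]) &
    closure [set x | f x != 0] `<=` U].
Proof.
move=> cK oU KU.
have cU : closed (~` (Some @` U : set opc)).
  by apply: open_closedC; exact: one_point_compactification_open_some.
have dKU : (~` (Some @` U : set opc)) `&` (Some @` K) = set0.
  by rewrite -subset0 => y [nU [x Kx xE]]; apply: nU; exists x => //; exact: KU.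
have [f [cf f0 f1 f01]] :=
  urysohn_ext_itv opc_normal cU (closed_Some cK) dKU (ltr01 : (0 : R) < 1).
pose g x := f (Some x).
have cg : continuous g.
  move=> x; apply: (@continuous_comp T opc R Some f); last exact: cf.
  exact: one_point_compactification_some_continuous.
have g01 x : 0 <= g x <= 1.
  by have /= := f01 (g x) (ex_intro2 _ _ (Some x) Logic.I erefl); rewrite in_itv.
(* Cutting [g] at [1/2] keeps the closure of the support inside the closed set [1/2 <= g], which is
   disjoint from the complement of [U] and from a neighbourhood of the point at infinity. *)
pose h x := Num.max 0 (2 * g x - 1).
have hg x : h x != 0 -> 2^-1 <= g x.
  apply: contraNT; rewrite -ltNge => gx; apply/eqP/max_idPl.
  by rewrite subr_le0 mulrC -ler_pdivlMr// mul1r ltW.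
have cgh : closed [set x | 2^-1 <= g x].
  by apply: (@preimage_closed _ _ g [set r | 2^-1 <= r]) => //; exact: closed_ge.
have clh : closure [set x | h x != 0] `<=` [set x | 2^-1 <= g x].
  rewrite closureE; apply: smallest_sub => // x /=; exact: hg.
exists h; split.
- move=> x; apply: (@continuous_comp _ _ _ g (fun r => Num.max 0 (2 * r - 1))).
    exact: cg.
  apply: (@continuous_max R R^o (cst 0) (fun r => 2 * r - 1)); first exact: cvg_cst.
  apply: cvgB; last exact: cvg_cst.
  by apply: cvgM; [exact: cvg_cst|exact: cvg_id].
- move=> x; rewrite le_max lexx /= ge_max ler01 /=.
  by have /andP[_ g1] := g01 x; lra.
- move=> x Kx; rewrite /h /g (f1 (f (Some x)))//; last by exists (Some x) => //; exists x.
  by rewrite mulr1 -[2]/(1 + 1) addrK; apply/max_idPr.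
- have : nbhs (None : opc) [set y | f y < 2^-1].
    have fN : f None = 0 by apply: f0; exists None => // -[].
    have h0 : nbhs (f None) [set r : R | r < 2^-1].
      by rewrite fN; apply: lt_nbhsl; rewrite invr_gt0.
    exact: (cf None _ h0).
  move=> [W [cW clW] WS].
  apply: (subclosed_compact _ cW); first exact: closed_closure.
  move=> x /clh /= gx; apply: contrapT => nWx.
  have : f (Some x) < 2^-1 by apply: WS; left; exists x.
  by rewrite ltNge gx.
- move=> x /clh /= gx; apply: contrapT => nUx.
  have g0 : g x = 0.
    by apply: f0; exists (Some x) => // -[y Uy [yx]]; apply: nUx; rewrite -yx.
  by move: gx; rewrite g0 leNgt invr_gt0 ltr0n.
Qed.

(** The image of [K] is closed in the one-point compactification, a normal space where the bounded
    form of Tietze's theorem applies; compactness of [K] supplies the bound. *)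
Lemma compact_tietze (K : set T) (f : T -> R) : compact K ->
  {within K, continuous f} ->
  exists g : T -> R, continuous g /\ forall x, K x -> g x = f x.
Proof.
move=> cK cf.
pose f' : opc -> R^o := oapp f 0.
have cf' : {within (Some @` K : set opc), continuous f'}.
  apply/subspace_continuousP => _ [x Kx <-].
  move/subspace_continuousP : cf => /(_ x Kx) cf A nA.
  have h : nbhs x [set z | K z -> A (f z)] by exact: cf A nA.
  suff : nbhs x [set z | (Some @` K : set opc) (Some z) -> A (f z)] by [].
  by apply: filterS h => z hz [w Kw [wz]]; apply: hz; rewrite -wz.
have [M M0 fM] : exists2 M : R, 0 < M & forall x, (Some @` K : set opc) x -> `|f' x| <= M.
  have /compact_bounded[M [Mr MP]] : compact (f @` K : set R^o).
    exact: continuous_compact cf cK.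
  exists (Num.max 0 M + 1); first by rewrite ltr_wpDl// le_max lexx.
  move=> _ [x Kx <-]; apply: (MP (Num.max 0 M + 1)); last by exists x.
  by rewrite (@le_lt_trans _ _ (Num.max 0 M)) ?ltrDl// le_max lexx orbT.
have [g [gf cg gM]] :=
  continuous_bounded_extension opc_normal (closed_Some cK) M0 cf' fM.
exists (g \o Some); split.
  move=> x; apply: continuous_comp; last exact: cg.
  exact: one_point_compactification_some_continuous.
by move=> x Kx /=; rewrite -gf//= inE; exists x.
Qed.

Lemma compact_tietze_complex (K : set T) (f : T -> R[i]^o) : compact K ->
  {within K, continuous f} ->
  exists g : T -> R[i]^o, continuous g /\ forall x, K x -> g x = f x.
Proof.
move=> cK cf.
have [|r [cr rE]] := @compact_tietze K (fun x => complex.Re (f x)) cK.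
  by move=> x; apply: (cvg_Re (T := subspace K)); exact: cf.
have [|i [ci iE]] := @compact_tietze K (fun x => complex.Im (f x)) cK.
  by move=> x; apply: (cvg_Im (T := subspace K)); exact: cf.
exists (fun x => r x +i* i x); split.
  by move=> x; apply: cvg_complex; [exact: cr|exact: ci].
by move=> x Kx; rewrite rE// iE//; case: (f x).
Qed.

Hypothesis T_sc : @second_countable T.

(** The basic open sets whose closure is compact and contained in [U] already cover [U], as Urysohn
    functions at single points show. Finite unions of these closures form the exhaustion. *)
Lemma open_sigma_compact (U : set T) : open U ->
  exists K : nat -> set T, [/\ forall n, compact (K n),
    forall n m, (n <= m)%N -> K n `<=` K m & U = \bigcup_n K n].
Proof.
move=> oU; have [e [eo eb]] := second_countable_enum T_sc.
pose good n := compact (closure (e n)) /\ closure (e n) `<=` U.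
pose K0 n := if `[< good n >] then closure (e n) else set0.
have K0U n : K0 n `<=` U by rewrite /K0; case: asboolP => [[]//|_]; exact: sub0set.
have cK0 n : compact (K0 n).
  by rewrite /K0; case: asboolP => [[]//|_]; exact: compact0.
exists (fun n => \big[setU/set0]_(i < n.+1) K0 i); split.
- by move=> n; apply: bigsetU_compact => i _.
- move=> n m nm; exact: (subset_bigsetU (F := K0) (nm : (n.+1 <= m.+1)%N)).
- apply/seteqP; split=> [x Ux|x [n _]]; last first.
    by rewrite -bigcup_mkord => -[k _]; exact: K0U.
  have [|||f [cf _ f1 cf0 fU]] := @compact_open_urysohn [set x] U.
  + exact: compact_set1.
  + by [].
  + by move=> y ->.
  pose V := [set y | f y != 0].
  have oV : open V.
    rewrite (_ : V = f @^-1` (~` [set 0])); last first.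
      by apply/seteqP; split=> y /=; move/eqP.
    by apply: open_comp => [y _|]; [exact: cf|rewrite openC; exact: closed_eq].
  have /eb[n [ex eV]] : nbhs x V.
    by apply: open_nbhs_nbhs; split => //; rewrite /V /= f1// oner_neq0.
  exists n => //; rewrite -bigcup_mkord; exists n => //=.
  have gn : good n.
    split; last exact: subset_trans (closureS eV) fU.
    apply: (subclosed_compact _ cf0); first exact: closed_closure.
    exact: closureS.
  by rewrite /K0 asboolT//; exact: subset_closure.
Qed.

End locally_compact_functions.

Section product_borel.
Variables (R : realType) (T : ptopologicalType).
Hypothesis T_sc : @second_countable T.

(** Countably many rectangles of basic open sets exhaust an open set of the product, so it belongs
    to the product of the Borel sigma-algebras. This makes continuous functions of two variables
    eligible for Fubini's theorem. *)
Lemma open_prod_measurable (O : set (T * T)) : open O ->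
  measurable (O : set (borel T * borel T)%type).
Proof.
move=> oO; have [e [eo eb]] := second_countable_enum T_sc.
have -> : O = \bigcup_n \bigcup_m
    (if `[< e n `*` e m `<=` O >] then e n `*` e m else set0).
  apply/seteqP; split=> [[x y] Oxy|[x y] [n _ [m _]]]; last first.
    by case: asboolP => // h; exact: h.
  have : nbhs (x, y) O by exact: open_nbhs_nbhs.
  move=> [[A B] /= [/eb[n [ex nA]] /eb[m [ey mB]]] AB].
  exists n => //; exists m => //; rewrite asboolT//.
  by move=> [a b] [/= /nA Aa /mB Bb]; exact: AB.
apply: bigcup_measurable => n _; apply: bigcup_measurable => m _.
case: asboolP => // _; apply: measurableX; exact: sub_sigma_algebra.
Qed.

Lemma measurable_within_prod (D : set (T * T)) (g : T * T -> R) :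
  {within D, continuous g} ->
  measurable_fun (D : set (borel T * borel T)%type) (g : (borel T * borel T)%type -> R).
Proof.
move=> /continuousP cg mD.
apply: (@measurability _ _ (borel T * borel T)%type R D g _ (RGenOpens.measurableE R)) => //.
move=> _ [_ [a [b ->]] <-].
have /open_subspaceP[V oV VD] := cg _ (@interval_open R (BRight a) (BLeft b) isT isT).
rewrite setIC -VD; apply: measurableI => //; exact: open_prod_measurable.
Qed.

End product_borel.

(** Fubini's theorem takes sigma-finiteness as a structure on the measure, whereas it is known for
    [lam u] only as a proposition, and only at units [u]; this turns one into the other. *)
Lemma sigma_finite_measure_ex d (T : measurableType d) (R : realType)
    (m : {measure set T -> \bar R}) : sigma_finite setT m ->
  exists M : {sigma_finite_measure set T -> \bar R}, m = M.
Proof.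
move=> sf.
pose H1 := isSFinite.Build _ _ _ _ (sfinite_measure_sigma_finite sf).
pose H2 := isSigmaFinite.Build _ _ _ _ sf.
pose M := HB.pack_for (SigmaFiniteMeasure.type T R) (Measure.sort m) H1 H2.
by exists M; exact: eq_measure.
Qed.

(** * Iterated integrals over measurable rectangles *)

Section iterated_integrals.
Context d1 d2 (T1 : measurableType d1) (T2 : measurableType d2) (R : realType).
Variables (m1 : {measure set T1 -> \bar R}) (m2 : {measure set T2 -> \bar R}).
Hypothesis (sf1 : sigma_finite setT m1) (sf2 : sigma_finite setT m2).
Variables (D1 : set T1) (D2 : set T2).
Hypothesis (mD1 : measurable D1) (mD2 : measurable D2).
Local Open Scope ereal_scope.

Let patch_iterated (F : T1 * T2 -> \bar R) x :
  \int[m2]_y (F \_ (D1 `*` D2)) (x, y) =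
  ((fun x => \int[m2]_(y in D2) F (x, y)) \_ D1) x.
Proof.
rewrite /patch; case: ifPn => xD.
  rewrite [RHS]integral_mkcond; apply: eq_integral => y _.
  by rewrite /patch in_setX /= xD.
by apply: integral0_eq => y _; rewrite in_setX /= (negbTE xD).
Qed.

Let patch_iterated_swap (F : T1 * T2 -> \bar R) y :
  \int[m1]_x (F \_ (D1 `*` D2)) (x, y) =
  ((fun y => \int[m1]_(x in D1) F (x, y)) \_ D2) y.
Proof.
rewrite /patch; case: ifPn => yD.
  rewrite [RHS]integral_mkcond; apply: eq_integral => x _.
  by rewrite /patch in_setX /= yD andbT.
by apply: integral0_eq => x _; rewrite in_setX /= (negbTE yD) andbF.
Qed.

Lemma tonelli_on (F : T1 * T2 -> \bar R) :
  measurable_fun (D1 `*` D2) F -> (forall z, 0 <= F z) ->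
  \int[m1]_(x in D1) \int[m2]_(y in D2) F (x, y) =
  \int[m2]_(y in D2) \int[m1]_(x in D1) F (x, y).
Proof.
move=> mF F0; rewrite integral_mkcond [RHS]integral_mkcond.
under eq_integral do rewrite -patch_iterated.
under [RHS]eq_integral do rewrite -patch_iterated_swap.
have [M1 ->] := sigma_finite_measure_ex sf1.
have [M2 ->] := sigma_finite_measure_ex sf2.
apply: (fubini_tonelli (F \_ (D1 `*` D2))).
  exact/(measurable_restrictT F (measurableX mD1 mD2)).
by apply: erestrict_ge0 => z _.
Qed.

Lemma measurable_tonelli_on (F : T1 * T2 -> \bar R) :
  measurable_fun (D1 `*` D2) F -> (forall z, 0 <= F z) ->
  measurable_fun D1 (fun x => \int[m2]_(y in D2) F (x, y)).
Proof.
move=> mF F0; apply/(measurable_restrictT _ mD1).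
rewrite (_ : _ \_ _ = fun x => \int[m2]_y (F \_ (D1 `*` D2)) (x, y)); last first.
  by apply/funext => x; rewrite patch_iterated.
have [M2 ->] := sigma_finite_measure_ex sf2.
apply: (measurable_fun_fubini_tonelli_F (F \_ (D1 `*` D2))).
  exact/(measurable_restrictT F (measurableX mD1 mD2)).
by apply: erestrict_ge0 => z _.
Qed.

(** Every slice, and not almost every one, is to be integrable, because the real inner integrals are
    read through [fine], which sends infinite values to [0]. *)
Lemma fubini_on (F : T1 * T2 -> R) :
  measurable_fun (D1 `*` D2) F ->
  \int[m1]_(x in D1) \int[m2]_(y in D2) `|F (x, y)|%:E < +oo ->
  (forall x, D1 x -> m2.-integrable D2 (fun y => (F (x, y))%:E)) ->
  (forall y, D2 y -> m1.-integrable D1 (fun x => (F (x, y))%:E)) ->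
  (\int[m1]_(x in D1) (\int[m2]_(y in D2) F (x, y)) =
  \int[m2]_(y in D2) (\int[m1]_(x in D1) F (x, y)))%R.
Proof.
move=> mF Foo i2 i1; rewrite /Rintegral; congr fine.
pose FE : T1 * T2 -> \bar R := EFin \o F.
transitivity (\int[m1]_(x in D1) \int[m2]_(y in D2) FE (x, y)).
  apply: eq_integral => x /set_mem xD; rewrite fineK//.
  by apply: integrable_fin_num => //; exact: i2.
transitivity (\int[m2]_(y in D2) \int[m1]_(x in D1) FE (x, y)); last first.
  apply: eq_integral => y /set_mem yD; rewrite fineK//.
  by apply: integrable_fin_num => //; exact: i1.
rewrite integral_mkcond [RHS]integral_mkcond.
under eq_integral do rewrite -patch_iterated.
under [RHS]eq_integral do rewrite -patch_iterated_swap.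
have mFE : measurable_fun setT (FE \_ (D1 `*` D2)).
  apply/(measurable_restrictT FE (measurableX mD1 mD2)).
  exact/measurable_EFinP.
move: Foo; rewrite integral_mkcond.
under eq_integral do rewrite -(patch_iterated (fun z => `|F z|%:E)).
have [M1 ->] := sigma_finite_measure_ex sf1.
have [M2 ->] := sigma_finite_measure_ex sf2 => Foo.
apply: (Fubini (f := FE \_ (D1 `*` D2))).
apply/integrable12ltyP => //; apply: le_lt_trans Foo.
rewrite le_eqVlt; apply/orP; left; apply/eqP.
apply: eq_integral => x _; apply: eq_integral => y _.
by rewrite /patch; case: ifP => // _; rewrite abse0.
Qed.

End iterated_integrals.

(** * Complex integrals *)

Section complex_integral.
Context d (T : measurableType d) (R : realType).
Variables (mu : {measure set T -> \bar R}) (D : set T).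
Hypothesis mD : measurable D.
Implicit Types f g : T -> R[i].

Definition cmeasurable f := measurable_fun D (fun x => complex.Re (f x)) /\
  measurable_fun D (fun x => complex.Im (f x)).

Definition cintegrable f := mu.-integrable D (fun x => (complex.Re (f x))%:E) /\
  mu.-integrable D (fun x => (complex.Im (f x))%:E).

Lemma cabsE (z : R[i]) :
  cabs z = Num.sqrt ((complex.Re z) ^+ 2 + (complex.Im z) ^+ 2).
Proof. by rewrite /cabs normc_def. Qed.

Lemma cmeasurable_cabs f : cmeasurable f -> measurable_fun D (fun x => cabs (f x)).
Proof.
move=> [mr mi]; under eq_fun do rewrite cabsE.
apply: (@measurableT_comp _ _ _ _ _ _ (@Num.sqrt R)).
  by apply: continuous_measurable_fun; exact: sqrt_continuous.
by apply: measurable_funD; exact: measurable_funX.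
Qed.

Lemma cmeasurableM f g : cmeasurable f -> cmeasurable g ->
  cmeasurable (fun x => f x * g x).
Proof.
move=> [mr mi] [nr ni].
have RE z w : complex.Re (z * w) =
    complex.Re z * complex.Re w - complex.Im z * complex.Im w :> R.
  by case: z => ? ?; case: w.
have IE z w : complex.Im (z * w) =
    complex.Re z * complex.Im w + complex.Im z * complex.Re w :> R.
  by case: z => ? ?; case: w.
split.
  under eq_fun do rewrite RE.
  by apply: measurable_funB; exact: measurable_funM.
under eq_fun do rewrite IE.
by apply: measurable_funD; exact: measurable_funM.
Qed.

Lemma cintegrable_measurable f : cintegrable f -> cmeasurable f.
Proof.
by move=> [/measurable_int fr /measurable_int fi]; split; exact/measurable_EFinP.
Qed.

Lemma cintegrableP f : cmeasurable f ->
  (\int[mu]_(x in D) (cabs (f x))%:E < +oo)%E -> cintegrable f.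
Proof.
move=> mf foo; have mc := cmeasurable_cabs mf.
have ic : mu.-integrable D (fun x => (cabs (f x))%:E).
  apply/integrableP; split; first exact/measurable_EFinP.
  by under eq_integral do rewrite /= ger0_norm ?cabs_ge0//.
case: mf => mr mi; split.
  apply: (le_integrable mD _ _ ic); first exact/measurable_EFinP.
  by move=> x _; rewrite lee_fin [leRHS]ger0_norm ?cabs_ge0// cabs_Re.
apply: (le_integrable mD _ _ ic); first exact/measurable_EFinP.
by move=> x _; rewrite lee_fin [leRHS]ger0_norm ?cabs_ge0// cabs_Im.
Qed.

Lemma cintegrable_cabs f : cintegrable f -> mu.-integrable D (fun x => (cabs (f x))%:E).
Proof.
move=> [fr fi]; have mf := cmeasurable_cabs (cintegrable_measurable (conj fr fi)).
apply: (@le_integrable _ _ _ mu D mD _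
    (fun x => (`|complex.Re (f x)| + `|complex.Im (f x)|)%:E)).
- exact/measurable_EFinP.
- move=> x _; rewrite lee_fin ger0_norm ?cabs_ge0// ger0_norm ?addr_ge0//.
  exact: cabs_le_ReIm.
- under eq_fun do rewrite EFinD.
  by apply: integrableD => //; exact: integrable_norm.
Qed.

Lemma cintegrable_lin k f g : cintegrable f -> cintegrable g ->
  cintegrable (fun x => k * f x + g x).
Proof.
have RE (z w v : R[i]) : complex.Re (z * w + v) =
    complex.Re z * complex.Re w + (- complex.Im z * complex.Im w + complex.Re v) :> R.
  by case: z => ? ?; case: w => ? ?; case: v => ? ? /=; ring.
have IE (z w v : R[i]) : complex.Im (z * w + v) =
    complex.Re z * complex.Im w + (complex.Im z * complex.Re w + complex.Im v) :> R.
  by case: z => ? ?; case: w => ? ?; case: v => ? ? /=; ring.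
move=> [fr fi] [gr gi]; split.
  under eq_fun do rewrite RE 2!EFinD 2!EFinM.
  by do 2! (apply: integrableD => //; first exact: integrableZl).
under eq_fun do rewrite IE 2!EFinD 2!EFinM.
by do 2! (apply: integrableD => //; first exact: integrableZl).
Qed.

Lemma cintegral_lin k f g : cintegrable f -> cintegrable g ->
  cintegral mu D (fun x => k * f x + g x) =
  k * cintegral mu D f + cintegral mu D g.
Proof.
move=> [fr fi] [gr gi].
have RE (z w v : R[i]) : complex.Re (z * w + v) =
    complex.Re z * complex.Re w + (- complex.Im z * complex.Im w + complex.Re v) :> R.
  by case: z => ? ?; case: w => ? ?; case: v => ? ? /=; ring.
have IE (z w v : R[i]) : complex.Im (z * w + v) =
    complex.Re z * complex.Im w + (complex.Im z * complex.Re w + complex.Im v) :> R.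
  by case: z => ? ?; case: w => ? ?; case: v => ? ? /=; ring.
rewrite /cintegral.
under eq_Rintegral do rewrite RE.
under [X in _ +i* X]eq_Rintegral do rewrite IE.
have Z (h : T -> R) (r : R) : mu.-integrable D (fun x => (h x)%:E) ->
    mu.-integrable D (fun x => (r * h x)%:E).
  by move=> ih; under eq_fun do rewrite EFinM; exact: integrableZl.
have A (h1 h2 : T -> R) : mu.-integrable D (fun x => (h1 x)%:E) ->
    mu.-integrable D (fun x => (h2 x)%:E) ->
    mu.-integrable D (fun x => (h1 x + h2 x)%:E).
  by move=> i1 i2; under eq_fun do rewrite EFinD; exact: integrableD.
rewrite !RintegralD//; do ?[exact: Z|apply: A => //; exact: Z].
rewrite !RintegralZl//.
by case: k => a b; simpc => /=; congr (_ +i* _); ring.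
Qed.

Lemma cintegrable0 : cintegrable (fun=> 0).
Proof. by split; exact: integrable0. Qed.

Lemma cintegral0 : cintegral mu D (fun=> 0) = 0.
Proof. by rewrite /cintegral /= !Rintegral_cst// !mul0r. Qed.

Lemma cintegralZ k f : cintegrable f ->
  cintegral mu D (fun x => k * f x) = k * cintegral mu D f.
Proof.
move=> fi; have := cintegral_lin k fi cintegrable0; rewrite cintegral0 addr0 => <-.
by congr cintegral; apply/funext => x; rewrite addr0.
Qed.

Lemma cintegrableZ k f : cintegrable f -> cintegrable (fun x => k * f x).
Proof.
move=> fi; have := cintegrable_lin k fi cintegrable0.
by under eq_fun do rewrite addr0.
Qed.

Lemma cintegralB f g : cintegrable f -> cintegrable g ->
  cintegral mu D (fun x => f x - g x) = cintegral mu D f - cintegral mu D g.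
Proof.
move=> fi gi; have := cintegral_lin (-1) gi fi; rewrite mulN1r addrC => <-.
by congr cintegral; apply/funext => x; rewrite mulN1r addrC.
Qed.

Lemma eq_cintegral f g : (forall x, D x -> f x = g x) ->
  cintegral mu D f = cintegral mu D g.
Proof.
by move=> fg; rewrite /cintegral; congr (_ +i* _); apply: eq_Rintegral => x;
  rewrite inE => /fg ->.
Qed.

Lemma cintegral_conj f : cintegrable f ->
  cintegral mu D (fun x => (f x)^*%C) = (cintegral mu D f)^*%C.
Proof.
move=> [fr fi]; rewrite /cintegral /=; congr (_ +i* _).
  by apply: eq_Rintegral => x _; case: (f x).
rewrite -mulN1r -RintegralZl//.
by apply: eq_Rintegral => x _; rewrite mulN1r; case: (f x).
Qed.

(** Multiplication by the conjugate of [I] rotates the integral onto the real axis: [|I|^2] is the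
    integral of the real part of the rotated [f], hence at most [|I|] times the integral of
    [|f|]. *)
Lemma cabs_cintegral_le f : cintegrable f ->
  cabs (cintegral mu D f) <= \int[mu]_(x in D) cabs (f x).
Proof.
move=> fi; set I := cintegral mu D f; set J := \int[mu]_(x in D) cabs (f x).
have J0 : 0 <= J by apply: Rintegral_ge0 => x _; exact: cabs_ge0.
have [->|I0] := eqVneq (cabs I) 0; first exact: J0.
have Ip : 0 < cabs I by rewrite lt_def I0 cabs_ge0.
rewrite -(ler_pM2l Ip) -expr2 cabs_sqr mulrC -cintegralZ// -RintegralZl//; last first.
  exact: cintegrable_cabs.
have [hr _] := cintegrableZ I^*%C fi.
apply: le_Rintegral => //.
  exact: (@integrableZl _ _ _ mu D mD (cabs I) _ (cintegrable_cabs fi)).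
by move=> x _; rewrite (le_trans (Re_cabs _))// cabsM cabs_conj.
Qed.

Lemma cabs_cintegral_le_integral f : cintegrable f ->
  ((cabs (cintegral mu D f))%:E <= \int[mu]_(x in D) (cabs (f x))%:E)%E.
Proof.
move=> fi; rewrite -[leRHS]fineK; last first.
  by apply: integrable_fin_num => //; exact: cintegrable_cabs.
by rewrite lee_fin; exact: cabs_cintegral_le.
Qed.

End complex_integral.

Section complex_fubini.
Context d1 d2 (T1 : measurableType d1) (T2 : measurableType d2) (R : realType).
Variables (m1 : {measure set T1 -> \bar R}) (m2 : {measure set T2 -> \bar R}).
Hypothesis (sf1 : sigma_finite setT m1) (sf2 : sigma_finite setT m2).
Variables (D1 : set T1) (D2 : set T2).
Hypothesis (mD1 : measurable D1) (mD2 : measurable D2).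

Lemma cfubini_on (F : T1 * T2 -> R[i]) :
  cmeasurable (D1 `*` D2) F ->
  (\int[m1]_(x in D1) \int[m2]_(y in D2) (cabs (F (x, y)))%:E < +oo)%E ->
  (forall x, D1 x -> cintegrable m2 D2 (fun y => F (x, y))) ->
  (forall y, D2 y -> cintegrable m1 D1 (fun x => F (x, y))) ->
  cintegral m1 D1 (fun x => cintegral m2 D2 (fun y => F (x, y))) =
  cintegral m2 D2 (fun y => cintegral m1 D1 (fun x => F (x, y))).
Proof.
move=> mF Foo i2 i1.
have mc := cmeasurable_cabs mF; case: mF => mr mi.
have le_fin (h : T1 * T2 -> R) : measurable_fun (D1 `*` D2) h ->
    (forall z, `|h z| <= cabs (F z)) ->
    (forall x, D1 x -> measurable_fun D2 (fun y => h (x, y))) ->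
    (\int[m1]_(x in D1) \int[m2]_(y in D2) `|h (x, y)|%:E < +oo)%E.
  move=> mh hc mhx; apply: le_lt_trans Foo.
  have mhE : measurable_fun (D1 `*` D2) (fun z => (`|h z|)%:E).
    by apply/measurable_EFinP; exact: measurableT_comp.
  have mcE : measurable_fun (D1 `*` D2) (fun z => (cabs (F z))%:E).
    exact/measurable_EFinP.
  apply: ge0_le_integral => //.
  - by move=> x _; apply: integral_ge0 => y _; rewrite lee_fin.
  - apply: (measurable_tonelli_on sf2 mD1 mD2 mhE) => z; by rewrite lee_fin.
  - apply: (measurable_tonelli_on sf2 mD1 mD2 mcE) => z.
    by rewrite lee_fin cabs_ge0.
  - move=> x xD; apply: ge0_le_integral => //.
    + by apply/measurable_EFinP; apply: measurableT_comp => //; exact: mhx.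
    + exact: measurable_int (cintegrable_cabs mD2 (i2 _ xD)).
    + by move=> y _; rewrite lee_fin.
congr (_ +i* _).
  apply: (fubini_on sf1 sf2 mD1 mD2 mr).
  - apply: (le_fin _ mr) => [z|x xD]; first exact: cabs_Re.
    exact: (cintegrable_measurable (i2 _ xD)).1.
  - by move=> x xD; exact: (i2 _ xD).1.
  - by move=> x xD; exact: (i1 _ xD).1.
apply: (fubini_on sf1 sf2 mD1 mD2 mi).
- apply: (le_fin _ mi) => [z|x xD]; first exact: cabs_Im.
  exact: (cintegrable_measurable (i2 _ xD)).2.
- by move=> x xD; exact: (i2 _ xD).2.
- by move=> x xD; exact: (i1 _ xD).2.
Qed.

End complex_fubini.

(** * Borel measures finite on compact sets *)

Section borel_measures.
Variables (R : realType) (T : ptopologicalType).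
Hypothesis T_hausdorff : hausdorff_space T.
Implicit Types mu nu : {measure set (borel T) -> \bar R}.

Lemma closed_borel (A : set T) : closed A -> measurable (A : set (borel T)).
Proof.
move=> cA; rewrite -[A]setCK; apply: measurableC.
by apply: sub_sigma_algebra; rewrite openC.
Qed.

Lemma compact_borel (K : set T) : compact K -> measurable (K : set (borel T)).
Proof. by move=> cK; apply: closed_borel; exact: compact_closed. Qed.

Lemma cmeasurable_within (D : set T) (f : T -> R[i]^o) : {within D, continuous f} ->
  cmeasurable (D : set (borel T)) (f : borel T -> R[i]).
Proof.
move=> cf; split; apply: measurable_within => x.
  by apply: (cvg_Re (T := subspace D)); exact: cf.
by apply: (cvg_Im (T := subspace D)); exact: cf.
Qed.

(** The function is dominated by a constant times the indicator of [K]. Continuity is asked within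
    [D] only, since a convolution integrand [a y * b (y^-1 x)] is meaningful on a single fiber. *)
Lemma cintegrable_compact mu (D K : set T) (f : T -> R[i]^o) :
  (mu K < +oo)%E -> closed D -> compact K -> {within D, continuous f} ->
  (forall x, D x -> ~ K x -> f x = 0) ->
  cintegrable mu (D : set (borel T)) (f : borel T -> R[i]).
Proof.
move=> muK cD cK cf f0.
have mD := closed_borel cD; have mK := compact_borel cK.
have mf := cmeasurable_within cf.
have [M M0 fM] : exists2 M : R, 0 <= M & forall x, D x -> cabs (f x) <= M.
  have cDK : compact (K `&` D) by exact: compact_closedI.
  have /compact_bounded[M [Mr MP]] : compact ((fun x => cabs (f x)) @` (K `&` D) : set R^o).
    apply: continuous_compact cDK; apply: (continuous_subspaceW (B := D)).
      by move=> x [].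
    by move=> x; apply: (cvg_cabs (T := subspace D)); exact: cf.
  have M1 : M < Num.max 0 M + 1.
    by rewrite (@le_lt_trans _ _ (Num.max 0 M)) ?ltrDl// le_max lexx orbT.
  have M2 : 0 <= Num.max 0 M + 1 by rewrite addr_ge0// le_max lexx.
  exists (Num.max 0 M + 1) => // x Dx; have [Kx|nKx] := pselect (K x).
    rewrite -[leLHS]ger0_norm ?cabs_ge0//; apply: (MP _ M1).
    by exists x.
  by rewrite f0// cabs0.
apply: cintegrableP => //.
apply: (@le_lt_trans _ _ (\int[mu]_(x in D) (M * \1_K x)%:E)%E).
  apply: ge0_le_integral => //.
  - by move=> x _; rewrite lee_fin cabs_ge0.
  - by apply/measurable_EFinP; exact: cmeasurable_cabs.
  - by apply/measurable_EFinP; apply: measurable_funM => //; exact: measurable_indic.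
  - move=> x Dx; rewrite lee_fin indicE; have [Kx|nKx] := pselect (K x).
      by rewrite mem_set// mulr1 fM.
    by rewrite f0// cabs0 mulr_ge0.
under eq_integral do rewrite EFinM.
rewrite ge0_integralZl//; last by apply/measurable_EFinP; exact: measurable_indic.
rewrite integral_indic// lte_mul_pinfty//.
by rewrite (le_lt_trans _ muK)// le_measure ?inE//; exact: measurableI.
Qed.

Hypothesis T_lc : locally_compact [set: T].
Hypothesis T_sc : @second_countable T.

(** Finiteness is given on compact sets but wanted on open ones: the set where a Urysohn function of
    a compact set is nonzero is open with compact closure. *)
Lemma open_finite_cover mu : (forall K, compact K -> (mu K < +oo)%E) ->
  exists g : nat -> set T, [/\ forall n, open (g n), \bigcup_n g n = setT &
    forall n, (mu (g n) < +oo)%E].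
Proof.
move=> fin; have [K [cK _ KT]] := open_sigma_compact R T_hausdorff T_lc T_sc openT.
have F n : exists V : set T, [/\ open V, K n `<=` V & (mu V < +oo)%E].
  have [f [cf _ f1 cf0 _]] :=
    compact_open_urysohn R T_hausdorff T_lc (cK n) openT (@subsetT _ _).
  exists [set y | f y != 0]; split.
  - rewrite (_ : [set y | f y != 0] = f @^-1` (~` [set 0])); last first.
      by apply/seteqP; split=> y /=; move/eqP.
    by apply: open_comp => [y _|]; [exact: cf|rewrite openC; exact: closed_eq].
  - by move=> x /f1 /= ->; rewrite oner_neq0.
  - apply: le_lt_trans (fin _ cf0); apply: le_measure; rewrite ?inE.
    + apply: sub_sigma_algebra.
      rewrite (_ : [set y | f y != 0] = f @^-1` (~` [set 0])); last first.
        by apply/seteqP; split=> y /=; move/eqP.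
      by apply: open_comp => [y _|]; [exact: cf|rewrite openC; exact: closed_eq].
    + by apply: closed_borel; exact: closed_closure.
    + exact: subset_closure.
have [g gP] := choice F; exists g; split=> [n||n]; try by have [] := gP n.
rewrite -subTset KT => x [n _ Kx]; exists n => //.
by have [_ + _] := gP n; exact.
Qed.

Lemma borel_sigma_finite mu : (forall K, compact K -> (mu K < +oo)%E) ->
  sigma_finite setT mu.
Proof.
move=> /open_finite_cover[g [og gT gfin]]; exists g; first by rewrite gT.
by move=> n; split=> //; exact: sub_sigma_algebra.
Qed.

(** The measure of an open set is the limit along an exhaustion by compact sets, and a Urysohn
    function squeezed between a compact set and the open set gives each inequality. Open sets are
    stable under intersection and include a countable cover of finite measure, so equality spreads
    to all Borel sets. *)
Lemma Cc_measure_unique mu nu :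
  (forall K, compact K -> (mu K < +oo)%E) ->
  (forall f : T -> R, continuous f -> (forall x, 0 <= f x) ->
     compact (closure [set x | f x != 0]) ->
     (\int[mu]_x (f x)%:E = \int[nu]_x (f x)%:E)%E) ->
  forall A, measurable A -> mu A = nu A.
Proof.
move=> fin Cceq.
have le_open (m1 m2 : {measure set (borel T) -> \bar R}) :
  (forall f : T -> R, continuous f -> (forall x, 0 <= f x) ->
     compact (closure [set x | f x != 0]) ->
     (\int[m1]_x (f x)%:E = \int[m2]_x (f x)%:E)%E) ->
  forall U, open U -> (m1 U <= m2 U)%E.
  move=> eqi U oU.
  have [K [cK ndK UE]] := open_sigma_compact R T_hausdorff T_lc T_sc oU.
  have mU : measurable (U : set (borel T)) by exact: sub_sigma_algebra.
  have mK n : measurable (K n : set (borel T)) by exact: compact_borel.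
  have KU n : K n `<=` U by rewrite UE; exact: bigcup_sup.
  have cv : m1 (K n) @[n --> \oo] --> m1 U.
    rewrite [in X in _ --> X]UE; apply: nondecreasing_cvg_mu => //.
      by rewrite -UE.
    by move=> n m nm; apply/subsetPset; exact: ndK.
  rewrite -(cvg_lim _ cv)//; apply: lime_le; first by apply/cvg_ex; exists (m1 U).
  apply: nearW => n.
  have [f [cf f01 f1 cf0 fU]] := compact_open_urysohn R T_hausdorff T_lc (cK n) oU (KU n).
  have mf : measurable_fun [set: borel T] (fun x => (f x)%:E).
    apply/measurable_EFinP; apply: (@measurable_within _ _ setT).
    by apply: continuous_subspaceT.
  rewrite -(setIT (K n)) -integral_indic//.
  apply: (@le_trans _ _ (\int[m1]_x (f x)%:E)%E).
    apply: ge0_le_integral => //.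
    - by apply/measurable_EFinP; exact: measurable_indic.
    - move=> x _; rewrite lee_fin indicE; have [Kx|nKx] := pselect (K n x).
        by rewrite mem_set// f1.
      by rewrite memNset//; have /andP[] := f01 x.
  rewrite eqi//; last by move=> x; have /andP[] := f01 x.
  rewrite -[in leRHS](setIT U) -integral_indic//.
  apply: ge0_le_integral => //.
  - by move=> x _; rewrite lee_fin; have /andP[] := f01 x.
  - by apply/measurable_EFinP; exact: measurable_indic.
  - move=> x _; rewrite lee_fin indicE; have [Ux|nUx] := pselect (U x).
      by rewrite mem_set//; have /andP[] := f01 x.
    rewrite memNset// leNgt; apply/negP => fx; apply: nUx; apply: fU.
    by apply: subset_closure; rewrite /= gt_eqF.
have eq_open U : open U -> mu U = nu U.
  move=> oU; apply/eqP; rewrite eq_le !le_open// => f cf f0 cf0.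
  by rewrite Cceq.
have [g [og gT gfin]] := open_finite_cover fin.
move=> A mA; apply: (@measure_unique _ R (borel T) (@open T) g) => //.
exact: openI.
Qed.

End borel_measures.

(** * Haar systems *)

Lemma ge0_integral_mrestr d (T : measurableType d) (R : realType)
    (mu : {measure set T -> \bar R}) (D E : set T) (mD : measurable D)
    (f : T -> \bar R) : measurable E -> measurable_fun E f ->
  (forall x, E x -> (0 <= f x)%E) ->
  (\int[mrestr mu mD]_(x in E) f x = \int[mu]_(x in E `&` D) f x)%E.
Proof.
move=> mE mf f0.
rewrite (@ge0_negligible_integral _ _ _ (mrestr mu mD) E (~` D))//; last 2 first.
- exact: measurableC.
- by rewrite -[LHS]/(mu (~` D `&` D)) setICl measure0.
rewrite setDE setCK; apply: eq_measure_integral => A mA AD.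
by rewrite /= /mrestr setIidl// => x /AD[].
Qed.

Section groupoid_algebra.
Variable G : groupoidType.
Implicit Types x y z : G.

Lemma gmulK x y : src x = rng y -> gmul (ginv x) (gmul x y) = y.
Proof.
by move=> xy; rewrite gmulA ?src_ginv// gmulVx xy gmul_rng.
Qed.

Lemma gmulVK x y : rng x = rng y -> gmul x (gmul (ginv x) y) = y.
Proof.
by move=> xy; rewrite gmulA ?rng_ginv ?src_ginv// gmulxV xy gmul_rng.
Qed.

Lemma ginvK x : ginv (ginv x) = x.
Proof.
rewrite -[LHS]gmul_src src_ginv rng_ginv -gmulVx gmulA ?src_ginv//.
by rewrite gmulVx src_ginv gmul_rng.
Qed.

Lemma ginv_gmul x y : src x = rng y -> ginv (gmul x y) = gmul (ginv y) (ginv x).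
Proof.
move=> xy.
have c1 : src (ginv y) = rng (ginv x) by rewrite src_ginv rng_ginv.
have e : gmul (gmul x y) (gmul (ginv y) (ginv x)) = rng x.
  have c0 : src y = rng (gmul (ginv y) (ginv x)) by rewrite (rng_gmul _ _ c1) rng_ginv.
  by rewrite -(gmulA _ _ _ xy c0) gmulVK ?gmulxV// rng_ginv.
have c2 : src (gmul x y) = rng (gmul (ginv y) (ginv x)).
  by rewrite src_gmul// rng_gmul// rng_ginv.
have := gmulK c2; rewrite e => <-.
by rewrite -(rng_gmul _ _ xy) -src_ginv gmul_src.
Qed.

Lemma src_inv_mul x y : rng x = rng y -> src (gmul (ginv x) y) = src y.
Proof. by move=> xy; rewrite src_gmul// src_ginv. Qed.

Lemma rng_inv_mul x y : rng x = rng y -> rng (gmul (ginv x) y) = src x.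
Proof. by move=> xy; rewrite rng_gmul ?rng_ginv// src_ginv. Qed.

End groupoid_algebra.

Section groupoid_topology.
Variable G : topGroupoidType.

Lemma unit_rng (x : G) : unit_space G (rng x).
Proof. by exists x. Qed.

Lemma unit_src (x : G) : unit_space G (src x).
Proof. by exists (src x); rewrite ?rng_src. Qed.

Lemma rng_unit (u : G) : unit_space G u -> rng u = u.
Proof. by move=> [x _ <-]; rewrite rng_rng. Qed.

Lemma src_unit (u : G) : unit_space G u -> src u = u.
Proof. by move=> [x _ <-]; rewrite src_rng. Qed.

Lemma src_continuous : continuous (src : G -> G).
Proof.
move=> x; have -> : (src : G -> G) = rng \o ginv by apply/funext => y; rewrite /= rng_ginv.
by apply: continuous_comp; [exact: ginv_continuous|exact: rng_continuous].
Qed.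

Lemma gmul_near (x y : G) (A : set G) : src x = rng y -> nbhs (gmul x y) A ->
  exists U V, [/\ nbhs x U, nbhs y V &
    forall x' y', U x' -> V y' -> src x' = rng y' -> A (gmul x' y')].
Proof.
move=> xy nA.
have /subspace_continuousP/(_ (x, y) xy)/(_ _ nA) := @gmul_continuous G.
move=> [[U V] /= [nU nV] UV]; exists U, V; split=> // x' y' Ux Vy xy'.
exact: (UV (x', y')).
Qed.

Lemma gmul_continuous_right (x : G) :
  {within rfiber (src x), continuous (gmul x : G -> G)}.
Proof.
apply/subspace_continuousP => y /= yx A nA.
have [U [V [nU nV UV]]] := gmul_near (esym yx) nA.
suff : nbhs y [set z | rng z = src x -> A (gmul x z)] by [].
by apply: filterS nV => z Vz zx; apply: UV => //; exact: nbhs_singleton nU.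
Qed.

End groupoid_topology.

Section haar_integration.
Variables (R : realType) (G : topGroupoidType).
Hypothesis (G_hausdorff : hausdorff_space G) (G_lc : locally_compact [set: G]).
Hypothesis (G_sc : @second_countable G).
Variable lam : G -> {measure set (borel G) -> \bar R}.
Hypothesis lam_haar : is_haar_system lam.

Let mrf (u : G) : measurable (rfiber u : set (borel G)).
Proof. exact: measurable_rfiber. Qed.

Lemma lam_finite u K : unit_space G u -> compact K -> (lam u K < +oo)%E.
Proof. by move=> uu; exact: haar_finite. Qed.

Lemma lam_sigma_finite u : unit_space G u -> sigma_finite setT (lam u).
Proof.
move=> uu; apply: (borel_sigma_finite G_hausdorff G_lc G_sc) => K cK.
exact: lam_finite.
Qed.

Lemma compact_translate (x : G) (K : set G) : compact K ->
  compact [set y | rng y = src x /\ K (gmul x y)].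
Proof.
move=> cK.
have -> : [set y | rng y = src x /\ K (gmul x y)] =
    gmul (ginv x) @` (K `&` rfiber (rng x)).
  apply/seteqP; split=> [y [yx Kxy]|_ [z [Kz zx] <-]].
    by exists (gmul x y); [rewrite /rfiber /= rng_gmul|rewrite gmulK].
  by split; rewrite ?rng_inv_mul ?gmulVK.
apply: continuous_compact; last by apply: compact_closedI cK _; exact: closed_rfiber.
apply: (continuous_subspaceW (B := rfiber (rng x))); first by move=> y [].
by rewrite -src_ginv; exact: gmul_continuous_right.
Qed.

(** Left translation by [x], set to [point] off the fiber over [src x] so that it becomes a total
    measurable map along which measures can be pushed forward. *)
Let trans (x : G) : borel G -> borel G :=
  fun y => if rng y == src x then gmul x y else point.

Let measurable_trans x : measurable_fun setT (trans x).
Proof.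
rewrite -(setUv (rfiber (src x))); apply/measurable_funU.
- exact: mrf.
- by apply: measurableC; exact: mrf.
split.
  apply: (@eq_measurable_fun _ _ _ _ (rfiber (src x) : set (borel G)) (gmul x : borel G -> borel G)).
    by move=> y /set_mem /= yx; rewrite /trans yx eqxx.
  move=> mD; apply: (@measurability _ _ (borel G) (borel G) _ _ (@open G)) => //.
  move=> _ [U oU <-]; rewrite setIC.
  have /continuousP/(_ _ oU)/open_subspaceP[V oV VD] := @gmul_continuous_right G x.
  by rewrite -VD; apply: measurableI => //; exact: sub_sigma_algebra.
apply: (@eq_measurable_fun _ _ _ _ _ (cst point)).
  by move=> y /set_mem /= yx; rewrite /trans; case: eqP.
exact: measurable_cst.
Qed.

Lemma Cc_cintegrable (u : G) (D : set G) (a : G -> R[i]) :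
  unit_space G u -> closed D -> Cc G a ->
  cintegrable (lam u) (D : set (borel G)) (a : borel G -> R[i]).
Proof.
move=> uu cD [ca cK]; apply: (cintegrable_compact G_hausdorff _ cD cK).
- exact: lam_finite.
- exact: continuous_subspaceT.
- move=> x _ nx; apply/eqP; apply: contrapT => /negP ax; apply: nx.
  exact: subset_closure.
Qed.

Lemma Cc_real (f : G -> R) : continuous f -> compact (closure [set x | f x != 0]) ->
  Cc G (fun x => (f x)%:C : R[i]).
Proof.
move=> cf cK; split.
  by move=> x; apply: cvg_real_complex; exact: cf.
rewrite (_ : [set x | (f x)%:C != 0] = [set x | f x != 0])//.
apply/seteqP; split=> x /=; apply: contraNN => /eqP; first by move=> ->.
by move=> /complexI ->.
Qed.

Let Cc_translate_finite (x : G) (f : G -> R) : continuous f ->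
  compact (closure [set x | f x != 0]) ->
  cintegrable (lam (src x)) (rfiber (src x) : set (borel G))
    (fun y => (f (gmul x y))%:C).
Proof.
move=> cf cK.
refine (@cintegrable_compact R G G_hausdorff (lam (src x)) (rfiber (src x)) _
    (fun y => (f (gmul x y))%:C) _ (@closed_rfiber G G_hausdorff _)
    (@compact_translate x _ cK) _ _).
- apply: lam_finite; [exact: unit_src|exact: compact_translate].
- move=> y; apply: (cvg_real_complex (T := subspace (rfiber (src x)))).
  apply: (@continuous_comp (subspace (rfiber (src x))) G R (gmul x) f).
    exact: gmul_continuous_right.
  exact: cf.
- move=> y yx ny; apply/eqP; apply: contrapT => /negP fy; apply: ny; split=> //.
  by apply: subset_closure; apply: contraNN fy => /= /eqP ->.
Qed.

Let real_integral_eq (u : G) (D : set G) (f : G -> R) :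
  cintegrable (lam u) (D : set (borel G)) (fun x => (f x)%:C) -> measurable (D : set (borel G)) ->
  (\int[lam u]_(x in D) (f x)%:E = (complex.Re (cintegral (lam u) D (fun x => (f x)%:C)))%:E)%E.
Proof.
by move=> [fi _] mD; rewrite /cintegral /= /Rintegral fineK//; exact: integrable_fin_num.
Qed.

(** Left invariance is an axiom for functions in [Cc] only. Both sides are values of Borel measures,
    a push-forward of [lam (src x)] and a restriction of [lam (rng x)], which agree on such
    functions and hence on all Borel sets by [Cc_measure_unique]. *)
Lemma haar_translate (x : G) (A : set (borel G)) : measurable A ->
  lam (src x) [set y | rng y = src x /\ A (gmul x y)] = lam (rng x) (A `&` rfiber (rng x)).
Proof.
move=> mA.
pose nu : {measure set (borel G) -> \bar R} := mrestr (lam (src x)) (mrf (src x)).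
pose mu2 : {measure set (borel G) -> \bar R} := mrestr (lam (rng x)) (mrf (rng x)).
pose pm : {measure set (borel G) -> \bar R} := pushforward nu (trans x).
pose mu1 := pm (measurable_trans x).
have mu1E B : mu1 B = lam (src x) [set y | rng y = src x /\ B (gmul x y)].
  rewrite -[LHS]/(lam (src x) ((trans x @^-1` B) `&` rfiber (src x))).
  congr (lam _ _); apply/seteqP; split=> [y [/= + yx]|y [yx By]].
    by rewrite /trans yx eqxx.
  by split=> //=; rewrite /trans yx eqxx.
rewrite -mu1E -[RHS]/(mu2 A); apply: esym.
apply: (Cc_measure_unique G_hausdorff G_lc G_sc _ _ mA).
  move=> K cK; rewrite -[mu2 K]/(lam (rng x) (K `&` rfiber (rng x))).
  apply: lam_finite; first exact: unit_rng.
  by apply: compact_closedI cK _; exact: closed_rfiber.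
move=> f cf f0 cK.
have mf : measurable_fun [set: borel G] (fun x => (f x)%:E).
  apply/measurable_EFinP; apply: (@measurable_within R G setT).
  by apply: continuous_subspaceT.
rewrite /mu1 /pm ge0_integral_pushforward//; last by move=> y _; rewrite lee_fin.
rewrite preimage_setT !ge0_integral_mrestr//; do ?by move=> y _ /=; rewrite lee_fin.
  rewrite !setTI real_integral_eq//; last first.
    apply: Cc_cintegrable; [exact: unit_rng|exact: closed_rfiber|exact: Cc_real].
  rewrite -haar_left_invariant//; last exact: Cc_real.
  rewrite -real_integral_eq//; last exact: Cc_translate_finite.
  by apply: eq_integral => y /set_mem /= yx; rewrite /trans yx eqxx.
exact: (measurableT_comp mf (measurable_trans x)).
Qed.

Lemma haar_invariant (x : G) (f : G -> \bar R) :
  measurable_fun (rfiber (rng x) : set (borel G)) (f : borel G -> \bar R) ->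
  (forall y, 0 <= f y)%E ->
  (\int[lam (src x)]_(y in rfiber (src x)) f (gmul x y) =
   \int[lam (rng x)]_(y in rfiber (rng x)) f y)%E.
Proof.
move=> mf f0.
pose nu : {measure set (borel G) -> \bar R} := mrestr (lam (src x)) (mrf (src x)).
pose pm : {measure set (borel G) -> \bar R} := pushforward nu (trans x).
pose mu1 := pm (measurable_trans x).
pose D : set (borel G) := rfiber (rng x).
rewrite -(@eq_measure_integral _ _ _ D (lam (rng x)) mu1 f); last first.
  move=> A mA AD.
  rewrite -[LHS]/(lam (src x) ((trans x @^-1` A) `&` rfiber (src x))).
  rewrite -{2}(setIidl AD) -haar_translate//.
  congr (lam _ _); apply/seteqP; split=> [y [/= + yx]|y [yx By]].
    by rewrite /trans yx eqxx.
  by split=> //=; rewrite /trans yx eqxx.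
have mE : measurable (trans x @^-1` D).
  by rewrite -[X in measurable X]setTI; exact: (@measurable_trans x measurableT _ (mrf (rng x))).
have fD : {in D, forall y, (0 <= f y)%E} by move=> y _; exact: f0.
rewrite /mu1 /pm (ge0_integral_pushforward (measurable_trans x) nu (mrf (rng x)) mf fD).
have mft : measurable_fun (trans x @^-1` D) (f \o trans x).
  apply: (measurable_comp (mrf (rng x)) _ mf).
    by move=> _ [y /= yD <-].
  exact: measurable_funTS (measurable_trans x).
have f0t y : (trans x @^-1` D) y -> (0 <= (f \o trans x) y)%E.
  by move=> _; exact: f0.
rewrite (ge0_integral_mrestr _ _ mE mft f0t).
have -> : trans x @^-1` D `&` rfiber (src x) = rfiber (src x).
  apply/setIidr => y /= yx; rewrite /trans yx eqxx /D /rfiber /=.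
  exact: rng_gmul.
by apply: eq_integral => y /set_mem /= yx; rewrite /trans yx eqxx.
Qed.

End haar_integration.

(** * The convolution algebra *)

Section convolution_Cc.
Variables (R : realType) (G : topGroupoidType).
Hypothesis (G_hausdorff : hausdorff_space G) (G_lc : locally_compact [set: G]).
Hypothesis (G_sc : @second_countable G).
Variable lam : G -> {measure set (borel G) -> \bar R}.
Hypothesis lam_haar : is_haar_system lam.
Implicit Types (a b : G -> R[i]) (x y z u : G).

Let mrf u : measurable (rfiber u : set (borel G)).
Proof. exact: measurable_rfiber. Qed.

Let crf u : closed (rfiber u).
Proof. exact: closed_rfiber. Qed.

Lemma hausdorff_separate x y : x <> y ->
  exists A B, [/\ nbhs x A, nbhs y B & forall z w, A z -> B w -> z <> w].
Proof.
move=> /eqP xy; have := G_hausdorff; rewrite open_hausdorff => /(_ _ _ xy).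
move=> [[A B] /= [/set_mem Ax /set_mem By] [oA oB /eqP AB]].
exists A, B; split; try exact: open_nbhs_nbhs.
by move=> z w Az Bw zw; have : (A `&` B) z; [split=> //; rewrite zw|rewrite AB].
Qed.

Lemma closed_composable : closed (@composable G).
Proof.
rewrite -[X in closed X]setCK; apply: open_closedC; rewrite openE => -[x y] /= xy.
have [A [B [nA nB AB]]] := hausdorff_separate xy.
exists (src @^-1` A, rng @^-1` B).
  by split; [exact: (@src_continuous G x)|exact: (@rng_continuous G y)].
by move=> [p q] /= [Ap Bq]; exact: AB.
Qed.

Lemma compact_set_gmul (K L : set G) : compact K -> compact L ->
  compact [set gmul p.1 p.2 | p in (K `*` L) `&` @composable G].
Proof.
move=> cK cL; apply: continuous_compact.
  apply: (continuous_subspaceW (B := @composable G)); first by move=> p [].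
  exact: gmul_continuous.
by apply: compact_closedI; [exact: compact_setX|exact: closed_composable].
Qed.

Lemma Cc_supp a x : a x != 0 -> closure [set x | a x != 0] x.
Proof. by move=> ax; exact: subset_closure. Qed.

Lemma Cc_compact_supp a (K : set G) : continuous (a : G -> R[i]^o) -> compact K ->
  (forall x, a x != 0 -> K x) -> Cc G a.
Proof.
move=> ca cK aK; split=> //; apply: (subclosed_compact _ cK).
  exact: closed_closure.
rewrite closureE; apply: smallest_sub => //.
exact: (compact_closed G_hausdorff).
Qed.

Lemma Cc_cabs a : Cc G a -> Cc G (fun x => (cabs (a x))%:C : R[i]).
Proof.
move=> [ca cK]; apply: (Cc_compact_supp _ cK).
  by move=> x; apply: cvg_real_complex; apply: cvg_cabs; exact: ca.
move=> x ax; apply: Cc_supp; apply: contraNN ax => /eqP ->.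
by rewrite cabs0.
Qed.

Lemma Cc_lin (k : R[i]) a b : Cc G a -> Cc G b -> Cc G (fun x => k * a x + b x).
Proof.
move=> [ca cK] [cb cL]; apply: (Cc_compact_supp _ (compactU cK cL)).
  move=> x; apply: (@cvgD R[i] R[i]^o); last exact: cb.
  by apply: cvgM; [exact: cvg_cst|exact: ca].
move=> x abx; have [ax|ax] := eqVneq (a x) 0; last by left; exact: Cc_supp.
right; apply: Cc_supp; apply: contraNN abx => /eqP ->.
by rewrite ax mulr0 addr0.
Qed.

Lemma Cc0 : Cc G (fun=> 0 : R[i]).
Proof.
apply: (Cc_compact_supp _ (@compact0 G)); first by move=> x; exact: cvg_cst.
by move=> x; rewrite eqxx.
Qed.

Lemma Cc_invol a : Cc G a -> Cc G (invol a).
Proof.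
move=> [ca cK]; apply: (@Cc_compact_supp _ (ginv @` closure [set x | a x != 0])).
- move=> x; apply: cvg_conj.
  by apply: (@continuous_comp G G R[i]^o ginv a); [exact: ginv_continuous|exact: ca].
- apply: continuous_compact cK; apply: continuous_subspaceT.
  exact: ginv_continuous.
- move=> x ax; exists (ginv x); last exact: ginvK.
  by apply: Cc_supp; apply: contraNN ax => /eqP ax; rewrite /invol ax conjc0.
Qed.

Lemma Cc_mull a b : Cc G a -> continuous (b : G -> R[i]^o) -> Cc G (fun x => a x * b x).
Proof.
move=> [ca cK] cb; apply: (Cc_compact_supp _ cK).
  by move=> x; apply: (@cvgM R[i]); [exact: ca|exact: cb].
by move=> x abx; apply: Cc_supp; apply: contraNN abx => /eqP ->; rewrite mul0r.
Qed.

(** Over units the fiber integral of [|a|] is continuous, and it vanishes off the compact set of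
    ranges of the support. This makes the I-norm finite on [Cc]. *)
Lemma Cc_integral_bounded a : Cc G a -> exists2 C : R, 0 <= C &
  forall u, unit_space G u -> (\int[lam u]_(x in rfiber u) (cabs (a x))%:E <= C%:E)%E.
Proof.
move=> Ca; have [ca cK] := Ca; have Cb := Cc_cabs Ca.
pose phi u := complex.Re (cintegral (lam u) (rfiber u) (fun x => (cabs (a x))%:C)).
have phiE u : unit_space G u ->
    (\int[lam u]_(x in rfiber u) (cabs (a x))%:E = (phi u)%:E)%E.
  move=> uu; have [fi _] := Cc_cintegrable G_hausdorff lam_haar uu (@crf u) Cb.
  by rewrite /phi /cintegral /= /Rintegral fineK//; exact: integrable_fin_num.
have cphi : {within unit_space G, continuous phi}.
  move=> u; apply: (cvg_Re (T := subspace (unit_space G))).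
  exact: (haar_continuous lam_haar Cb).
set K := closure [set x | a x != 0] in cK.
have cKr : compact (rng @` K).
  by apply: continuous_compact cK; apply: continuous_subspaceT; exact: rng_continuous.
have /compact_bounded[M [Mr MP]] : compact (phi @` (rng @` K) : set R^o).
  apply: continuous_compact cKr.
  by apply: (continuous_subspaceW (B := unit_space G)) => // _ [x _ <-]; exact: unit_rng.
have M1 : M < Num.max 0 M + 1.
  by rewrite (@le_lt_trans _ _ (Num.max 0 M)) ?ltrDl// le_max lexx orbT.
have M2 : 0 <= Num.max 0 M + 1 by rewrite addr_ge0// le_max lexx.
exists (Num.max 0 M + 1) => // u uu.
have [uK|uK] := pselect ((rng @` K) u).
  rewrite phiE// lee_fin (le_trans (ler_norm _))//; apply: (MP _ M1).
  by exists u.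
rewrite integral0_eq ?lee_fin// => x xu.
suff -> : a x = 0 by rewrite cabs0.
apply/eqP; apply: contrapT => /negP ax; apply: uK; exists x => //.
exact: Cc_supp.
Qed.

Lemma inv_mul_continuous x :
  {within rfiber (rng x), continuous (fun y : G => gmul (ginv y) x)}.
Proof.
apply/subspace_continuousP => y /= yx A nA.
have [|U [V [nU nV UV]]] := gmul_near _ nA; first by rewrite src_ginv.
suff : nbhs y [set z | rng z = rng x -> A (gmul (ginv z) x)] by [].
have : nbhs y (ginv @^-1` U) by exact: (@ginv_continuous G y).
apply: filterS => z Uz zx; apply: UV => //; first exact: nbhs_singleton nV.
by rewrite src_ginv.
Qed.

Lemma conv_integrand_continuous a b x : continuous (a : G -> R[i]^o) ->
  continuous (b : G -> R[i]^o) ->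
  {within rfiber (rng x), continuous (fun y => a y * b (gmul (ginv y) x) : R[i]^o)}.
Proof.
move=> ca cb y; apply: (@cvgM R[i] (subspace (rfiber (rng x)))).
  exact: (continuous_subspaceT ca).
apply: (@continuous_comp (subspace (rfiber (rng x))) G R[i]^o
  (fun y => gmul (ginv y) x) b); last exact: cb.
exact: inv_mul_continuous.
Qed.

Lemma conv_integrable a b x : Cc G a -> continuous (b : G -> R[i]^o) ->
  cintegrable (lam (rng x)) (rfiber (rng x) : set (borel G))
    (fun y => a y * b (gmul (ginv y) x)).
Proof.
move=> [ca cK] cb.
refine (@cintegrable_compact R G G_hausdorff (lam (rng x)) (rfiber (rng x)) _
    (fun y => a y * b (gmul (ginv y) x)) _ (@crf _) cK _ _).
- by apply: (lam_finite lam_haar) => //; exact: unit_rng.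
- exact: (@conv_integrand_continuous a b x ca cb).
- move=> y _ ny; suff -> : a y = 0 by rewrite mul0r.
  by apply/eqP; apply: contrapT => /negP /Cc_supp.
Qed.

Lemma conv_supp a b x : conv lam a b x != 0 ->
  exists y, [/\ rng y = rng x, a y != 0 & b (gmul (ginv y) x) != 0].
Proof.
move=> abx; apply: contrapT => H; move/negP : abx; apply; apply/eqP.
rewrite /conv -(@cintegral0 _ _ _ (lam (rng x)) (rfiber (rng x)) (mrf _)).
apply: eq_cintegral => y yx; apply/eqP; apply: contrapT => /negP.
by rewrite mulf_eq0 negb_or => /andP[ay bx]; apply: H; exists y.
Qed.

(** A tube argument over [K]: at points over [rng x0] continuity of the product is enough, and
    around the others the condition is void, because their range differs from [rng x] for [x] near
    [x0]. *)
Lemma conv_near b (K : set G) x0 (B : G -> R[i]^o) (e : R) : 0 < e ->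
  compact K -> continuous (b : G -> R[i]^o) -> continuous B ->
  (forall y, K y -> rng y = rng x0 -> B y = b (gmul (ginv y) x0)) ->
  \forall x \near x0, forall y, K y -> rng y = rng x ->
    cabs (B y - b (gmul (ginv y) x)) < e.
Proof.
move=> e0 /compact_near_coveringP cK cb cB BE.
have H := cK G (nbhs x0) (fun x y => rng y = rng x ->
  cabs (B y - b (gmul (ginv y) x)) < e) (nbhs_filter x0).
apply: H => y Ky.
have e2 : 0 < e / 2 by rewrite divr_gt0.
have [yx|yx] := pselect (rng y = rng x0); last first.
  have [P [Q [nP nQ PQ]]] := hausdorff_separate yx.
  exists (rng @^-1` P, rng @^-1` Q).
    by split; [exact: (@rng_continuous G y)|exact: (@rng_continuous G x0)].
  by move=> [y' x'] /= [Py Qx] yx'; have := PQ _ _ Py Qx yx'.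
have nB : nbhs y [set y' | cabs (B y - B y') < e / 2].
  have : nbhs (B y) [set w | cabs (B y - w) < e / 2].
    by apply/rnorm_ballP; exists (e / 2).
  exact: cB.
have nb : nbhs (gmul (ginv y) x0) [set w | cabs (B y - b w) < e / 2].
  rewrite (BE _ Ky yx); set w0 := gmul _ _.
  have : nbhs (b w0 : R[i]^o) [set w | cabs (b w0 - w) < e / 2].
    by apply/rnorm_ballP; exists (e / 2).
  exact: cb.
have [|U [V [nU nV UV]]] := gmul_near _ nb; first by rewrite src_ginv.
exists ([set y' | cabs (B y - B y') < e / 2] `&` (ginv @^-1` U), V).
  by split=> //; apply: filterI => //; exact: (@ginv_continuous G y).
move=> [y' x'] /= [[By' Uy'] Vx'] yx'.
have -> : B y' - b (gmul (ginv y') x') =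
    (B y' - B y) + (B y - b (gmul (ginv y') x')) by rewrite addrA subrK.
rewrite (le_lt_trans (cabsD _ _))// (splitr e) ltrD//; first by rewrite cabsB.
by apply: UV => //; rewrite src_ginv.
Qed.

(** The measure and the integrand both move with [x], while continuity of the Haar system concerns
    one fixed function. The factor [y |-> b (y^-1 x0)], given on a single fiber, is extended from a
    compact set to [B] on [G] by Tietze. The integral of [a * B] is continuous in the unit, and
    [conv_near] bounds its distance to the convolution near [x0]. *)
Lemma conv_continuous a b : Cc G a -> Cc G b ->
  continuous (conv lam a b : G -> R[i]^o).
Proof.
move=> Ca [cb _] x0; have [ca cK] := Ca.
set K := closure [set x | a x != 0] in cK.
have cM : compact (K `&` rfiber (rng x0)) by exact: compact_closedI.
have [|B [cB BE]] := @compact_tietze_complex R G G_hausdorff G_lc _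
    (fun y => b (gmul (ginv y) x0)) cM.
  apply: (continuous_subspaceW (B := rfiber (rng x0))); first by move=> y [].
  move=> y; apply: (@continuous_comp (subspace (rfiber (rng x0))) G R[i]^o
    (fun y => gmul (ginv y) x0) b); last exact: cb.
  exact: inv_mul_continuous.
have CF := Cc_mull Ca cB.
have [C C0 aC] := Cc_integral_bounded Ca.
move=> A /rnorm_ballP[e e0 eA].
have e2 : 0 < e / 2 by rewrite divr_gt0.
pose d := e / 2 / (C + 1).
have C1 : 0 < C + 1 by rewrite ltr_wpDl.
have d0 : 0 < d by rewrite divr_gt0.
have N1 : \forall x \near x0, forall y, K y -> rng y = rng x ->
    cabs (B y - b (gmul (ginv y) x)) < d.
  exact: (conv_near d0 cK cb cB (fun y Ky yx => BE y (conj Ky yx))).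
pose phi u := cintegral (lam u) (rfiber u) (fun y => a y * B y).
have N2 : \forall x \near x0, cabs (phi (rng x0) - phi (rng x)) < e / 2.
  have /subspace_continuousP/(_ _ (unit_rng x0)) := haar_continuous lam_haar CF.
  have nb : nbhs (phi (rng x0) : R[i]^o) [set w | cabs (phi (rng x0) - w) < e / 2].
    by apply/rnorm_ballP; exists (e / 2).
  move=> /(_ _ nb) nu.
  have nx : nbhs x0 [set x | unit_space G (rng x) ->
      cabs (phi (rng x0) - phi (rng x)) < e / 2] by exact: @rng_continuous G x0 _ nu.
  by apply: filterS nx => x; apply; exact: unit_rng.
suff : nbhs x0 [set x | A (conv lam a b x)] by [].
apply: filterS2 N1 N2 => x h1 h2; apply: eA.
have E0 : conv lam a b x0 = phi (rng x0).
  apply: eq_cintegral => y yx; have [->|ay] := eqVneq (a y) 0; first by rewrite !mul0r.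
  by rewrite BE//; split=> //; exact: Cc_supp.
have -> : (conv lam a b x0 : R[i]^o) - conv lam a b x =
    (phi (rng x0) - phi (rng x)) + (phi (rng x) - conv lam a b x).
  by rewrite E0 addrA subrK.
apply: (@le_lt_trans _ _ (cabs (phi (rng x0) - phi (rng x)) + cabs (phi (rng x) - conv lam a b x))).
  exact: (@rnormD R R[i]^o).
rewrite (splitr e) ltr_leD//.
have i1 := Cc_cintegrable G_hausdorff lam_haar (unit_rng x) (@crf (rng x)) CF.
have i2 := conv_integrable x Ca cb.
rewrite /phi /conv -cintegralB//.
rewrite -lee_fin.
have i3 := cintegrable_lin (mrf (rng x)) (-1) i2 i1.
have i4 : cintegrable (lam (rng x)) (rfiber (rng x) : set (borel G))
    (fun y => a y * B y - a y * b (gmul (ginv y) x)).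
  move: i3; congr cintegrable; apply/funext => y.
  by rewrite mulN1r addrC.
apply: (le_trans (cabs_cintegral_le_integral (mrf _) i4)).
apply: (@le_trans _ _ (\int[lam (rng x)]_(y in rfiber (rng x)) (d%:E * (cabs (a y))%:E))%E).
  apply: ge0_le_integral => //.
  - by move=> y _; rewrite lee_fin cabs_ge0.
  - exact: measurable_int (cintegrable_cabs (mrf _) i4).
  - apply: measurable_funeM; apply/measurable_EFinP/cmeasurable_cabs.
    exact: (cmeasurable_within (continuous_subspaceT ca)).
  - move=> y yx; rewrite -EFinM lee_fin -mulrBr cabsM mulrC.
    have [->|ay] := eqVneq (a y) 0; first by rewrite cabs0 !mulr0.
    by rewrite ler_wpM2r ?cabs_ge0// ltW// h1//; exact: Cc_supp.
rewrite ge0_integralZl//; last 3 first.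
- apply/measurable_EFinP/cmeasurable_cabs.
  exact: (cmeasurable_within (continuous_subspaceT ca)).
- by move=> y _; rewrite lee_fin cabs_ge0.
- by rewrite lee_fin ltW.
apply: (@le_trans _ _ (d%:E * C%:E)%E).
  by apply: lee_wpmul2l; [rewrite lee_fin ltW|apply: aC; exact: unit_rng].
by rewrite -EFinM lee_fin /d mulrAC ler_pdivrMr// ler_wpM2l ?(ltW e2)// lerDl.
Qed.

Lemma conv_Cc a b : Cc G a -> Cc G b -> Cc G (conv lam a b).
Proof.
move=> Ca Cb; have [_ cK] := Ca; have [_ cL] := Cb.
apply: (Cc_compact_supp (conv_continuous Ca Cb) (compact_set_gmul cK cL)) => x.
move=> /conv_supp[y [yx ay bx]].
exists (y, gmul (ginv y) x); last by rewrite /= gmulVK.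
split; last by rewrite /composable /= rng_inv_mul.
by split; exact: Cc_supp.
Qed.

End convolution_Cc.

Lemma gmul_within (G : topGroupoidType) (T : topologicalType) (D : set T)
    (f g : T -> G) : {within D, continuous f} -> {within D, continuous g} ->
  (forall t, D t -> src (f t) = rng (g t)) ->
  {within D, continuous (fun t => gmul (f t) (g t))}.
Proof.
move=> /subspace_continuousP cf /subspace_continuousP cg fg.
apply/subspace_continuousP => t Dt A nA.
have [U [V [nU nV UV]]] := gmul_near (fg _ Dt) nA.
have h1 : nbhs t [set s | D s -> U (f s)] by exact: cf _ Dt _ nU.
have h2 : nbhs t [set s | D s -> V (g s)] by exact: cg _ Dt _ nV.
suff : nbhs t [set s | D s -> A (gmul (f s) (g s))] by [].
by apply: filterS2 h1 h2 => s h1 h2 Ds; apply: UV; [exact: h1|exact: h2|exact: fg].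
Qed.

Section convolution_algebra.
Variables (R : realType) (G : topGroupoidType).
Hypothesis (G_hausdorff : hausdorff_space G) (G_lc : locally_compact [set: G]).
Hypothesis (G_sc : @second_countable G).
Variable lam : G -> {measure set (borel G) -> \bar R}.
Hypothesis lam_haar : is_haar_system lam.
Implicit Types (a b c : G -> R[i]) (x y z u : G).

Let mrf u : measurable (rfiber u : set (borel G)).
Proof. exact: measurable_rfiber. Qed.

Let crf u : closed (rfiber u).
Proof. exact: closed_rfiber. Qed.

Let fint := conv_integrable G_hausdorff lam_haar.

Lemma involK a : invol (invol a) = a.
Proof. by apply/funext => x; rewrite /invol ginvK conjcK. Qed.

Lemma invol_lin k a b :
  invol (fun x => k * a x + b x) = (fun x => k^*%C * invol a x + invol b x).
Proof. by apply/funext => x; rewrite /invol rmorphD rmorphM. Qed.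

Lemma conv_linl k a b c : Cc G a -> Cc G b -> continuous (c : G -> R[i]^o) ->
  conv lam (fun x => k * a x + b x) c = (fun x => k * conv lam a c x + conv lam b c x).
Proof.
move=> Ca Cb cc; apply/funext => x; rewrite /conv -cintegral_lin//; try exact: fint.
by congr cintegral; apply/funext => y; rewrite mulrDl mulrA.
Qed.

Lemma conv_linr k a b c : Cc G a -> continuous (b : G -> R[i]^o) ->
  continuous (c : G -> R[i]^o) ->
  conv lam a (fun x => k * b x + c x) = (fun x => k * conv lam a b x + conv lam a c x).
Proof.
move=> Ca cb cc; apply/funext => x; rewrite /conv -cintegral_lin//; try exact: fint.
by congr cintegral; apply/funext => y; rewrite mulrDr mulrCA.
Qed.

(** Positive and negative parts have equal integrals on both sides, so the values agree even where a
    divergent integral takes its default value. Functions that are merely measurable on a fiber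
    occur later. *)
Lemma haar_invariant_complex x (f : G -> R[i]) :
  cmeasurable (rfiber (rng x) : set (borel G)) (f : borel G -> R[i]) ->
  cintegral (lam (src x)) (rfiber (src x)) (fun y => f (gmul x y)) =
  cintegral (lam (rng x)) (rfiber (rng x)) f.
Proof.
have real_case (h : G -> R) :
    measurable_fun (rfiber (rng x) : set (borel G)) (h : borel G -> R) ->
    \int[lam (src x)]_(y in rfiber (src x)) h (gmul x y) =
    \int[lam (rng x)]_(y in rfiber (rng x)) h y.
  move=> /measurable_EFinP mh; rewrite /Rintegral; congr fine.
  rewrite integralE [RHS]integralE; congr (_ - _)%E.
    rewrite -(@haar_invariant _ _ G_hausdorff G_lc G_sc _ lam_haar x ((EFin \o h)^\+)%E)//.
      by apply: eq_integral => y _; rewrite !funeposE.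
    exact: measurable_funepos.
  rewrite -(@haar_invariant _ _ G_hausdorff G_lc G_sc _ lam_haar x ((EFin \o h)^\-)%E)//.
    by apply: eq_integral => y _; rewrite !funenegE.
  exact: measurable_funeneg.
move=> [mr mi]; congr (_ +i* _).
  exact: (real_case (fun y => complex.Re (f y))).
exact: (real_case (fun y => complex.Im (f y))).
Qed.

(** The substitution [y = x w] moves the right-hand integral to the fiber over [src x], where the
    two integrands coincide. *)
Lemma invol_conv a b : Cc G a -> Cc G b ->
  invol (conv lam a b) = conv lam (invol b) (invol a).
Proof.
move=> Ca Cb; have [cb' _] := Cc_invol G_hausdorff Cb; have [ca' _] := Cc_invol G_hausdorff Ca.
apply/funext => x; rewrite /invol {1}/conv rng_ginv -cintegral_conj//; last first.
  have [cb _] := Cb; have := fint (ginv x) Ca cb; by rewrite rng_ginv.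
rewrite /conv -haar_invariant_complex; last first.
  exact: (cmeasurable_within (@conv_integrand_continuous R G _ _ x cb' ca')).
apply: eq_cintegral => w wx; rewrite /invol.
have xw : src x = rng w by [].
have e : gmul (ginv (gmul x w)) x = ginv w.
  rewrite ginv_gmul// -gmulA ?src_ginv ?rng_ginv//; last first.
  by rewrite gmulVx xw -[X in gmul _ X](@src_ginv _ w) gmul_src.
by rewrite e ginvK ginv_gmul// rmorphM /= mulrC.
Qed.

Let cfst (D : set (G * G)) : {within D, continuous (fst : G * G -> G)}.
Proof. by apply: continuous_subspaceT => p; exact: cvg_fst. Qed.

Let csnd (D : set (G * G)) : {within D, continuous (snd : G * G -> G)}.
Proof. by apply: continuous_subspaceT => p; exact: cvg_snd. Qed.

Let within_comp (T : topologicalType) (D : set T) (U W : topologicalType)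
    (f : T -> U) (g : U -> W) : {within D, continuous f} -> continuous g ->
  {within D, continuous (g \o f)}.
Proof.
by move=> cf cg t; apply: (@continuous_comp (subspace D) U W f g); [exact: cf|exact: cg].
Qed.

Lemma measurable_prod_within (u : G) (F : G * G -> R[i]) :
  {within rfiber u `*` rfiber u, continuous (F : G * G -> R[i]^o)} ->
  cmeasurable (rfiber u `*` rfiber u : set (borel G * borel G)%type)
    (F : (borel G * borel G)%type -> R[i]).
Proof.
move=> cF; split; apply: (measurable_within_prod G_sc) => p.
  by apply: (cvg_Re (T := subspace (rfiber u `*` rfiber u))); exact: cF.
by apply: (cvg_Im (T := subspace (rfiber u `*` rfiber u))); exact: cF.
Qed.

Lemma shear_continuous u a b : continuous (a : G -> R[i]^o) ->
  continuous (b : G -> R[i]^o) ->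
  {within rfiber u `*` rfiber u,
    continuous (fun p : G * G => a p.2 * b (gmul (ginv p.2) p.1) : R[i]^o)}.
Proof.
move=> ca cb p; apply: (@cvgM R[i] (subspace (rfiber u `*` rfiber u))).
  exact: (within_comp (@csnd _) ca).
apply: (@within_comp _ _ _ _ (fun p : G * G => gmul (ginv p.2) p.1) _ _ cb).
apply: gmul_within.
- exact: (within_comp (@csnd _) (@ginv_continuous G)).
- exact: cfst.
- by move=> [y z] [/= yu zu]; rewrite src_ginv yu zu.
Qed.

(** Fubini's theorem for [F], followed by the substitution [y = z w] in the inner integral. *)
Lemma convA a b c : Cc G a -> Cc G b -> Cc G c ->
  conv lam (conv lam a b) c = conv lam a (conv lam b c).
Proof.
move=> Ca Cb Cc'; have [ca _] := Ca; have [cb _] := Cb; have [cc _] := Cc'.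
have Cab := conv_Cc G_hausdorff G_lc lam_haar Ca Cb.
apply/funext => x; set u := rng x.
have sf := lam_sigma_finite G_hausdorff G_lc G_sc lam_haar (unit_rng x).
pose F (p : G * G) := a p.2 * b (gmul (ginv p.2) p.1) * c (gmul (ginv p.1) x).
have cF : {within rfiber u `*` rfiber u, continuous (F : G * G -> R[i]^o)}.
  move=> p; apply: (@cvgM R[i] (subspace (rfiber u `*` rfiber u))).
    exact: (@shear_continuous u a b ca cb p).
  apply: (@within_comp _ _ _ _ (fun p : G * G => gmul (ginv p.1) x) _ _ cc).
  apply: gmul_within.
  - exact: (within_comp (@cfst _) (@ginv_continuous G)).
  - by apply: continuous_subspaceT => q; exact: cvg_cst.
  - by move=> [y z] [/= yu zu]; rewrite src_ginv yu.
have inner y : rfiber u y -> cintegrable (lam u) (rfiber u : set (borel G))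
    (fun z => F (y, z)).
  move=> yu; have := fint y Ca cb; rewrite (yu : rng y = u) => h.
  have := cintegrableZ (mrf u) (c (gmul (ginv y) x)) h.
  by under eq_fun do rewrite mulrC.
(* For fixed [z] the factor [b (z^-1 y)] confines [y] to a translate of a compact set. *)
have outer z : rfiber u z -> cintegrable (lam u) (rfiber u : set (borel G))
    (fun y => F (y, z)).
  move=> zu; have [_ cKb] := Cb.
  refine (@cintegrable_compact R G G_hausdorff (lam u) (rfiber u) _
    (fun y => F (y, z)) _ (@crf _) (@compact_translate _ G_hausdorff (ginv z) _ cKb) _ _).
  - apply: (lam_finite lam_haar); [exact: unit_rng|exact: compact_translate].
  - move=> y; apply: (@cvgM R[i] (subspace (rfiber u))).
      apply: (@cvgM R[i] (subspace (rfiber u))); first exact: cvg_cst.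
      apply: (@within_comp _ _ _ _ (fun y => gmul (ginv z) y) _ _ cb).
      by rewrite -zu -src_ginv; exact: gmul_continuous_right.
    apply: (@within_comp _ _ _ _ (fun y => gmul (ginv y) x) _ _ cc).
    exact: inv_mul_continuous.
  - move=> y yu ny; rewrite /F /= (_ : b _ = 0) ?mulr0 ?mul0r//.
    apply/eqP; apply: contrapT => /negP /Cc_supp h; apply: ny; split=> //.
    by rewrite src_ginv zu.
(* The double integral of [|F|] is that of the convolution of [|a|] and [|b|] at [y] times
   [|c (y^-1 x)|], which is finite because this convolution is again in [Cc]. *)
have fin : (\int[lam u]_(y in rfiber u) \int[lam u]_(z in rfiber u)
    (cabs (F (y, z)))%:E < +oo)%E.
  have CA := Cc_cabs G_hausdorff Ca; have CB := Cc_cabs G_hausdorff Cb.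
  have CC := Cc_cabs G_hausdorff Cc'.
  have CAB := conv_Cc G_hausdorff G_lc lam_haar CA CB.
  have [cB _] := CB; have [cC _] := CC.
  have [h _] := fint x CAB cC.
  have /(integrable_lty (mrf u)) : (lam u).-integrable (rfiber u) _ := h.
  congr (_ < _)%E; apply: eq_integral => y /set_mem yu.
  set A := conv lam _ _ y.
  have -> : complex.Re (A * (cabs (c (gmul (ginv y) x)))%:C) =
      complex.Re A * cabs (c (gmul (ginv y) x)).
    by case: A => p q; simpc.
  have [k _] := fint y CA cB; rewrite (yu : rng y = u) in k.
  rewrite /A /conv /cintegral (yu : rng y = u) /= -RintegralZr//.
  rewrite /Rintegral fineK; last first.
    apply: integrable_fin_num => //.
    under eq_fun do rewrite EFinM.
    exact: (integrableZr (mrf u)).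
  apply: eq_integral => z _; rewrite /F /= !cabsM; congr ((_ * _)%:E).
  by rewrite mulr0 subr0.
transitivity (cintegral (lam u) (rfiber u)
    (fun y => cintegral (lam u) (rfiber u) (fun z => F (y, z)))).
  apply: eq_cintegral => y yx.
  have yu : rng y = u by [].
  rewrite mulrC {1}/conv yu -cintegralZ//; last first.
    by have := fint y Ca cb; rewrite yu.
  by apply: eq_cintegral => z zu; rewrite mulrC.
rewrite (cfubini_on sf sf (mrf u) (mrf u) (measurable_prod_within cF) fin inner outer).
apply: eq_cintegral => z zx; have zu : rng z = u by [].
rewrite /conv rng_inv_mul// -cintegralZ//; last first.
  by have := fint (gmul (ginv z) x) Cb cc; rewrite rng_inv_mul.
have -> : cintegral (lam u) (rfiber u) (fun y => F (y, z)) =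
    cintegral (lam (rng z)) (rfiber (rng z)) (fun y => F (y, z)) by rewrite zu.
rewrite -haar_invariant_complex; last first.
  by rewrite zu; exact: cintegrable_measurable (outer _ zu).
apply: eq_cintegral => w wz; have zw : src z = rng w by [].
by rewrite /F /= gmulK// -mulrA ginv_gmul// gmulA// ?src_ginv// rng_ginv.
Qed.

End convolution_algebra.

(** * The I-norm *)

Section I_norm.
Variables (R : realType) (G : topGroupoidType).
Hypothesis (G_hausdorff : hausdorff_space G) (G_lc : locally_compact [set: G]).
Hypothesis (G_sc : @second_countable G).
Variable lam : G -> {measure set (borel G) -> \bar R}.
Hypothesis lam_haar : is_haar_system lam.
Implicit Types (a b c : G -> R[i]) (x y z u : G).

Let mrf u : measurable (rfiber u : set (borel G)).
Proof. exact: measurable_rfiber. Qed.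

Let fint := conv_integrable G_hausdorff lam_haar.

Definition range_norm a : \bar R :=
  ereal_sup [set (\int[lam u]_(x in rfiber u) (cabs (a x))%:E)%E
            | u in unit_space G].

Lemma measurable_cabs_fiber a (D : set G) : continuous (a : G -> R[i]^o) ->
  measurable_fun (D : set (borel G)) (fun x => (cabs (a x))%:E).
Proof.
move=> ca; apply/measurable_EFinP/cmeasurable_cabs.
by apply: cmeasurable_within; exact: continuous_subspaceT.
Qed.

(** Inversion carries the second supremum to the range norm of [invol a], so estimates of the I-norm
    reduce to [range_norm] of a function and of its involution. *)
Lemma InormE a : continuous (a : G -> R[i]^o) ->
  Inorm lam a = Order.max (range_norm a) (range_norm (invol a)).
Proof.
move=> ca; congr (Order.max _ (ereal_sup _)).
apply: eq_imagel => u _.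
pose pm : {measure set (borel G) -> \bar R} :=
  pushforward (lam u) (ginv : borel G -> borel G).
pose mu := pm (@measurable_ginv G).
have msf : measurable (sfiber u : set (borel G)).
  have -> : sfiber u = (ginv : borel G -> borel G) @^-1` rfiber u.
    by apply/seteqP; split=> x; rewrite /rfiber /sfiber /= rng_ginv.
  rewrite -[X in measurable X]setTI; exact: (@measurable_ginv G measurableT _ (mrf u)).
rewrite (@eq_measure_integral _ _ _ _ mu)//.
rewrite /mu /pm (ge0_integral_pushforward (@measurable_ginv G))//; last 2 first.
- exact: (@measurable_cabs_fiber a _ ca).
- by move=> y _; rewrite lee_fin cabs_ge0.
have -> : (ginv : borel G -> borel G) @^-1` sfiber u = rfiber u.
  by apply/seteqP; split=> x; rewrite /rfiber /sfiber /= src_ginv.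
by apply: eq_integral => x _; rewrite /= /invol cabs_conj.
Qed.

Lemma range_norm_ge0 a : (0 <= range_norm a)%E.
Proof.
apply: (@le_trans _ _ (\int[lam (rng point)]_(x in rfiber (rng point)) (cabs (a x))%:E)%E).
  by apply: integral_ge0 => x _; rewrite lee_fin cabs_ge0.
by apply: ereal_sup_ubound; exists (rng point) => //; exact: unit_rng.
Qed.

Lemma range_norm_lty a : Cc G a -> (range_norm a < +oo)%E.
Proof.
move=> /(Cc_integral_bounded G_hausdorff lam_haar)[C C0 aC].
apply: (@le_lt_trans _ _ C%:E); last exact: ltry.
by apply: ub_ereal_sup => _ [u uu <-]; exact: aC.
Qed.

Lemma range_norm_ub a u : unit_space G u ->
  (\int[lam u]_(x in rfiber u) (cabs (a x))%:E <= range_norm a)%E.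
Proof. by move=> uu; apply: ereal_sup_ubound; exists u. Qed.

(** Tonelli's theorem for [|a y| |b (y^-1 x)|]: for fixed [y], left invariance turns the integral
    over [x] into the integral of [|b|] over the fiber at [src y]. *)
Lemma range_norm_conv a b : Cc G a -> Cc G b ->
  (range_norm (conv lam a b) <= range_norm a * range_norm b)%E.
Proof.
move=> Ca Cb; have [ca _] := Ca; have [cb _] := Cb.
have Cab := conv_Cc G_hausdorff G_lc lam_haar Ca Cb.
apply: ub_ereal_sup => _ [u uu <-].
have ru : rng u = u by exact: rng_unit.
have sf := lam_sigma_finite G_hausdorff G_lc G_sc lam_haar uu.
pose F (p : G * G) := (cabs (a p.2) * cabs (b (gmul (ginv p.2) p.1)))%:E.
have mF : measurable_fun (rfiber u `*` rfiber u : set (borel G * borel G)%type) F.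
  have /(measurable_prod_within G_sc)/cmeasurable_cabs h :=
    @shear_continuous R G u a b ca cb.
  apply/measurable_EFinP; rewrite (_ : (fun p => _) =
    (fun p => cabs (a p.2 * b (gmul (ginv p.2) p.1))))//.
  by apply/funext => p; rewrite cabsM.
have F0 p : (0 <= F p)%E by rewrite lee_fin mulr_ge0// cabs_ge0.
apply: (@le_trans _ _ (\int[lam u]_(x in rfiber u) \int[lam u]_(y in rfiber u) F (x, y))%E).
  apply: ge0_le_integral => //.
  - by move=> x _; rewrite lee_fin cabs_ge0.
  - by apply: measurable_cabs_fiber; case: Cab.
  - exact: (measurable_tonelli_on sf (mrf u) (mrf u) mF F0).
  - move=> x xu; have h := fint x Ca cb; rewrite (xu : rng x = u) in h.
    rewrite /conv (xu : rng x = u).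
    apply: (le_trans (cabs_cintegral_le_integral (mrf u) h)).
    by under eq_integral do rewrite cabsM.
rewrite (tonelli_on sf sf (mrf u) (mrf u) mF F0).
apply: (@le_trans _ _ (\int[lam u]_(y in rfiber u) ((cabs (a y))%:E * range_norm b))%E).
  apply: ge0_le_integral => //.
  - by move=> y _; apply: integral_ge0 => x _.
  - have mF' : measurable_fun (rfiber u `*` rfiber u : set (borel G * borel G)%type)
        (fun p => F (p.2, p.1)).
      apply: (measurable_comp (F := (rfiber u `*` rfiber u : set (borel G * borel G)%type))
        (g := fun p => (p.2, p.1)) _ _ mF).
      + by apply: measurableX; exact: mrf.
      + by move=> _ [[p q] /= [pu qu] <-].
      + by apply: measurable_funTS; exact: measurable_swap.
    by apply: (measurable_tonelli_on sf (mrf u) (mrf u) mF') => p; exact: F0.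
  - apply: emeasurable_funM; last exact: measurable_cst.
    exact: (@measurable_cabs_fiber a _ ca).
  - move=> y yu; rewrite /F /=.
    under eq_integral do rewrite EFinM.
    have mb : measurable_fun (rfiber u : set (borel G)) (fun x => (cabs (b (gmul (ginv y) x)))%:E).
      apply/measurable_EFinP; apply: cmeasurable_cabs.
      apply: (@cmeasurable_within R G _ (fun x => b (gmul (ginv y) x))) => x.
      apply: (@continuous_comp (subspace (rfiber u)) G R[i]^o (fun x => gmul (ginv y) x) b);
        last exact: cb.
      by rewrite -(yu : rng y = u) -src_ginv; exact: gmul_continuous_right.
    rewrite ge0_integralZl//; last 2 first.
    + by move=> x _; rewrite lee_fin cabs_ge0.
    + by rewrite lee_fin cabs_ge0.
    apply: lee_wpmul2l; first by rewrite lee_fin cabs_ge0.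
    rewrite -(yu : rng y = u) in mb *.
    rewrite -(haar_invariant G_hausdorff G_lc G_sc lam_haar mb); last first.
      by move=> x; rewrite lee_fin cabs_ge0.
    apply: (@le_trans _ _ (\int[lam (src y)]_(w in rfiber (src y)) (cabs (b w))%:E)%E).
      rewrite le_eqVlt; apply/orP; left; apply/eqP; apply: eq_integral => w /set_mem wy.
      by rewrite gmulK.
    by apply: range_norm_ub; exact: unit_src.
have bf : range_norm b \is a fin_num.
  by rewrite ge0_fin_numE ?range_norm_ge0//; exact: range_norm_lty.
rewrite -(fineK bf) ge0_integralZr//; last 3 first.
- exact: (@measurable_cabs_fiber a _ ca).
- by move=> y _; rewrite lee_fin cabs_ge0.
- by rewrite lee_fin fine_ge0// range_norm_ge0.
apply: lee_wpmul2r; first by rewrite lee_fin fine_ge0// range_norm_ge0.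
exact: range_norm_ub.
Qed.

Lemma range_norm_le (k : R) a b : 0 <= k -> continuous (a : G -> R[i]^o) ->
  continuous (b : G -> R[i]^o) ->
  (forall x, cabs (a x) <= k * cabs (b x)) -> (range_norm a <= k%:E * range_norm b)%E.
Proof.
move=> k0 ca cb ab; apply: ub_ereal_sup => _ [u uu <-].
apply: (@le_trans _ _ (\int[lam u]_(x in rfiber u) (k%:E * (cabs (b x))%:E))%E).
  apply: ge0_le_integral => //.
  - by move=> x _; rewrite lee_fin cabs_ge0.
  - exact: (@measurable_cabs_fiber a _ ca).
  - by apply: measurable_funeM; exact: (@measurable_cabs_fiber b _ cb).
  - by move=> x _; rewrite -EFinM lee_fin.
rewrite ge0_integralZl//; last 2 first.
- exact: (@measurable_cabs_fiber b _ cb).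
- by move=> y _; rewrite lee_fin cabs_ge0.
by apply: lee_wpmul2l; [rewrite lee_fin|exact: range_norm_ub].
Qed.

Lemma Inorm_ge0 a : Cc G a -> (0 <= Inorm lam a)%E.
Proof. by move=> [ca _]; rewrite (InormE ca) le_max range_norm_ge0. Qed.

Lemma Inorm_lty a : Cc G a -> (Inorm lam a < +oo)%E.
Proof.
move=> Ca; have h1 := range_norm_lty Ca.
have h2 := range_norm_lty (Cc_invol G_hausdorff Ca).
by have [ca _] := Ca; rewrite (InormE ca) /Order.max; case: ifP.
Qed.

Lemma Inorm_fin_num a : Cc G a -> Inorm lam a \is a fin_num.
Proof.
move=> Ca; rewrite ge0_fin_numE; first exact: Inorm_lty Ca.
exact: Inorm_ge0 Ca.
Qed.

Lemma Inorm_invol a : Cc G a -> Inorm lam (invol a) = Inorm lam a.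
Proof.
move=> Ca; have [ca _] := Ca; have [ca' _] := Cc_invol G_hausdorff Ca.
rewrite (InormE ca) (InormE ca') involK; exact: maxC.
Qed.

Lemma Inorm_conv a b : Cc G a -> Cc G b ->
  (Inorm lam (conv lam a b) <= Inorm lam a * Inorm lam b)%E.
Proof.
move=> Ca Cb; have Ca' := Cc_invol G_hausdorff Ca; have Cb' := Cc_invol G_hausdorff Cb.
have h1 := range_norm_conv Ca Cb; have h2 := range_norm_conv Cb' Ca'.
have [cab _] := conv_Cc G_hausdorff G_lc lam_haar Ca Cb.
rewrite (InormE cab) (InormE (proj1 Ca)) (InormE (proj1 Cb)).
rewrite (invol_conv G_hausdorff G_lc G_sc lam_haar Ca Cb) ge_max; apply/andP; split.
  apply: le_trans h1 _.
  by apply: lee_pmul; rewrite ?range_norm_ge0// le_max lexx.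
apply: le_trans h2 _; rewrite muleC.
by apply: lee_pmul; rewrite ?range_norm_ge0// le_max lexx orbT.
Qed.

Lemma Inorm_le (k : R) a b : 0 <= k -> Cc G a -> Cc G b ->
  (forall x, cabs (a x) <= k * cabs (b x)) -> (Inorm lam a <= k%:E * Inorm lam b)%E.
Proof.
move=> k0 Ca Cb ab; have [ca' _] := Cc_invol G_hausdorff Ca.
have [cb' _] := Cc_invol G_hausdorff Cb.
have [ca _] := Ca; have [cb _] := Cb.
have ab' x : cabs (invol a x) <= k * cabs (invol b x).
  by rewrite /invol !cabs_conj.
have h1 := range_norm_le k0 ca cb ab; have h2 := range_norm_le k0 ca' cb' ab'.
have kE : (0 <= k%:E)%E by rewrite lee_fin.
rewrite (InormE ca) (InormE cb) ge_max; apply/andP; split.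
  apply: le_trans h1 _.
  by apply: (lee_wpmul2l kE); rewrite le_max lexx.
apply: le_trans h2 _.
by apply: (lee_wpmul2l kE); rewrite le_max lexx orbT.
Qed.

End I_norm.

(** * The kernel subgroupoid *)

Section kernel_functions.
Variables (R : realType) (G : topGroupoidType).
Hypothesis (G_hausdorff : hausdorff_space G) (G_lc : locally_compact [set: G]).
Hypothesis (G_sc : @second_countable G).
Variable lam : G -> {measure set (borel G) -> \bar R}.
Variables (Gam : groupType) (c : contHom G Gam).
Local Notation Ge := (kergrp c).
Local Notation ext := (@ker_extend R G Gam c).
Local Notation lame := (haar_restr lam : Ge -> {measure set (borel Ge) -> \bar R}).
Implicit Types (a b : G -> R[i]) (f g : Ge -> R[i]).

Definition ker_restrict a : Ge -> R[i] := fun x => a (val x).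

Lemma ker_extendK f : ker_restrict (ext f) = f.
Proof. by apply/funext => x; exact: ker_extend_val. Qed.

Lemma ker_restrictK a : (forall x, ~ kerset c x -> a x = 0) ->
  ext (ker_restrict a) = a.
Proof.
move=> a0; apply/funext => x; have [cx|cx] := pselect (kerset c x).
  by rewrite -[x]/(val (to_ker (mem_set cx))) ker_extend_val.
by rewrite ker_extend_out// a0.
Qed.

Lemma kerset_val (x : Ge) : kerset c (val x).
Proof. by have := valP x; rewrite inE. Qed.

Lemma hom_rng x : c (rng x) = 1%g.
Proof. by have := kerset_rng c x; rewrite inE. Qed.

Lemma hom_ginv x : c (ginv x) = (c x)^-1%g.
Proof.
have : composable (x, ginv x) by rewrite /composable /= rng_ginv.
move=> /(hom_gmul c); rewrite gmulxV hom_rng.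
by move=> /(congr1 (fun z => (c x)^-1 * z)%g); rewrite mulKg mulg1.
Qed.

Lemma hom_inv_mul x y : rng x = rng y -> c (gmul (ginv x) y) = ((c x)^-1 * c y)%g.
Proof.
move=> xy; rewrite hom_gmul ?hom_ginv//.
by rewrite /composable /= src_ginv.
Qed.

Lemma ker_hausdorff : hausdorff_space Ge.
Proof.
move=> x y xy; apply: val_inj; apply: G_hausdorff => A B nA nB.
have [z [Az Bz]] := xy _ _ (@val_ker_continuous _ _ c x _ nA) (@val_ker_continuous _ _ c y _ nB).
by exists (val z).
Qed.

(** Compactness in the subspace is tested on filters pushed to [G] by [val]; their cluster points
    lie in G_e because it is closed. *)
Lemma Cc_restrict a : Cc G a -> Cc Ge (ker_restrict a).
Proof.
move=> [ca cK]; set K := closure _ in cK.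
have cR : continuous (ker_restrict a : Ge -> R[i]^o).
  move=> x; apply: (@continuous_comp Ge G R[i]^o val a); last exact: ca.
  exact: val_ker_continuous.
have cKe : compact ((val : Ge -> G) @^-1` K).
  have cKk : compact (K `&` kerset c).
    by apply: compact_closedI => //; exact: closed_kerset.
  move=> F FF FK.
  have [|x [[Kx kx] xF]] := cKk (val @ F) _.
    have H : F [set y : Ge | (K `&` kerset c) (val y)].
      by apply: filterS FK => y Ky; split=> //; exact: (kerset_val y).
    exact: H.
  exists (to_ker (mem_set kx)); split=> // A B FA nB.
  have /= [U oU UB] : exists2 U : set G, nbhs x U & val @^-1` U `<=` B.
    move: nB => [_ [[W oW <-] Wx] WB]; exists W => //.
    exact: open_nbhs_nbhs.
  have FvA : F [set y : Ge | (val @` A : set G) (val y)].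
    by apply: filterS FA => y Ay; exists y.
  have [] := xF (val @` A) U FvA oU.
  move=> _ [[y Ay <-] Uy]; exists y; split=> //; exact: UB.
apply: (Cc_compact_supp ker_hausdorff cR cKe) => x ax.
exact: subset_closure.
Qed.

Lemma ext_lin k f g : ext (fun x => k * f x + g x) = (fun x => k * ext f x + ext g x).
Proof.
apply/funext => x; rewrite /ker_extend; case: insubP => //= _.
by rewrite mulr0 addr0.
Qed.

Lemma ext_invol f : ext (invol f) = invol (ext f).
Proof.
apply/funext => x; rewrite /invol; have [cx|cx] := pselect (kerset c x).
  pose y : Ge := to_ker (mem_set cx).
  rewrite -[x]/(val y) ker_extend_val.
  by rewrite -[ginv (val y)]/(val (ginv y)) ker_extend_val.
rewrite !ker_extend_out ?conjc0// => cy; apply: cx.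
by have := kerset_ginv (mem_set cy); rewrite ginvK inE.
Qed.

Lemma restrict_invol a : ker_restrict (invol a) = invol (ker_restrict a).
Proof. by []. Qed.

Lemma val_rfiber (u : Ge) : val @` rfiber u = rfiber (val u) `&` kerset c.
Proof.
apply/seteqP; split=> [_ [x <- <-]|x [/= xu cx]].
  by split=> //; exact: kerset_val.
by exists (to_ker (mem_set cx)) => //; apply: val_inj.
Qed.

Lemma measurable_ker_rfiber (u : Ge) : measurable (rfiber u : set (borel Ge)).
Proof. exact: (measurable_rfiber ker_hausdorff). Qed.

(** At a point of G_e the integrand is supported in G_e, where [lam u] and its restriction agree. At
    any other point no [y] makes both factors nonzero, G_e being closed under products. *)
Lemma ext_conv f g : Cc Ge f -> Cc Ge g ->
  ext (conv lame f g) = conv lam (ext f) (ext g).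
Proof.
move=> Cf Cg; have [cf _] := ker_extend_Cc G_hausdorff Cf.
have [cg _] := ker_extend_Cc G_hausdorff Cg.
apply/funext => x; have [cx|cx] := pselect (kerset c x); last first.
  rewrite ker_extend_out//; apply/esym/eqP; apply: contrapT => /negP.
  move=> /(conv_supp G_hausdorff)[y [yx fy gx]]; apply: cx.
  have cy : kerset c y.
    by apply: contrapT => /(ker_extend_out f)/eqP; apply/negP.
  have cyx : kerset c (gmul (ginv y) x).
    by apply: contrapT => /(ker_extend_out g)/eqP; apply/negP.
  have := kerset_gmul (mem_set cy) (mem_set cyx).
  rewrite rng_inv_mul// => /(_ erefl); rewrite gmulVK// inE; exact.
pose x' : Ge := to_ker (mem_set cx).
rewrite -[x]/(val x') ker_extend_val /conv.
rewrite -(@cintegral_mkcond R G Gam c lam); last first.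
  by move=> y _ ny; rewrite (ker_extend_out f ny) mul0r.
rewrite -[rng (val x')]/(val (rng x')) -val_rfiber.
rewrite -cintegral_haar_restr.
- apply: eq_cintegral => y yx.
  rewrite -(ker_extend_val f) -(ker_extend_val g) val_ker_gmul//.
  rewrite src_ginv; exact: (congr1 val (yx : rng y = rng x')).
- exact: measurable_ker_rfiber.
- apply: (continuous_subspaceW (B := rfiber (rng (val x')))).
    by rewrite val_rfiber => y [].
  exact: (@conv_integrand_continuous R G (ext f) (ext g) (val x') cf cg).
Qed.

Lemma unit_val (u : Ge) : unit_space Ge u -> unit_space G (val u).
Proof. by move=> [v _ <-]; exists (val v). Qed.

Lemma integral_cabs_restrict (u : Ge) a : continuous (a : G -> R[i]^o) ->
  (\int[haar_restr lam u]_(x in rfiber u) (cabs (ker_restrict a x))%:E =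
   \int[lam (val u)]_(x in rfiber (val u) `&` kerset c) (cabs (a x))%:E)%E.
Proof.
move=> ca; rewrite -val_rfiber.
rewrite -(@ge0_integral_haar_restr R G Gam c lam u _ (fun x => (cabs (a x))%:E))//.
- exact: measurable_ker_rfiber.
- exact: measurable_cabs_fiber.
- by move=> x; rewrite lee_fin cabs_ge0.
Qed.

Lemma range_norm_restrict a : continuous (a : G -> R[i]^o) ->
  (range_norm lame (ker_restrict a) <= range_norm lam a)%E.
Proof.
move=> ca; apply: ub_ereal_sup => _ [u /unit_val uu <-].
rewrite integral_cabs_restrict//; apply: le_trans (range_norm_ub _ _ uu).
apply: ge0_subset_integral.
- apply: measurableI; first exact: measurable_rfiber.
  by apply: closed_borel => //; exact: closed_kerset.
- exact: measurable_rfiber.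
- exact: measurable_cabs_fiber.
- by move=> x _; rewrite lee_fin cabs_ge0.
- by move=> x [].
Qed.

(** Every unit of [G] lies in G_e, so both suprema run over the same units. *)
Lemma range_norm_ext f : continuous (ext f : G -> R[i]^o) ->
  (range_norm lam (ext f) <= range_norm lame f)%E.
Proof.
move=> cf; apply: ub_ereal_sup => _ [_ [x _ <-] <-].
pose u : Ge := to_ker (kerset_rng c x).
have uu : unit_space Ge u.
  by exists u => //; apply: val_inj; exact: rng_rng.
apply: le_trans (range_norm_ub _ _ uu).
rewrite -{2}(ker_extendK f) integral_cabs_restrict// integral_mkcondr.
rewrite le_eqVlt; apply/orP; left; apply/eqP; apply: eq_integral => y _.
rewrite /patch; case: ifPn => //; rewrite notin_setE => cy.
by rewrite (ker_extend_out f cy) cabs0.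
Qed.

Lemma Inorm_restrict a : Cc G a -> (Inorm lame (ker_restrict a) <= Inorm lam a)%E.
Proof.
move=> Ca; have [ca _] := Ca; have [ca' _] := Cc_invol G_hausdorff Ca.
have [cr _] := Cc_restrict Ca.
rewrite (InormE ker_hausdorff lame cr) (InormE G_hausdorff lam ca) -restrict_invol.
have h1 := range_norm_restrict ca; have h2 := range_norm_restrict ca'.
rewrite ge_max; apply/andP; split; rewrite le_max; apply/orP; [left|right] => //.
Qed.

Lemma Inorm_ext f : Cc Ge f -> (Inorm lam (ext f) <= Inorm lame f)%E.
Proof.
move=> Cf; have [cf _] := Cf; have Ce := ker_extend_Cc G_hausdorff Cf.
have [ce _] := Ce; have [ce' _] := Cc_invol G_hausdorff Ce.
rewrite (InormE ker_hausdorff lame cf) (InormE G_hausdorff lam ce) -ext_invol.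
rewrite -ext_invol in ce'.
have h1 := range_norm_ext ce; have h2 := range_norm_ext ce'.
rewrite ge_max; apply/andP; split; rewrite le_max; apply/orP; [left|right] => //.
Qed.

Definition coset_part (g : Gam) a : G -> R[i] := fun x => if c x == g then a x else 0.

Lemma near_coset x : \forall y \near x, c y = c x.
Proof.
have /continuousP := @hom_continuous _ _ c => /(_ [set c x] (discrete_open _)) oc.
have := open_nbhs_nbhs (conj oc (erefl : [set c x] (c x)) : open_nbhs x _).
exact.
Qed.

Lemma coset_part_continuous (g : Gam) a : continuous (a : G -> R[i]^o) ->
  continuous (coset_part g a : G -> R[i]^o).
Proof.
move=> ca x A; rewrite /= /coset_part => nA.
suff : nbhs x [set y | A (coset_part g a y)] by [].
move: nA; case: eqP => cx nA.
  have h : nbhs x [set y | A (a y)] by exact: ca.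
  apply: filterS2 h (near_coset x) => y Ay cyx.
  by rewrite /= /coset_part cyx cx eqxx.
have := near_coset x; apply: filterS => y cyx.
rewrite /= /coset_part cyx; case: eqP => // _; exact: nbhs_singleton nA.
Qed.

Lemma Cc_coset_part (g : Gam) a : Cc G a -> Cc G (coset_part g a).
Proof.
move=> [ca cK]; apply: (Cc_compact_supp G_hausdorff _ cK).
  exact: coset_part_continuous.
move=> x; rewrite /coset_part; case: ifP => [_ ax|_]; last by rewrite eqxx.
exact: subset_closure.
Qed.

(** The cosets of [c] are open and cover the compact support, so finitely many suffice. *)
Lemma coset_decomposition a : Cc G a ->
  exists s : seq Gam, a = \sum_(g <- s) coset_part g a.
Proof.
move=> [_ cK]; set K := closure _ in cK.
have [s sK] : exists s : seq Gam, forall x, K x -> c x \in s.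
  move: cK; rewrite compact_cover => /(_ _ [set: Gam] (fun g : Gam => c @^-1` [set g])).
  case=> [g _|x Kx|D _ DK].
  - have /continuousP := @hom_continuous _ _ c; apply; exact: discrete_open.
  - by exists (c x).
  - by exists (finmap.enum_fset D) => x /DK[g /= gD ->].
(* Without repetitions each coset contributes to the sum once. *)
exists (undup s).
apply/funext => x; rewrite fct_sumE.
have [xs|xs] := boolP (c x \in undup s).
  rewrite (big_rem _ xs) /= {1}/coset_part eqxx big_seq big1 ?addr0// => g gs.
  rewrite /coset_part; case: eqP => // cx; move: gs.
  by rewrite -cx mem_rem_uniqF// undup_uniq.
rewrite big_seq big1.
  apply/eqP; apply: contrapT => /negP ax; move: xs.
  by rewrite mem_undup sK//; exact: subset_closure.
move=> g gs; rewrite /coset_part; case: eqP => // cx.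
by move: xs; rewrite cx gs.
Qed.

Lemma conv_coset_ker (g : Gam) a b x : ~ kerset c x ->
  conv lam (invol (coset_part g a)) (coset_part g b) x = 0.
Proof.
move=> cx; apply/eqP; apply: contrapT => /negP.
move=> /(conv_supp G_hausdorff)[y [yx]].
rewrite /invol /coset_part hom_inv_mul// hom_ginv.
case: ifP => [/eqP ->|_]; last by rewrite conjc0 eqxx.
case: ifP => [/eqP|_]; last by rewrite eqxx.
move=> h; exfalso; apply: cx; rewrite /kerset /=.
by move: h => /(congr1 (fun z => g^-1 * z)%g); rewrite mulVg mulKg.
Qed.

End kernel_functions.

(** * Approximate units *)

(** Integration of [|h (F - t)| <= k h]. The bound on [F - t] is asked only where the weight [h] is
    nonzero, which is how the small support of [psi] enters the approximation. *)
Lemma weighted_comparison d (T : measurableType d) (R : realType)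
    (mu : {measure set T -> \bar R}) (D : set T) (mD : measurable D)
    (h : T -> R) (F : T -> R[i]) (t : R[i]) (k : R) :
  mu.-integrable D (fun x => (h x)%:E) -> cintegrable mu D (fun x => (h x)%:C * F x) ->
  (forall x, D x -> 0 <= h x) ->
  (forall x, D x -> h x != 0 -> cabs (F x - t) <= k) ->
  cabs (cintegral mu D (fun x => (h x)%:C * F x) - t * (\int[mu]_(x in D) h x)%:C)
    <= k * \int[mu]_(x in D) h x.
Proof.
move=> ih iF h0 Fk.
have ihC : cintegrable mu D (fun x => (h x)%:C).
  by split => //=; exact: integrable0.
have -> : (\int[mu]_(x in D) h x)%:C = cintegral mu D (fun x => (h x)%:C).
  by rewrite /cintegral /= Rintegral_cst// mul0r.
rewrite -cintegralZ// -cintegralB//; last exact: cintegrableZ.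
have i2 : cintegrable mu D (fun x => (h x)%:C * F x - t * (h x)%:C).
  have := cintegrable_lin mD (-1) (cintegrableZ mD t ihC) iF.
  by congr cintegrable; apply/funext => x; rewrite mulN1r addrC.
rewrite (le_trans (cabs_cintegral_le mD i2))//.
rewrite -RintegralZl//; apply: le_Rintegral => //.
- exact: cintegrable_cabs.
- exact: (@integrableZl _ _ _ mu D mD k _ ih).
- move=> x Dx; have [hx|hx] := eqVneq (h x) 0.
    by rewrite hx mul0r mulr0 subrr cabs0 mulr0.
  have -> : (h x)%:C * F x - t * (h x)%:C = (h x)%:C * (F x - t) by ring.
  rewrite cabsM cabs_real (ger0_norm (h0 _ Dx)) mulrC.
  by apply: ler_wpM2r; [exact: h0|exact: Fk].
Qed.

Lemma compact_positive_lower_bound (R : realType) (T : topologicalType)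
    (K : set T) (h : T -> R) : compact K -> continuous h ->
  (forall x, K x -> 0 < h x) -> exists2 e : R, 0 < e & forall x, K x -> e <= h x.
Proof.
move=> cK ch h0.
have /compact_bounded[M [Mr MP]] : compact ((fun x => (h x)^-1) @` K : set R^o).
  apply: continuous_compact cK; apply/subspace_continuousP => x Kx.
  apply: (@cvg_within_filter _ _ (fun x => (h x)^-1) (nbhs x)).
  by apply: cvgV; [rewrite gt_eqF// h0|exact: ch].
have M1 : M < Num.max 0 M + 1.
  by rewrite (@le_lt_trans _ _ (Num.max 0 M)) ?ltrDl// le_max lexx orbT.
have M2 : 0 < Num.max 0 M + 1 by rewrite ltr_wpDl// le_max lexx.
exists (Num.max 0 M + 1)^-1; first by rewrite invr_gt0.
move=> x Kx; rewrite -[leRHS]invrK lef_pV2 ?posrE ?invr_gt0 ?h0//.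
by rewrite (le_trans (ler_norm _))//; apply: (MP _ M1); exists x.
Qed.

Section positive_functions.
Variables (R : realType) (G : topGroupoidType).
Hypothesis (G_hausdorff : hausdorff_space G) (G_lc : locally_compact [set: G]).
Hypothesis (G_sc : @second_countable G).
Variable lam : G -> {measure set (borel G) -> \bar R}.
Hypothesis lam_haar : is_haar_system lam.
Implicit Types (a b : G -> R[i]) (h : G -> R) (x y z u : G).

Let mrf u : measurable (rfiber u : set (borel G)).
Proof. exact: measurable_rfiber. Qed.

Let crf u : closed (rfiber u).
Proof. exact: closed_rfiber. Qed.

Definition ccR h := continuous h /\ compact (closure [set x | h x != 0]).

Lemma ccR_Cc h : ccR h -> Cc G (fun x => (h x)%:C : R[i]).
Proof. by move=> [ch cK]; exact: Cc_real. Qed.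

Lemma ccR_supp h (K : set G) : continuous h -> compact K ->
  (forall x, h x != 0 -> K x) -> ccR h.
Proof.
move=> ch cK hK; split=> //; apply: (subclosed_compact _ cK).
  exact: closed_closure.
by rewrite closureE; apply: smallest_sub => //; exact: (compact_closed G_hausdorff).
Qed.

Lemma ccR_mul h k : ccR h -> continuous k -> ccR (fun x => h x * k x).
Proof.
move=> [ch cK] ck; apply: (ccR_supp _ cK).
  by move=> x; apply: cvgM; [exact: ch|exact: ck].
move=> x hk; apply: subset_closure; apply: contraNN hk => /eqP ->.
by rewrite mul0r.
Qed.

Lemma ccR_ginv h : ccR h -> ccR (h \o ginv).
Proof.
move=> [ch cK]; apply: (@ccR_supp _ (ginv @` closure [set x | h x != 0])).
- by move=> x; apply: continuous_comp; [exact: ginv_continuous|exact: ch].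
- by apply: continuous_compact cK; apply: continuous_subspaceT; exact: ginv_continuous.
- by move=> x hx; exists (ginv x); [exact: subset_closure|exact: ginvK].
Qed.

Lemma ccR_sqrt h : ccR h -> ccR (fun x => Num.sqrt (h x)).
Proof.
move=> [ch cK]; apply: (ccR_supp _ cK).
  by move=> x; apply: (@continuous_comp _ _ _ h (@Num.sqrt R));
    [exact: ch|exact: sqrt_continuous].
move=> x hx; apply: subset_closure; apply: contraNN hx => /eqP ->.
by rewrite sqrtr0.
Qed.

Definition fint h u : R := \int[lam u]_(x in rfiber u) h x.

Lemma fint_integrable h u : unit_space G u -> ccR h ->
  (lam u).-integrable (rfiber u : set (borel G)) (fun x => (h x)%:E).
Proof.
by move=> uu /ccR_Cc Ch; have [] := Cc_cintegrable G_hausdorff lam_haar uu (@crf u) Ch.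
Qed.

Lemma fint_rng_continuous h : ccR h -> continuous (fun x => fint h (rng x)).
Proof.
move=> /ccR_Cc Ch x A nA.
have /subspace_continuousP/(_ _ (unit_rng x)) := haar_continuous lam_haar Ch.
move=> /cvg_Re /(_ A nA) nu.
have nx : nbhs x [set y | unit_space G (rng y) -> A (fint h (rng y))].
  exact: (@rng_continuous G x _ nu).
suff : nbhs x [set y | A (fint h (rng y))] by [].
by apply: filterS nx => y; apply; exact: unit_rng.
Qed.

Lemma fint_src_continuous h : ccR h -> continuous (fun x => fint h (src x)).
Proof.
move=> ch x.
have -> : (fun x => fint h (src x)) = (fun x => fint h (rng x)) \o ginv.
  by apply/funext => y; rewrite /= rng_ginv.
apply: continuous_comp; first exact: ginv_continuous.
exact: (fint_rng_continuous ch).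
Qed.

(** A point off the support has a null neighbourhood; with a countable base, countably many null
    basic open sets cover the complement of the support. *)
Lemma lam_fiber_null u : unit_space G u -> lam u (~` rfiber u) = 0%E.
Proof.
move=> uu; have [e [eo eb]] := second_countable_enum G_sc.
pose good n := lam u (e n) = 0%E.
pose F n := if `[< good n >] then e n else set0.
have mF n : measurable (F n : set (borel G)).
  by rewrite /F; case: asboolP => // _; exact: sub_sigma_algebra.
have F0 n : lam u (F n) = 0%E.
  by rewrite /F; case: asboolP => [//|_]; rewrite measure0.
have cover : ~` rfiber u `<=` \bigcup_n F n.
  move=> x; rewrite -(haar_support lam_haar uu) => nx.
  have [U [[oU Ux] U0]] : exists U, open_nbhs x U /\ ~ (0 < lam u U)%E.
    apply: contrapT => H; apply: nx => U nU; apply: contrapT => h.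
    by apply: H; exists U.
  have [n [enx enU]] := eb _ _ (open_nbhs_nbhs (conj oU Ux)).
  exists n => //; rewrite /F asboolT// /good.
  apply/eqP; rewrite eq_le measure_ge0 andbT.
  rewrite (@le_trans _ _ (lam u U))//; last by rewrite leNgt; exact/negP.
  by apply: le_measure => //; rewrite ?inE; exact: sub_sigma_algebra.
apply/eqP; rewrite eq_le measure_ge0 andbT.
have mUF : measurable (\bigcup_n F n : set (borel G)) by exact: bigcup_measurable.
apply: (@le_trans _ _ (lam u (\bigcup_n F n))).
  apply: le_measure => //; rewrite ?inE//; apply: measurableC; exact: mrf.
have := generalized_Boole_inequality (lam u) mF mUF.
by move=> /le_trans; apply; rewrite eseries0// => n _ _; exact: F0.
Qed.

(** The point [x] is in the support of [lam (rng x)], so the open set where [h] exceeds [h x / 2]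
    has positive measure, and by [lam_fiber_null] this mass sits on the fiber of integration. *)
Lemma fint_gt0 h x : ccR h -> (forall y, 0 <= h y) -> 0 < h x -> 0 < fint h (rng x).
Proof.
move=> ch h0 hx; set u := rng x; have uu : unit_space G u by exact: unit_rng.
pose O := [set y | h x / 2 < h y].
have oO : open O.
  apply: (@open_comp _ _ h [set r | h x / 2 < r]); last exact: open_gt.
  by move=> y _; exact: ch.1.
have hx2 : 0 < h x / 2 by rewrite divr_gt0.
have mO : measurable (O : set (borel G)) by exact: sub_sigma_algebra.
have lO : (0 < lam u (O `&` rfiber u))%E.
  have : (0 < lam u O)%E.
    have : msupport (lam u) x by rewrite (haar_support lam_haar uu).
    by apply; split=> //; rewrite /O /= [ltRHS]splitr ltrDl.
  suff -> : lam u O = lam u (O `&` rfiber u) by [].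
  have mA : measurable (O `&` rfiber u : set (borel G)).
    by apply: measurableI => //; exact: mrf.
  have mC : measurable (~` rfiber u : set (borel G)).
    by apply: measurableC; exact: mrf.
  have mB : measurable (O `&` ~` rfiber u : set (borel G)) by exact: measurableI.
  have dAB : (O `&` rfiber u) `&` (O `&` ~` rfiber u) = set0.
    by rewrite setIACA setICr setI0.
  have lB : lam u (O `&` ~` rfiber u) = 0%E.
    exact: (subset_measure0 mB mC (@subIsetr _ _ _) (lam_fiber_null uu)).
  have E := measureU (lam u) mA mB dAB; rewrite -setIUr setUv setIT in E.
  by apply: (etrans E); rewrite -[RHS]adde0; congr (_ + _)%E; exact: lB.
have ih := fint_integrable uu ch.
rewrite -lte_fin /fint /Rintegral fineK; last exact: (integrable_fin_num (mrf u)).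
apply: (@lt_le_trans _ _ ((h x / 2)%:E * lam u (O `&` rfiber u))%E).
  by rewrite mule_gt0// lte_fin.
rewrite -integral_cst; last by apply: measurableI => //; exact: mrf.
have mh := measurable_int (lam u) ih.
have mI : measurable (O `&` rfiber u : set (borel G)).
  by apply: measurableI => //; exact: mrf.
apply: (@le_trans _ _ (\int[lam u]_(y in O `&` rfiber u) (h y)%:E)%E).
  apply: ge0_le_integral => //.
  - by move=> y _; rewrite lee_fin ltW.
  - by apply: measurable_funS mh => //; exact: mrf.
  - by move=> y [Oy _]; rewrite lee_fin ltW.
have hE y : rfiber u y -> (0 <= (h y)%:E)%E by rewrite lee_fin.
by apply: ge0_subset_integral;
  [exact: mI|exact: mrf|exact: mh|exact: hE|exact: subIsetr].
Qed.

End positive_functions.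

Section approximate_unit.
Variables (R : realType) (G : topGroupoidType).
Hypothesis (G_hausdorff : hausdorff_space G) (G_lc : locally_compact [set: G]).
Variables (Gam : groupType) (c : contHom G Gam).
Implicit Types (a b : G -> R[i]) (h : G -> R) (x y z u : G).

(** As [y] and [y'] approach [z], the product [y' (y^-1 x)] approaches [z (z^-1 x) = x], uniformly
    over the compact support of [a]. Points whose range is not [rng z] drop out, since
    [rng x = rng y] fails near them. *)
Lemma near_translate a (N : set G) (e : R) z : Cc G a -> open N ->
  closure [set x | a x != 0] `<=` N -> 0 < e ->
  exists U, nbhs z U /\ forall y y' x, U y -> U y' ->
    closure [set x | a x != 0] x -> src y = src y' -> rng x = rng y ->
    N (gmul y' (gmul (ginv y) x)) /\
    cabs (a (gmul y' (gmul (ginv y) x)) - a x) < e.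
Proof.
move=> [ca cK] oN KN e0; set K := closure _ in cK KN *.
pose P (p : G * G) x := src p.1 = src p.2 -> rng x = rng p.1 ->
    N (gmul p.2 (gmul (ginv p.1) x)) /\
    cabs (a (gmul p.2 (gmul (ginv p.1) x)) - a x) < e.
have H : \forall p \near nbhs (z, z), K `<=` P p.
  move/compact_near_coveringP : cK => cK.
  apply: (cK (G * G)%type (nbhs (z, z)) P (nbhs_filter (z, z))) => x0 Kx0.
  have [xz|xz] := pselect (rng x0 = rng z); last first.
    have [A [B [nA nB AB]]] := hausdorff_separate G_hausdorff xz.
    exists (rng @^-1` A, (rng @^-1` B) `*` setT).
      split; first exact: (@rng_continuous G x0).
      exists (rng @^-1` B, setT); last by move=> p [].
      by split; [exact: (@rng_continuous G z)|exact: filterT].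
    by move=> [x [y y']] /= [Ax [By _]] _ xy; have := AB _ _ Ax By xy.
  have e2 : 0 < e / 2 by rewrite divr_gt0.
  have na : nbhs x0 [set x | cabs (a x0 - a x) < e / 2].
    have : nbhs (a x0 : R[i]^o) [set w | cabs (a x0 - w) < e / 2].
      by apply/rnorm_ballP; exists (e / 2).
    exact: ca.
  have nA : nbhs (gmul z (gmul (ginv z) x0)) (N `&` [set x | cabs (a x0 - a x) < e / 2]).
    rewrite gmulVK//; apply: filterI => //.
    by apply: open_nbhs_nbhs; split=> //; exact: KN.
  have c1 : src z = rng (gmul (ginv z) x0) by rewrite rng_inv_mul.
  have [U1 [V1 [nU1 nV1 UV1]]] := gmul_near c1 nA.
  have c2 : src (ginv z) = rng x0 by rewrite src_ginv.
  have [U2 [V2 [nU2 nV2 UV2]]] := gmul_near c2 nV1.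
  exists (V2 `&` [set x | cabs (a x0 - a x) < e / 2], (ginv @^-1` U2) `*` U1).
    split; first exact: filterI.
    exists (ginv @^-1` U2, U1) => //; split=> //.
    exact: (@ginv_continuous G z).
  move=> [x [y y']] /= [[V2x ax] [U2y U1y']] yy' xy.
  have [Nx ax'] : (N `&` [set x | cabs (a x0 - a x) < e / 2])
      (gmul y' (gmul (ginv y) x)).
    apply: UV1 => //; last by rewrite rng_inv_mul.
    by apply: UV2 => //; rewrite src_ginv.
  split=> //.
  have -> : a (gmul y' (gmul (ginv y) x)) - a x =
      (a (gmul y' (gmul (ginv y) x)) - a x0) + (a x0 - a x) by rewrite addrA subrK.
  by rewrite (le_lt_trans (cabsD _ _))// (splitr e) ltrD// cabsB.
have [[U V] /= [nU nV] UVP] := H.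
exists (U `&` V); split; first exact: filterI.
move=> y y' x [Uy _] [_ Vy'] Kx yy' xy.
by apply: (UVP (y, y')).
Qed.

(** Off the support of [a] only the translate [x'] can contribute. Then [near_translate] is used at
    [x'] with [y] and [y'] exchanged: the translate of [x'] is [x], which therefore lies in [N],
    where [h] is at least [1]. One function [h] thus dominates the error everywhere. *)
Lemma uniform_translate a (N : set G) h (e : R) z : Cc G a -> open N ->
  closure [set x | a x != 0] `<=` N -> 0 < e -> (forall x, N x -> 1 <= h x) ->
  (forall x, 0 <= h x) ->
  exists U, nbhs z U /\ forall y y' x, U y -> U y' -> src y = src y' -> rng x = rng y ->
    cabs (a (gmul y' (gmul (ginv y) x)) - a x) <= e * h x.
Proof.
move=> Ca oN KN e0 hN h0; have [U [nU UP]] := near_translate z Ca oN KN e0.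
exists U; split=> // y y' x Uy Uy' yy' xy.
have [Kx|nKx] := pselect (closure [set x | a x != 0] x).
  have [_ /ltW/le_trans] := UP y y' x Uy Uy' Kx yy' xy; apply.
  by rewrite ler_peMr ?(ltW e0)// hN//; exact: KN.
have ax0 : a x = 0.
  by apply/eqP; apply: contrapT => /negP /Cc_supp.
rewrite ax0 subr0; set x' := gmul y' _.
have [ax'|ax'] := eqVneq (a x') 0; first by rewrite ax' cabs0 mulr_ge0// ltW.
have yx : rng y = rng x by [].
have y'x : src y' = rng (gmul (ginv y) x) by rewrite rng_inv_mul.
have rx' : rng x' = rng y' by rewrite /x' rng_gmul.
have [Nx] := UP y' y x' Uy' Uy (Cc_supp ax') (esym yy') rx'.
rewrite {1 2}/x' gmulK// gmulVK// in Nx *.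
rewrite ax0 sub0r cabsN => /ltW/le_trans; apply.
by rewrite ler_peMr ?(ltW e0)// hN.
Qed.

Lemma coset_closure (g : Gam) a : (forall x, a x != 0 -> c x = g) ->
  forall x, closure [set x | a x != 0] x -> c x = g.
Proof.
move=> ag x /(_ _ (near_coset c x))[y [/= ay cy]].
by rewrite -(ag _ ay) -cy.
Qed.

(** Urysohn bumps at the points of the support, each inside a neighbourhood where
    [uniform_translate] applies and [c] is constant; finitely many of them cover the support. *)
Lemma coset_bumps (g : Gam) a h (N : set G) (e : R) : Cc G a ->
  (forall x, a x != 0 -> c x = g) -> open N ->
  closure [set x | a x != 0] `<=` N -> 0 < e -> (forall x, N x -> 1 <= h x) ->
  (forall x, 0 <= h x) ->
  exists n (phi : 'I_n -> G -> R),
    [/\ forall i, ccR (phi i), forall i x, 0 <= phi i x,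
        forall i x, phi i x != 0 -> c x = g,
        forall x, closure [set x | a x != 0] x -> exists i, 0 < phi i x &
        forall i y y' x, phi i y != 0 -> phi i y' != 0 -> src y = src y' ->
          rng x = rng y ->
          cabs (a (gmul y' (gmul (ginv y) x)) - a x) <= e * h x].
Proof.
move=> Ca ag oN KN e0 hN h0; have [_ cK] := Ca; set K := closure _ in cK KN *.
have B z : exists f : G -> R, K z -> [/\ ccR f, forall x, 0 <= f x,
    forall x, f x != 0 -> c x = g, f z = 1 &
    forall y y' x, f y != 0 -> f y' != 0 -> src y = src y' -> rng x = rng y ->
      cabs (a (gmul y' (gmul (ginv y) x)) - a x) <= e * h x].
  have [Kz|nKz] := pselect (K z); last by exists (fun=> 0).
  have [U [nU UP]] := uniform_translate z Ca oN KN e0 hN h0.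
  have nV : nbhs z (U `&` [set x | c x = c z]) by apply: filterI => //; exact: near_coset.
  have := nV; rewrite nbhsE => -[W [oW Wz] WU].
  have Wz1 : [set z] `<=` W by move=> _ ->.
  have [f [cf f01 f1 cf0 fW]] :=
    compact_open_urysohn R G_hausdorff G_lc (@compact_set1 _ z) oW Wz1.
  have fU x : f x != 0 -> U x /\ c x = g.
    move=> fx; have [Ux cx] := WU _ (fW _ (@subset_closure _ [set x | f x != 0] _ fx)).
    by split=> //; rewrite (cx : c x = c z); exact: coset_closure Kz.
  exists f => _; split=> //.
  - by move=> x; have /andP[] := f01 x.
  - by move=> x /fU[].
  - exact: f1.
  - by move=> y y' x /fU[Uy _] /fU[Uy' _]; exact: UP.
have [f fP] := choice B.
move: (cK); rewrite compact_cover.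
move=> /(_ G K (fun z => [set x | f z x != 0])).
have op z : K z -> open [set x | f z x != 0].
  move=> /fP[[cf _] _ _ _ _].
  rewrite (_ : [set x | f z x != 0] = f z @^-1` (~` [set 0])); last first.
    by apply/seteqP; split=> y /=; move/eqP.
  by apply: open_comp => [y _|]; [exact: cf|rewrite openC; exact: closed_eq].
case=> [//|z Kz|D DK KD].
  by exists z => //=; have [_ _ _ -> _] := fP z Kz; exact: oner_neq0.
pose s := finmap.enum_fset D.
have sK i : i \in s -> K i by move=> /DK; rewrite inE.
pose phi (i : 'I_(size s)) : G -> R := f (nth point s i).
have phiK i : K (nth point s (i : 'I_(size s))) by apply: sK; exact: mem_nth.
exists (size s), phi; split.
- by move=> i; have [] := fP _ (phiK i).
- by move=> i; have [] := fP _ (phiK i).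
- by move=> i; have [] := fP _ (phiK i).
- move=> x /KD[z zD /= fzx].
  have zs : (index z s < size s)%N by rewrite index_mem.
  exists (Ordinal zs); rewrite /phi /= nth_index// lt_def fzx.
  by have [_ -> _ _ _] := fP z (sK z zD).
- by move=> i; have [] := fP _ (phiK i).
Qed.

End approximate_unit.

Lemma continuous_maxr (R : realType) (T : topologicalType) (f : T -> R) (s : R) :
  continuous f -> continuous (fun x => Num.max (f x) s).
Proof.
move=> cf x.
exact: (@continuous_max R T f (fun=> s) x (cf x) (@cvg_cst _ s _ (nbhs x) _)).
Qed.

Section kernel_unit.
Variables (R : realType) (G : topGroupoidType).
Hypothesis (G_hausdorff : hausdorff_space G) (G_lc : locally_compact [set: G]).
Hypothesis (G_sc : @second_countable G).
Variable lam : G -> {measure set (borel G) -> \bar R}.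
Hypothesis lam_haar : is_haar_system lam.
Implicit Types (a b : G -> R[i]) (h theta m k : G -> R) (x y z u : G).

Let mrf u : measurable (rfiber u : set (borel G)).
Proof. exact: measurable_rfiber. Qed.

Lemma fint_le h k u : unit_space G u -> ccR h -> ccR k ->
  (forall x, h x <= k x) -> fint lam h u <= fint lam k u.
Proof.
move=> uu ch ck hk; apply: le_Rintegral => //.
- exact: (fint_integrable G_hausdorff lam_haar uu ch).
- exact: (fint_integrable G_hausdorff lam_haar uu ck).
Qed.

(* [psi * (psi^* * a)] averages the translates [a (y' y^-1 x)] over [y], [y'] in the
   support of [psi], so it is close to [a x] times the total weight [r]. *)
Lemma kernel_comparison theta m a k x : ccR theta -> (forall y, 0 <= theta y) ->
  (forall y, 0 <= m y) -> continuous (fun y => m (src y)) -> Cc G a ->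
  (forall y y', theta y != 0 -> theta y' != 0 -> src y = src y' -> rng x = rng y ->
     cabs (a (gmul y' (gmul (ginv y) x)) - a x) <= k x) ->
  let psi y := (theta y * m (src y))%:C : R[i] in
  let r := fint lam (fun y => theta y *
     (m (src y) ^+ 2 * fint lam (theta \o ginv) (src y))) (rng x) in
  is_true (cabs (conv lam psi (conv lam (invol psi) a) x - a x * r%:C) <= k x * r).
Proof.
move=> ct t0 m0 cm Ca kP psi r.
pose S u := fint lam (theta \o ginv) u.
have ctg : ccR (theta \o ginv) := ccR_ginv G_hausdorff ct.
have cpsi : ccR (fun y => theta y * m (src y)) := ccR_mul G_hausdorff ct cm.
have Cpsi : Cc G psi := ccR_Cc cpsi.
have CB : Cc G (conv lam (invol psi) a).
  exact: (conv_Cc G_hausdorff G_lc lam_haar (Cc_invol G_hausdorff Cpsi) Ca).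
set B := conv lam (invol psi) a in CB *.
have BP y : rng y = rng x -> theta y != 0 ->
    cabs (B (gmul (ginv y) x) - a x * (m (src y) * S (src y))%:C) <=
    k x * (m (src y) * S (src y)).
  move=> yx ty; set v := gmul (ginv y) x.
  have rv : rng v = src y by rewrite /v rng_inv_mul.
  have -> : m (src y) * S (src y) =
      \int[lam (src y)]_(w in rfiber (src y)) (m (src y) * theta (ginv w)).
    by rewrite /S /fint RintegralZl//;
      exact: (fint_integrable G_hausdorff lam_haar (unit_src y) ctg).
  have -> : B v = cintegral (lam (src y)) (rfiber (src y))
      (fun w => (m (src y) * theta (ginv w))%:C * a (gmul (ginv w) v)).
    rewrite /B /conv rv; apply: eq_cintegral => w wy.
    by rewrite /invol /psi conjc_real src_ginv (wy : rng w = _) mulrC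
      [theta _ * _]mulrC mulrC.
  apply: weighted_comparison.
  - exact: mrf.
  - have -> : (fun w => (m (src y) * theta (ginv w))%:E) =
        (fun w => (m (src y))%:E * (theta (ginv w))%:E)%E by [].
    apply: integrableZl => //.
    exact: (fint_integrable G_hausdorff lam_haar (unit_src y) ctg).
  - have := conv_integrable G_hausdorff lam_haar v
      (Cc_invol G_hausdorff Cpsi) Ca.1; rewrite rv.
    move=> [ir ii]; split.
      apply: eq_integrable ir => // w; rewrite inE => wy.
      by rewrite /invol /psi conjc_real src_ginv (wy : rng w = _) [theta _ * _]mulrC.
    apply: eq_integrable ii => // w; rewrite inE => wy.
    by rewrite /invol /psi conjc_real src_ginv (wy : rng w = _) [theta _ * _]mulrC.
  - by move=> w _; rewrite mulr_ge0.
  - move=> w wy; rewrite mulf_eq0 negb_or => /andP[_ tw].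
    by apply: kP => //; rewrite src_ginv; exact: esym.
pose q y := theta y * (m (src y) ^+ 2 * S (src y)).
have cq : ccR q.
  apply: (ccR_mul G_hausdorff ct) => y.
  apply: cvgM; first by apply: cvgM; exact: cm.
  exact: (fint_src_continuous lam_haar ctg).
have iq := fint_integrable G_hausdorff lam_haar (unit_rng x) cq.
have iqC : cintegrable (lam (rng x)) (rfiber (rng x) : set (borel G))
    (fun y => (q y)%:C : R[i]).
  by split => //=; exact: integrable0.
have rE : (r%:C : R[i]) = cintegral (lam (rng x)) (rfiber (rng x)) (fun y => (q y)%:C).
  by rewrite /cintegral /= Rintegral_cst// mul0r.
have iB := conv_integrable G_hausdorff lam_haar x Cpsi CB.1.
rewrite rE -cintegralZ// /conv -cintegralB//; last exact: cintegrableZ.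
have iD' : cintegrable (lam (rng x)) (rfiber (rng x) : set (borel G))
    (fun y => psi y * B (gmul (ginv y) x) - a x * (q y)%:C).
  have <- : (fun y => -1 * (a x * (q y)%:C) + psi y * B (gmul (ginv y) x)) =
    (fun y => psi y * B (gmul (ginv y) x) - a x * (q y)%:C).
    by apply/funext => y; rewrite mulN1r addrC.
  exact: (cintegrable_lin (mrf _) (-1) (cintegrableZ (mrf _) (a x) iqC) iB).
rewrite (le_trans (cabs_cintegral_le (mrf _) iD'))//.
rewrite /r /fint -RintegralZl//.
apply: le_Rintegral => //.
- exact: (cintegrable_cabs (mrf _) iD').
- exact: (@integrableZl _ _ _ _ _ (mrf _) (k x) _ iq).
move=> y yx.
have [ty|ty] := eqVneq (theta y) 0.
  by rewrite /psi /q ty !mul0r !mulr0 subr0 cabs0.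
have -> : psi y * B (gmul (ginv y) x) - a x * (q y)%:C = (theta y * m (src y))%:C *
   (B (gmul (ginv y) x) - a x * (m (src y) * S (src y))%:C).
  rewrite /psi /q mulrBr; congr (_ - _).
  by rewrite [RHS]mulrCA -rmorphM /=; congr (_ * _%:C); rewrite expr2; ring.
rewrite cabsM cabs_real ger0_norm ?mulr_ge0//.
have -> : k x * (theta y * (m (src y) ^+ 2 * fint lam (theta \o ginv) (src y))) =
  (theta y * m (src y)) * (k x * (m (src y) * S (src y))).
  by rewrite /S expr2; ring.
by apply: ler_wpM2l; [rewrite mulr_ge0|exact: BP].
Qed.

(** The weight [r] is only close to the fiber integral of [theta]: normalizing needs a division by
    [S], the mass of [theta] on a source fiber, which has to be cut off where it is small. One [psi]
    serves all [a] and [k]. *)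
Lemma kernel_unit theta (e : R) : ccR theta -> (forall y, 0 <= theta y) -> 0 < e ->
  exists psi : G -> R[i], [/\ Cc G psi, forall x, psi x != 0 -> theta x != 0 &
    forall a k x, Cc G a ->
      (forall y y', theta y != 0 -> theta y' != 0 -> src y = src y' -> rng x = rng y ->
        cabs (a (gmul y' (gmul (ginv y) x)) - a x) <= k x) ->
      exists r : R, [/\ fint lam theta (rng x) - e <= r, r <= fint lam theta (rng x) &
        cabs (conv lam psi (conv lam (invol psi) a) x - a x * r%:C) <= k x * r]].
Proof.
move=> ct t0 e0.
have cst : ccR (fun x => Num.sqrt (theta x)) := ccR_sqrt G_hausdorff ct.
have [C C0 CP] := Cc_integral_bounded G_hausdorff lam_haar (ccR_Cc cst).
have C1 : 0 < C + 1 by rewrite ltr_wpDl.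
(* [C] bounds the fiber integrals of [Num.sqrt (theta y)], so a pointwise loss of
   [d * Num.sqrt (theta y)] integrates to at most [e]. *)
pose d := e / (C + 1).
have d0 : 0 < d by rewrite divr_gt0.
have ctg : ccR (theta \o ginv) := ccR_ginv G_hausdorff ct.
pose S u := fint lam (theta \o ginv) u.
have cS : continuous (fun y => S (src y)).
  exact: (fint_src_continuous lam_haar ctg).
(* The set where [d ^+ 2 <= theta] is compact, and there [y^-1], whose range is [src y], makes
   [S (src y)] positive. *)
have [s s0 sP] : exists2 s : R, 0 < s &
    forall y, d ^+ 2 <= theta y -> s <= S (src y).
  apply: (compact_positive_lower_bound (K := [set y | d ^+ 2 <= theta y])) => //.
    apply: (subclosed_compact _ ct.2).
      apply: (@closed_comp _ _ theta [set r | d ^+ 2 <= r]); last exact: closed_ge.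
      by move=> y _; exact: ct.1.
    move=> y /= dy; apply: subset_closure => /=.
    by rewrite gt_eqF// (lt_le_trans _ dy)// exprn_gt0.
  move=> y dy; rewrite /S -rng_ginv; apply: (fint_gt0 G_hausdorff G_sc lam_haar ctg).
    by move=> z; exact: t0.
  by rewrite /= ginvK (lt_le_trans _ dy)// exprn_gt0.
(* With [m = q^(1/2)] the inner average has total weight one wherever
   [d ^+ 2 <= theta]; elsewhere the loss is at most [d * Num.sqrt (theta y)]. *)
pose q u : R := (Num.max (S u) s)^-1.
have q0 u : 0 < q u by rewrite invr_gt0 lt_max s0 orbT.
pose m u : R := Num.sqrt (q u).
have cm : continuous (fun y => m (src y)).
  move=> y; apply: (@continuous_comp _ _ _ (fun y => q (src y)) (@Num.sqrt R));
    last exact: sqrt_continuous.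
  have cM := @continuous_maxr R G _ s cS.
  apply: (@cvgV R _ (nbhs y) _ (fun y => Num.max (S (src y)) s)); last exact: cM.
  by rewrite gt_eqF// lt_max s0 orbT.

have m0 y : 0 <= m y by exact: sqrtr_ge0.
have cpsi : ccR (fun y => theta y * m (src y)) := ccR_mul G_hausdorff ct cm.
exists (fun y => (theta y * m (src y))%:C); split.
- exact: ccR_Cc cpsi.
- by move=> x; apply: contraNN => /eqP ->; rewrite mul0r.
move=> a k x Ca kP.
have H := kernel_comparison ct t0 m0 cm Ca kP.
set r := fint _ _ _ in H; exists r.
have S0 y : 0 <= S (src y) by apply: Rintegral_ge0 => w _; exact: t0.
have cg : ccR (fun y => theta y * (m (src y) ^+ 2 * S (src y))).
  apply: (ccR_mul G_hausdorff ct) => y.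
  apply: cvgM; first by apply: cvgM; exact: cm.
  exact: cS.
have uu := unit_rng x.
have mE u : m u ^+ 2 = q u by rewrite /m sqr_sqrtr// ltW.
split=> //; last first.
  apply: fint_le => // y; rewrite ler_piMr// mE /q mulrC ler_pdivrMr ?mul1r.
    by rewrite le_max lexx.
  by rewrite lt_max s0 orbT.
have cstd : ccR (fun x => Num.sqrt (theta x) * d).
  by apply: (ccR_mul G_hausdorff cst) => y; exact: cvg_cst.
have : fint lam (fun y => theta y - theta y * (m (src y) ^+ 2 * S (src y))) (rng x) <=
    fint lam (fun y => Num.sqrt (theta y) * d) (rng x).
  have cgn : ccR (fun y => theta y - theta y * (m (src y) ^+ 2 * S (src y))).
    have -> : (fun y => theta y - theta y * (m (src y) ^+ 2 * S (src y))) =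
      fun y => theta y * (1 - (m (src y) ^+ 2 * S (src y))).
      by apply/funext => y; rewrite mulrBr mulr1.
    apply: (ccR_mul G_hausdorff ct) => y; apply: cvgB; first exact: cvg_cst.
    apply: cvgM; first by apply: cvgM; exact: cm.
    exact: cS.
  apply: fint_le => // y.
  have [ty|ty] := leP (d ^+ 2) (theta y).
    rewrite mE /q [Num.max _ _]max_l ?sP// mulVf.
      by rewrite mulr1 subrr mulr_ge0 ?sqrtr_ge0// ltW.
    by rewrite gt_eqF// (lt_le_trans s0)// sP.
  rewrite (@le_trans _ _ (theta y))//.
    by rewrite gerBl ?mulr_ge0// sqr_ge0.
  rewrite -{1}(sqr_sqrtr (t0 y)) expr2 ler_wpM2l ?sqrtr_ge0//.
  by rewrite -[leRHS](ger0_norm (ltW d0)) -sqrtr_sqr ler_wsqrtr// ltW.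
rewrite /fint RintegralB//; first last.
- exact: (fint_integrable G_hausdorff lam_haar uu cg).
- exact: (fint_integrable G_hausdorff lam_haar uu ct).
move=> H1; rewrite lerBlDr -lerBlDl; apply: (le_trans H1).
rewrite RintegralZr//; last exact: (fint_integrable G_hausdorff lam_haar uu cst).
have : \int[lam (rng x)]_(y in rfiber (rng x)) Num.sqrt (theta y) <= C.
  have := CP _ uu; under eq_integral do rewrite cabs_real ger0_norm ?sqrtr_ge0//.
  rewrite -lee_fin /Rintegral fineK//.
  apply: integrable_fin_num => //.
  exact: (fint_integrable G_hausdorff lam_haar uu cst).
move=> /(ler_wpM2r (ltW d0)) /le_trans; apply.
rewrite /d mulrCA ger_pMr// ler_pdivrMr// mul1r lerDl//.
Qed.

End kernel_unit.

Section approximate_unit.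
Variables (R : realType) (G : topGroupoidType).
Hypothesis (G_hausdorff : hausdorff_space G) (G_lc : locally_compact [set: G]).
Hypothesis (G_sc : @second_countable G).
Variable lam : G -> {measure set (borel G) -> \bar R}.
Hypothesis lam_haar : is_haar_system lam.
Variables (Gam : groupType) (c : contHom G Gam).

Let mrf u : measurable (rfiber u : set (borel G)).
Proof. exact: measurable_rfiber. Qed.

(** Division by the fiber mass [H] of the sum of the [phi i], which depends on the range only and so
    leaves fiber integrals as a constant. Replacing [H] by its maximum with a lower bound [s] on [K]
    keeps the quotient continuous, with total [1] on [K] and at most [1] elsewhere. *)
Lemma partition_weights n (phi : 'I_n -> G -> R) (K : set G) : compact K ->
  (forall i, ccR (phi i)) -> (forall i y, 0 <= phi i y) ->
  (forall x, K x -> exists i, 0 < phi i x) ->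
  exists theta : 'I_n -> G -> R, [/\ forall i, ccR (theta i),
    forall i y, 0 <= theta i y, forall i y, theta i y != 0 -> phi i y != 0,
    forall x, \sum_i fint lam (theta i) (rng x) <= 1 &
    forall x, K x -> \sum_i fint lam (theta i) (rng x) = 1].
Proof.
move=> cK cphi phi0 phiK.
pose H x : R := \sum_i fint lam (phi i) (rng x).
have cH : continuous H.
  move=> x; apply: cvg_big => [|i _].
    exact: (@add_continuous R^o).
  exact: (fint_rng_continuous lam_haar (cphi i)).
have H0 i u : 0 <= fint lam (phi i) u by apply: Rintegral_ge0 => w _; exact: phi0.
have [s s0 sP] : exists2 s : R, 0 < s & forall x, K x -> s <= H x.
  apply: compact_positive_lower_bound => // x /phiK[i ix].
  rewrite /H (bigD1 i)//= ltr_pwDl//; last by apply: sumr_ge0.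
  exact: (fint_gt0 G_hausdorff G_sc lam_haar (cphi i) (phi0 i) ix).
have cM : continuous (fun x => Num.max (H x) s) := @continuous_maxr R G H s cH.
have M0 x : 0 < Num.max (H x) s by rewrite lt_max s0 orbT.
pose theta i y := phi i y * (Num.max (H y) s)^-1.
have E x : \sum_i fint lam (theta i) (rng x) = H x / Num.max (H x) s.
  rewrite /H mulr_suml; apply: eq_bigr => i _.
  rewrite /fint -(RintegralZr (Num.max (\sum_i fint lam (phi i) (rng x)) s)^-1 (mrf (rng x))
    (fint_integrable G_hausdorff lam_haar (unit_rng x) (cphi i))).
  by apply: eq_Rintegral => y; rewrite inE => yx; rewrite /theta /H (yx : rng y = _).
exists theta; split.
- move=> i; apply: (ccR_mul G_hausdorff (cphi i)) => y.
  by apply: (@cvgV R _ (nbhs y) _ (fun y => Num.max (H y) s)); [rewrite gt_eqF|exact: cM].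
- by move=> i y; rewrite mulr_ge0// invr_ge0 ltW.
- by move=> i y; rewrite mulf_eq0 negb_or => /andP[].
- by move=> x; rewrite E ler_pdivrMr// mul1r le_max lexx.
- move=> x Kx; rewrite E [Num.max _ _]max_l ?sP// divff// gt_eqF//.
  by rewrite (lt_le_trans s0)// sP.
Qed.

(** [beta] is chosen before [e], so the error is [e] times a fixed function of [Cc] and tends to [0]
    in the I-norm by [Inorm_le]. *)
Lemma approximate_unit (g : Gam) (a : G -> R[i]) : Cc G a ->
  (forall x, a x != 0 -> c x = g) ->
  exists beta : G -> R[i], Cc G beta /\ forall e : R, 0 < e ->
    exists n (psi : 'I_n -> G -> R[i]), [/\ forall i, Cc G (psi i),
      forall i x, psi i x != 0 -> c x = g &
      forall x, cabs (a x - \sum_i conv lam (psi i) (conv lam (invol (psi i)) a) x) <=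
        e * cabs (beta x)].
Proof.
move=> Ca ag; have [_ cK] := Ca; set K := closure _ in cK.
have [f [cf f01 f1 cf0 _]] :=
  compact_open_urysohn R G_hausdorff G_lc cK (@openT G) (@subsetT _ K).
pose N := [set x | 2^-1 < f x].
have oN : open N.
  by apply: (@open_comp _ _ f [set r | 2^-1 < r]) => [y _|]; [exact: cf|exact: open_gt].
have KN : K `<=` N by move=> x Kx; rewrite /N /= f1// invf_lt1// ltr1n.
pose h x := f x * 2.
have h0 x : 0 <= h x by rewrite mulr_ge0//; have /andP[] := f01 x.
have hN x : N x -> 1 <= h x by rewrite /N /= => /ltW; rewrite -div1r ler_pdivrMr.
have ch : ccR h.
  by apply: (ccR_mul G_hausdorff (conj cf cf0)) => y; exact: cvg_cst.
(* [h] dominates the translation error, and [|a|] the defect of the weights [r i], whose sum is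
   within [e] of [1] on the support of [a]. *)
exists (fun x => 1 * (h x)%:C + (cabs (a x))%:C); split.
  exact: (Cc_lin G_hausdorff 1 (ccR_Cc ch) (Cc_cabs G_hausdorff Ca)).
move=> e e0.
have [n [phi [cphi phi0 phig phiK phiP]]] :=
  coset_bumps G_hausdorff G_lc Ca ag oN KN e0 hN h0.
have [theta [ct t0 tphi t1 tK]] := partition_weights cK cphi phi0 phiK.
(* Each of the [n] weights loses at most this much, hence at most [e] in total; [n.+1] also covers
   [n = 0]. *)
have e'0 : 0 < e / n.+1%:R by rewrite divr_gt0.
have /choice[psi psiP] := fun i => kernel_unit G_hausdorff G_lc G_sc lam_haar
  (ct i) (t0 i) e'0.
exists n, psi; split.
- by move=> i; have [] := psiP i.
- by move=> i x px; have [_ /(_ _ px) tx _] := psiP i; exact: (phig i x (tphi i x tx)).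
move=> x.
have rP i : exists r : R, [/\ fint lam (theta i) (rng x) - e / n.+1%:R <= r,
    r <= fint lam (theta i) (rng x) &
    cabs (conv lam (psi i) (conv lam (invol (psi i)) a) x - a x * r%:C) <= e * h x * r].
  have [_ _ H] := psiP i; apply: (H a (fun x => e * h x) x Ca) => y y' ty ty' yy' xy.
  exact: (phiP i y y' x (tphi i y ty) (tphi i y' ty') yy' xy).
have [r rI] := choice rP.
have r1 : \sum_i r i <= 1.
  by apply: le_trans (t1 x); apply: ler_sum => i _; have [] := rI i.
have r2 : \sum_i fint lam (theta i) (rng x) - e <= \sum_i r i.
  apply: (@le_trans _ _ (\sum_i (fint lam (theta i) (rng x) - e / n.+1%:R))).
    rewrite sumrB lerB// sumr_const card_ord -[_ *+ _]mulr_natr -mulrA.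
    by rewrite ger_pMr// mulrC ler_pdivrMr// mul1r ler_nat.
  by apply: ler_sum => i _; have [] := rI i.
have -> : a x - \sum_i conv lam (psi i) (conv lam (invol (psi i)) a) x =
    a x * (1 - \sum_i r i)%:C +
    \sum_i (a x * (r i)%:C - conv lam (psi i) (conv lam (invol (psi i)) a) x).
  by rewrite sumrB -mulr_sumr rmorphB rmorph1 mulrBr mulr1 -rmorph_sum addrA subrK.
rewrite (le_trans (cabsD _ _))//.
have -> : cabs (1 * (h x)%:C + (cabs (a x))%:C : R[i]) = h x + cabs (a x).
  by rewrite mul1r -rmorphD cabs_real ger0_norm// addr_ge0// cabs_ge0.
rewrite mulrDr addrC lerD//.
  have D (I : finType) (F : I -> R[i]) : cabs (\sum_i F i) <= \sum_i cabs (F i).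
    elim/big_ind2 : _ => [|u v w z H1 H2|//]; first by rewrite cabs0.
    by rewrite (le_trans (cabsD _ _))// lerD.
  rewrite (le_trans (D _ _))//.
  apply: (@le_trans _ _ (\sum_i e * h x * r i)).
    by apply: ler_sum => i _; rewrite cabsB; have [] := rI i.
  by rewrite -mulr_sumr ler_piMr// mulr_ge0// ltW.
rewrite cabsM cabs_real mulrC.
have [ax|ax] := eqVneq (a x) 0; first by rewrite ax cabs0 !mulr0.
rewrite ler_wpM2r ?cabs_ge0// ger0_norm ?subr_ge0//.
by rewrite lerBlDr addrC -lerBlDr -(tK x) //; exact: Cc_supp.
Qed.

End approximate_unit.

(** * Positivity *)

Section positivity.
Variables (R : realType) (G : topGroupoidType).
Hypothesis (G_hausdorff : hausdorff_space G) (G_lc : locally_compact [set: G]).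
Hypothesis (G_sc : @second_countable G).
Variable lam : G -> {measure set (borel G) -> \bar R}.
Hypothesis lam_haar : is_haar_system lam.
Variables (Gam : groupType) (c : contHom G Gam).
Implicit Types (a b : G -> R[i]) (x y z u : G).

Lemma Cc_sum I (s : seq I) (F : I -> G -> R[i]) : (forall i, Cc G (F i)) ->
  Cc G (\sum_(i <- s) F i).
Proof.
move=> CF; elim: s => [|i s IH]; first by rewrite big_nil; exact: (Cc0 R G_hausdorff).
rewrite big_cons.
have := Cc_lin G_hausdorff 1 (CF i) IH.
by congr Cc; apply/funext => x; rewrite mul1r.
Qed.

Lemma Cc_additive_sum (V : zmodType) (L : (G -> R[i]) -> V) I (s : seq I)
    (F : I -> G -> R[i]) :
  (forall a b, Cc G a -> Cc G b -> L (fun x => 1 * a x + b x) = L a + L b) ->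
  (forall i, Cc G (F i)) -> L (\sum_(i <- s) F i) = \sum_(i <- s) L (F i).
Proof.
move=> Ladd CF.
have L0 : L (fun=> 0) = 0.
  have := Ladd _ _ (Cc0 R G_hausdorff) (Cc0 R G_hausdorff).
  have -> : (fun x : G => 1 * 0 + 0) = (fun=> 0 : R[i]).
    by apply/funext => x; rewrite mulr0 addr0.
  by move/eqP; rewrite -subr_eq subrr => /eqP <-.
elim: s => [|i s IH]; first by rewrite !big_nil.
rewrite !big_cons -IH -Ladd//; last exact: Cc_sum.
by congr L; apply/funext => x; rewrite mul1r.
Qed.

Lemma conv_sumr a I (s : seq I) (F : I -> G -> R[i]) : Cc G a ->
  (forall i, Cc G (F i)) ->
  conv lam a (\sum_(i <- s) F i) = \sum_(i <- s) conv lam a (F i).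
Proof.
move=> Ca; apply: (@Cc_additive_sum (G -> R[i]) (conv lam a)) => b d Cb Cd.
rewrite (conv_linr G_hausdorff lam_haar 1 Ca Cb.1 Cd.1).
by apply/funext => x; rewrite mul1r.
Qed.

Lemma conv_coset_part (g : Gam) a b x : kerset c x ->
  conv lam (invol (coset_part c g a)) b x =
  conv lam (invol (coset_part c g a)) (coset_part c g b) x.
Proof.
move=> cx; apply: eq_cintegral => y yx.
rewrite /invol /coset_part hom_inv_mul// hom_ginv (cx : c x = 1%g) mulg1.
by case: ifP => // _; rewrite conjc0 !mul0r.
Qed.

Variable phi : (G -> R[i]) -> R[i].
Hypothesis phi_lin : forall k a b, Cc G a -> Cc G b ->
  phi (fun x => k * a x + b x) = k * phi a + phi b.
Hypothesis phi_bound : forall a, Cc G a -> cabs (phi a) <= fine (Inorm lam a).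
Hypothesis phi_ker : forall a b, Cc G a -> Cc G b ->
  (forall x, kerset c x -> a x = b x) -> phi a = phi b.
Hypothesis phi_pos : forall b, Cc G b -> (forall x, ~ kerset c x -> b x = 0) ->
  0 <= phi (conv lam (invol b) b).

Let phi_sum I (s : seq I) (F : I -> G -> R[i]) : (forall i, Cc G (F i)) ->
  phi (\sum_(i <- s) F i) = \sum_(i <- s) phi (F i).
Proof.
by apply: Cc_additive_sum => a b Ca Cb; rewrite phi_lin// mul1r.
Qed.

Let Cconv a b (Ca : Cc G a) (Cb : Cc G b) : Cc G (conv lam a b) :=
  conv_Cc G_hausdorff G_lc lam_haar Ca Cb.
Let Cinv a (Ca : Cc G a) : Cc G (invol a) := Cc_invol G_hausdorff Ca.

Lemma ge0_approx (z : R[i]) (C : R) :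
  (forall e : R, 0 < e -> exists2 w : R[i], 0 <= w & cabs (z - w) <= e * C) -> 0 <= z.
Proof.
move=> H.
have C1 : 0 < `|C| + 1 by rewrite ltr_wpDl.
have H1 e : 0 < e -> exists2 w : R[i], 0 <= w & cabs (z - w) <= e.
  move=> e0; have [|w w0 zw] := H (e / (`|C| + 1)); first by rewrite divr_gt0.
  exists w => //; apply: (le_trans zw).
  rewrite mulrAC ler_pdivrMr// ler_wpM2l ?(ltW e0)//.
  by rewrite (le_trans (ler_norm _))// lerDl.
have Iz : complex.Im z = 0.
  apply/eqP; rewrite -normr_eq0 eq_le normr_ge0 andbT.
  apply/ler_addgt0Pr => e e0; rewrite add0r; have [w w0 zw] := H1 e e0.
  apply: le_trans zw; have := cabs_Im (z - w).
  by rewrite raddfB /= [X in _ - complex.Im X](Re_ge0_real w0) subr0.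
have Rz : 0 <= complex.Re z.
  rewrite -oppr_le0; apply/ler_addgt0Pr => e e0; rewrite add0r; have [w w0 zw] := H1 e e0.
  have w1 : 0 <= complex.Re w by rewrite -(lecR 0) -(Re_ge0_real w0).
  apply: le_trans zw; apply: le_trans (cabs_Re _); rewrite raddfB /=.
  by rewrite -normrN (le_trans _ (ler_norm _))// opprB lerDr.
by case: z Iz Rz {H H1} => x y /= -> x0; rewrite lecE /= eqxx.
Qed.

(* If [a] lives on one coset, [a] is close to [\sum_i psi_i * b_i] with
   [b_i = psi_i^* * a] supported in G_e, whence [a^* * a] is close to the sum of the
   [b_i^* * b_i], on which [phi] is nonnegative by hypothesis. *)
Lemma coset_positive (g : Gam) a : Cc G a -> (forall x, a x != 0 -> c x = g) ->
  0 <= phi (conv lam (invol a) a).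
Proof.
move=> Ca ag.
have [beta [Cb happ]] :=
  approximate_unit G_hausdorff G_lc G_sc lam_haar Ca ag.
apply: (@ge0_approx _ (fine (Inorm lam a) * fine (Inorm lam beta))) => e e0.
have [n [psi [Cpsi psig near_a]]] := happ e e0.
pose b i := conv lam (invol (psi i)) a.
have Cbi i : Cc G (b i) := Cconv (Cinv (Cpsi i)) Ca.
pose p := \sum_i conv lam (psi i) (b i).
have Cpb i : Cc G (conv lam (psi i) (b i)) := Cconv (Cpsi i) (Cbi i).
have Cp : Cc G p by exact: Cc_sum.
have part (d : G -> R[i]) : (forall x, d x != 0 -> c x = g) -> coset_part c g d = d.
  move=> dg; apply/funext => x; rewrite /coset_part; case: eqP => // cx.
  by apply/eqP; rewrite eq_sym; apply: contrapT => /negP /dg.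
have bE i : conv lam (invol a) (conv lam (psi i) (b i)) =
    conv lam (invol (b i)) (b i).
  rewrite -(convA G_hausdorff G_lc G_sc lam_haar (Cinv Ca) (Cpsi i) (Cbi i)).
  congr (conv lam _ _).
  by rewrite (invol_conv G_hausdorff G_lc G_sc lam_haar (Cinv (Cpsi i)) Ca) involK.
exists (\sum_i phi (conv lam (invol (b i)) (b i))).
  apply: sumr_ge0 => i _; apply: phi_pos => // x cx.
  by rewrite /b -(part _ (psig i)) -{1}(part _ ag) (conv_coset_ker G_hausdorff).
have -> : \sum_i phi (conv lam (invol (b i)) (b i)) = phi (conv lam (invol a) p).
  rewrite /p (conv_sumr _ (Cinv Ca) Cpb) phi_sum; last first.
    by move=> i; exact: (Cconv (Cinv Ca) (Cpb i)).
  by apply: eq_bigr => i _; rewrite bE.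
pose d x := -1 * p x + a x.
have Cd : Cc G d by exact: Cc_lin.
have -> : phi (conv lam (invol a) a) - phi (conv lam (invol a) p) =
    phi (conv lam (invol a) d).
  rewrite /d (conv_linr G_hausdorff lam_haar (-1) (Cinv Ca) Cp.1 Ca.1).
  rewrite phi_lin ?mulN1r 1?addrC//; first exact: (Cconv (Cinv Ca) Cp).
  exact: (Cconv (Cinv Ca) Ca).
apply: (le_trans (phi_bound (Cconv (Cinv Ca) Cd))).
have Id : (Inorm lam d <= e%:E * Inorm lam beta)%E.
  apply: (Inorm_le G_hausdorff lam (ltW e0) Cd Cb) => x.
  by have := near_a x; rewrite /d /p fct_sumE mulN1r addrC.
rewrite -lee_fin fineK; last exact: (Inorm_fin_num G_hausdorff lam_haar (Cconv (Cinv Ca) Cd)).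
apply: (le_trans (Inorm_conv G_hausdorff G_lc G_sc lam_haar (Cinv Ca) Cd)).
rewrite (Inorm_invol G_hausdorff lam Ca) mulrCA EFinM EFinM.
rewrite !fineK; try exact: (Inorm_fin_num G_hausdorff lam_haar).
by apply: lee_wpmul2l => //; exact: (Inorm_ge0 G_hausdorff lam Ca).
Qed.

Lemma kernel_positive a : Cc G a -> 0 <= phi (conv lam (invol a) a).
Proof.
move=> Ca; have [s aE] := coset_decomposition c Ca.
have Cg g : Cc G (coset_part c g a) := Cc_coset_part G_hausdorff c g Ca.
(* Only the left factor is decomposed. On G_e the products [a_g^* * a] and [a_g^* * a_g] agree, and
   [phi] depends on values in G_e alone, so no double sum arises. *)
rewrite {1}aE.
rewrite (@Cc_additive_sum _ (fun b => phi (conv lam (invol b) a))) //; last first.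
  move=> d b Cd Cb; rewrite invol_lin conjc1.
  rewrite (conv_linl G_hausdorff lam_haar 1 (Cinv Cd) (Cinv Cb) Ca.1).
  by rewrite phi_lin ?mul1r//; apply: Cconv => //; exact: Cinv.
apply: sumr_ge0 => g _.
have -> : phi (conv lam (invol (coset_part c g a)) a) =
    phi (conv lam (invol (coset_part c g a)) (coset_part c g a)).
  apply: phi_ker => [||x cx]; [exact: (Cconv (Cinv (Cg g)) Ca)|
    exact: (Cconv (Cinv (Cg g)) (Cg g))|exact: conv_coset_part].
apply: (@coset_positive g) => // x.
by rewrite /coset_part; case: ifP => [/eqP|_]; rewrite ?eqxx.
Qed.

End positivity.

(** * The GNS construction *)

Section hilbert_inner.
Variables (R : realType) (H : hilbertSpace R).
Implicit Types (x y z : H).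

Let lin := @inner_linear R H.
Let hconj := @inner_conj R H.

Lemma inner_ge0 x : 0 <= inner x x.
Proof. by rewrite inner_norm exprn_ge0. Qed.

Lemma inner_seminorm x : seminorm (@inner R H) x = rnorm x.
Proof.
rewrite /seminorm inner_norm norm_rnorm -rmorphXn /=.
by rewrite sqrtr_sqr ger0_norm// rnorm_ge0.
Qed.

Lemma inner_rnorm x : inner x x = (rnorm x ^+ 2)%:C.
Proof. by rewrite inner_norm norm_rnorm -rmorphXn. Qed.

Lemma inner_cauchy_schwarz x y : cabs (inner x y) <= rnorm x * rnorm y.
Proof.
by rewrite -!inner_seminorm; exact: (cauchy_schwarz lin hconj inner_ge0).
Qed.

Lemma inner_linr k x y z : inner z (k *: x + y) = k^*%C * inner z x + inner z y.
Proof. by rewrite (formDr lin hconj) (formZr lin hconj). Qed.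

Lemma innerBl x y z : inner (x - y) z = inner x z - inner y z.
Proof. exact: (formBl lin). Qed.

Lemma opnorm_ub (T : H -> H) x : rnorm x <= 1 -> ((rnorm (T x))%:E <= opnorm T)%E.
Proof. by move=> x1; apply: ereal_sup_ubound; exists x. Qed.

Lemma opnorm_le (T : H -> H) (C : R) : 0 <= C ->
  (forall x, rnorm (T x) <= C * rnorm x) -> (opnorm T <= C%:E)%E.
Proof.
move=> C0 TC; apply: ge_ereal_sup => _ [x x1 <-].
by rewrite lee_fin (le_trans (TC x))// ler_piMr.
Qed.

Lemma rnorm_opnorm (T : H -> H) (C : R) x : linear T -> 0 <= C ->
  (opnorm T <= C%:E)%E -> rnorm (T x) <= C * rnorm x.
Proof.
move=> Tl C0 TC.
have T0 : T 0 = 0.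
  by have := Tl 1 0 0; rewrite !scale1r addr0 => /eqP; rewrite -subr_eq subrr => /eqP.
have TZ k v : T (k *: v) = k *: T v.
  by have := Tl k v 0; rewrite T0 !addr0.
have [x0|x0] := eqVneq (rnorm x) 0.
  by rewrite (rnorm_eq0 x0) T0 !rnorm0 mulr0.
have xp : 0 < rnorm x by rewrite lt_def x0 rnorm_ge0.
pose r : R[i] := (rnorm x)^-1%:C.
have rx : rnorm (r *: x) = 1.
  by rewrite rnormZ -/(cabs r) cabs_real ger0_norm ?invr_ge0 ?rnorm_ge0// mulVf.
have rx1 : rnorm (r *: x) <= 1 by rewrite rx.
have := le_trans (opnorm_ub T rx1) TC.
rewrite TZ lee_fin rnormZ -/(cabs r) cabs_real ger0_norm ?invr_ge0 ?rnorm_ge0//.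
by rewrite mulrC ler_pdivrMr.
Qed.

End hilbert_inner.

(** Iteration gives [t 0 ^ (2^n) * N <= M * (I * N) ^ (2^n)]. If [t 0] exceeded [I * N], the powers
    [q ^ (2^n)] of a ratio [q > 1] would stay below [M / N], against Bernoulli's inequality. *)
Lemma iterated_square_bound (R : realType) (t : nat -> R) (N I M : R) :
  0 < N -> 0 <= I -> (forall n, 0 <= t n) -> (forall n, t n ^+ 2 <= t n.+1 * N) ->
  (forall n, t n <= I ^+ (2 ^ n) * M) -> t 0%N <= I * N.
Proof.
move=> N0 I0 t0 tS tM.
have H1 n : t 0%N ^+ (2 ^ n) * N <= t n * N ^+ (2 ^ n).
  elim: n => [|n IH]; first by rewrite expn0 !expr1.
  have A0 : 0 <= t 0%N ^+ (2 ^ n) by rewrite exprn_ge0.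
  have B0 : 0 <= N ^+ (2 ^ n) by rewrite exprn_ge0// ltW.
  rewrite expnS mulnC !exprM -(ler_pM2r N0).
  move: IH A0 B0; set A := t 0%N ^+ _; set B := N ^+ _ => IH A0 B0.
  have AN0 : 0 <= A * N by rewrite mulr_ge0// ltW.
  have -> : A ^+ 2 * N * N = (A * N) ^+ 2 by ring.
  apply: (@le_trans _ _ ((t n * B) ^+ 2)).
    by rewrite ler_pXn2r// nnegrE// mulr_ge0.
  have -> : t n.+1 * B ^+ 2 * N = t n.+1 * N * B ^+ 2 by ring.
  by rewrite exprMn ler_wpM2r// exprn_ge0.
rewrite leNgt; apply/negP => IN.
have IN0 : 0 <= I * N by rewrite mulr_ge0// ltW.
have tp : 0 < t 0%N := le_lt_trans IN0 IN.
have H2 n : t 0%N ^+ (2 ^ n) * N <= M * (I * N) ^+ (2 ^ n).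
  apply: (le_trans (H1 n)); rewrite exprMn mulrA ler_wpM2r ?exprn_ge0 ?(ltW N0)//.
  by rewrite mulrC.
have Mp : 0 < M.
  have := lt_le_trans tp (tM 0%N); rewrite expn0 expr1 => h.
  by rewrite ltNge; apply/negP => M0; move: h; rewrite ltNge mulr_ge0_le0.
have [I1|I1] := eqVneq (I * N) 0.
  have := H2 0%N; rewrite I1 expn0 !expr1 mulr0 leNgt.
  by rewrite mulr_gt0.
have INp : 0 < I * N by rewrite lt_def I1.
pose q := t 0%N / (I * N).
have q1 : 1 < q by rewrite ltr_pdivlMr// mul1r.
have H3 n : q ^+ (2 ^ n) <= M / N.
  by rewrite ler_pdivlMr// expr_div_n mulrAC ler_pdivrMr ?exprn_gt0.
have bern n : 1 + (q - 1) *+ n <= q ^+ n.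
  elim: n => [|n IH]; first by rewrite mulr0n addr0 expr0.
  have q0 : 0 <= q by rewrite ltW// (lt_trans ltr01).
  rewrite exprS; apply: le_trans (ler_wpM2l q0 IH).
  have d0 : 0 <= (q - 1) by rewrite subr_ge0 ltW.
  have : (q - 1) *+ n <= q * ((q - 1) *+ n) by rewrite ler_peMl ?mulrn_wge0// ltW.
  by rewrite mulrS mulrDr mulr1; lra.
have [n nP] : exists n : nat, M / N < 1 + (q - 1) *+ n.
  set n := (Num.truncn (M / N / (q - 1))).+1; exists n.
  have d0 : 0 < q - 1 by rewrite subr_gt0.
  apply: (@lt_trans _ _ ((q - 1) *+ n)); last by rewrite ltrDr.
  by rewrite -mulr_natr [ltRHS]mulrC -ltr_pdivrMr// truncnS_gt.
have := H3 n; rewrite leNgt => /negP; apply; apply: (lt_le_trans nP).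
apply: (le_trans (bern n)); apply: ler_weXn2l; first exact: ltW.
by rewrite ltnW// ltn_expl.
Qed.

Section Cc_module.
Variables (R : realType) (G : topGroupoidType) (G_hausdorff : hausdorff_space G).

(** The Hausdorff property is a parameter so that the submodule structure, whose stability under
    sums relies on it, can be attached to the predicate. *)
Definition Cc_pred (_ : hausdorff_space G) : {pred (G -> R[i]^o)} :=
  fun a => `[< Cc G (a : G -> R[i]) >].

Fact Cc_submod : submod_closed (Cc_pred G_hausdorff).
Proof.
split; first by apply/asboolP; exact: (Cc0 R G_hausdorff).
by move=> k a b /asboolP Ca /asboolP Cb; apply/asboolP; exact: (Cc_lin G_hausdorff k Ca Cb).
Qed.

HB.instance Definition _ :=
  GRing.isSubmodClosed.Build R[i] (G -> R[i]^o) (Cc_pred G_hausdorff) Cc_submod.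

Record Cc_fun := CcFun { Cc_val :> G -> R[i]^o ; _ : Cc_val \in Cc_pred G_hausdorff }.

HB.instance Definition _ := [isSub for Cc_val].
HB.instance Definition _ := [Choice of Cc_fun by <:].
HB.instance Definition _ := [SubChoice_isSubLmodule of Cc_fun by <:].

Lemma Cc_valP (a : Cc_fun) : Cc G (a : G -> R[i]).
Proof. by have /asboolP := valP a. Qed.

Definition Cc_mk (a : G -> R[i]) (Ca : Cc G a) : Cc_fun :=
  @CcFun a (introT (asboolP _) Ca).

Lemma Cc_val_lin k (a b : Cc_fun) :
  (k *: a + b : Cc_fun) = (fun x => k * a x + b x) :> (G -> R[i]).
Proof. by []. Qed.

End Cc_module.

Section gns.
Variables (R : realType) (G : topGroupoidType).
Hypothesis (G_hausdorff : hausdorff_space G) (G_lc : locally_compact [set: G]).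
Hypothesis (G_sc : @second_countable G).
Variable lam : G -> {measure set (borel G) -> \bar R}.
Hypothesis lam_haar : is_haar_system lam.
Variable phi : (G -> R[i]) -> R[i].
Hypothesis phi_lin : forall k a b, Cc G a -> Cc G b ->
  phi (fun x => k * a x + b x) = k * phi a + phi b.
Hypothesis phi_bound : forall a, Cc G a -> cabs (phi a) <= fine (Inorm lam a).
Hypothesis phi_conj : forall a, Cc G a -> phi (invol a) = (phi a)^*%C.
Hypothesis phi_pos : forall a, Cc G a -> 0 <= phi (conv lam (invol a) a).
Implicit Types (a b : G -> R[i]).

Local Notation V := (Cc_fun R G_hausdorff).
Implicit Types (v w : V).

Let Cconv a b (Ca : Cc G a) (Cb : Cc G b) : Cc G (conv lam a b) :=
  conv_Cc G_hausdorff G_lc lam_haar Ca Cb.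
Let Cinv a (Ca : Cc G a) : Cc G (invol a) := Cc_invol G_hausdorff Ca.
Let assoc a b d (Ca : Cc G a) (Cb : Cc G b) (Cd : Cc G d) :=
  convA G_hausdorff G_lc G_sc lam_haar Ca Cb Cd.
Let invM a b (Ca : Cc G a) (Cb : Cc G b) :=
  invol_conv G_hausdorff G_lc G_sc lam_haar Ca Cb.

Definition gns_form (v w : V) : R[i] := phi (conv lam (invol w) v).

Lemma gns_lin k u v w : gns_form (k *: u + v) w = k * gns_form u w + gns_form v w.
Proof.
have Cw := Cinv (Cc_valP w); have Cu := Cc_valP u; have Cv := Cc_valP v.
rewrite /gns_form Cc_val_lin (conv_linr G_hausdorff lam_haar k Cw Cu.1 Cv.1).
exact: (phi_lin k (Cconv Cw Cu) (Cconv Cw Cv)).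
Qed.

Lemma gns_conj v w : gns_form w v = (gns_form v w)^*%C.
Proof.
have Cw := Cc_valP w; have Cv := Cc_valP v.
rewrite /gns_form -(phi_conj (Cconv (Cinv Cw) Cv)).
by rewrite (invM (Cinv Cw) Cv) involK.
Qed.

Lemma gns_pos v : 0 <= gns_form v v.
Proof. exact: (phi_pos (Cc_valP v)). Qed.

Definition gns_inner := SemiInner gns_lin gns_conj gns_pos.

Definition gns_mul a (Ca : Cc G a) (v : V) : V :=
  Cc_mk G_hausdorff (Cconv Ca (Cc_valP v)).

Lemma gns_mul_linear a (Ca : Cc G a) : linear (gns_mul Ca).
Proof.
move=> k u v; apply/val_inj.
exact: (conv_linr G_hausdorff lam_haar k Ca (Cc_valP u).1 (Cc_valP v).1).
Qed.

Lemma gns_adjoint a (Ca : Cc G a) v w :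
  gns_form (gns_mul Ca v) w = gns_form v (gns_mul (Cinv Ca) w).
Proof.
have Cw := Cc_valP w; have Cv := Cc_valP v.
rewrite /gns_form /= (invM (Cinv Ca) Cw) involK.
by rewrite (assoc (Cinv Cw) Ca Cv).
Qed.

Lemma gns_mulM a b (Ca : Cc G a) (Cb : Cc G b) v :
  gns_mul Ca (gns_mul Cb v) = gns_mul (Cconv Ca Cb) v.
Proof. by apply/val_inj; rewrite /= (assoc Ca Cb (Cc_valP v)). Qed.

(** [gns_mul] carries a proof about its function, which blocks rewriting of that function; this
    congruence stands in for it. *)
Lemma gns_mul_eq a b (Ca : Cc G a) (Cb : Cc G b) v :
  a = b -> gns_mul Ca v = gns_mul Cb v.
Proof. by move=> ab; apply/val_inj; rewrite /= ab. Qed.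

Let I a : R := fine (Inorm lam a).

Let IE a : Cc G a -> ((I a)%:E = Inorm lam a)%E.
Proof. by move=> Ca; rewrite fineK//; exact: (Inorm_fin_num G_hausdorff lam_haar Ca). Qed.

Let I0 a : Cc G a -> 0 <= I a.
Proof. by move=> Ca; rewrite -lee_fin IE//; exact: (Inorm_ge0 G_hausdorff lam Ca). Qed.

Let IM a b : Cc G a -> Cc G b -> I (conv lam a b) <= I a * I b.
Proof.
move=> Ca Cb; rewrite -lee_fin EFinM !IE//; last exact: (Cconv Ca Cb).
exact: (Inorm_conv G_hausdorff G_lc G_sc lam_haar Ca Cb).
Qed.

Let II a : Cc G a -> I (invol a) = I a.
Proof. by move=> Ca; rewrite /I (Inorm_invol G_hausdorff lam Ca). Qed.

Local Notation sn := (seminorm gns_form).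

Let sq v : gns_form v v = (sn v ^+ 2)%:C := form_sqr gns_pos v.

(* With [h = a^* a], iterating the Cauchy-Schwarz inequality on [h, h^2, h^4, ...]
   replaces the crude constant in [|(h v | v)| <= |h|_I |v|_I^2] by [(v | v)]. *)
Lemma gns_mul_bound a (Ca : Cc G a) v : sn (gns_mul Ca v) <= I a * sn v.
Proof.
have Cv := Cc_valP v.
have [v0|v0] := eqVneq (sn v) 0.
  have := cauchy_schwarz gns_lin gns_conj gns_pos v (gns_mul (Cinv Ca) (gns_mul Ca v)).
  rewrite v0 mul0r -gns_adjoint sq cabs_real ger0_norm ?sqr_ge0// => h.
  rewrite mulr0 -(@ler_pXn2r _ 2)// ?nnegrE ?seminorm_ge0//.
  by rewrite (le_trans h)// expr0n.
have vp : 0 < sn v by rewrite lt_def v0 seminorm_ge0.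
pose h := conv lam (invol a) a.
have Ch : Cc G h := Cconv (Cinv Ca) Ca.
have hh : invol h = h by rewrite /h (invM (Cinv Ca) Ca) involK.
pose s n := iter n (fun b => conv lam b b) h.
have Cs n : Cc G (s n) by elim: n => //= n Cn; exact: (Cconv Cn Cn).
have ss n : invol (s n) = s n by elim: n => //= n IH; rewrite (invM (Cs n) (Cs n)) IH.
pose t n := cabs (gns_form (gns_mul (Cs n) v) v).
have E : sn (gns_mul Ca v) ^+ 2 = t 0%N.
  rewrite /t (gns_mul_eq (Cs 0%N) (Cconv (Cinv Ca) Ca) v erefl) -gns_mulM gns_adjoint.
  rewrite (gns_mul_eq (Cinv (Cinv Ca)) Ca v (involK a)).
  by rewrite sq cabs_real ger0_norm ?sqr_ge0.
suff : t 0%N <= I h * sn v ^+ 2.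
  move=> H; rewrite -(@ler_pXn2r _ 2)// ?nnegrE ?mulr_ge0 ?seminorm_ge0 ?I0//.
  rewrite E exprMn (le_trans H)// ler_wpM2r ?sqr_ge0//.
  by rewrite (le_trans (IM (Cinv Ca) Ca))// II// expr2.
apply: (@iterated_square_bound R t _ _ (I v * I v)).
- by rewrite exprn_gt0.
- exact: I0.
- by move=> n; exact: cabs_ge0.
- move=> n; have -> : t n.+1 = sn (gns_mul (Cs n) v) ^+ 2.
    rewrite /t (gns_mul_eq (Cs n.+1) (Cconv (Cs n) (Cs n)) v erefl) -gns_mulM.
    rewrite gns_adjoint (gns_mul_eq (Cinv (Cs n)) (Cs n) v (ss n)).
    by rewrite sq cabs_real ger0_norm ?sqr_ge0.
  rewrite -exprMn ler_pXn2r// ?nnegrE ?mulr_ge0 ?seminorm_ge0 ?cabs_ge0//.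
  exact: (cauchy_schwarz gns_lin gns_conj gns_pos).
- have Is n : I (s n) <= I h ^+ (2 ^ n).
    elim: n => [|n IH]; first by rewrite expn0 expr1.
    rewrite expnS mulnC exprM expr2 /= (le_trans (IM (Cs n) (Cs n)))//.
    by apply: ler_pM => //; exact: (I0 (Cs n)).
  move=> n; rewrite /t /gns_form /= (le_trans (phi_bound (Cconv (Cinv Cv) (Cconv (Cs n) Cv))))//.
  rewrite (le_trans (IM (Cinv Cv) (Cconv (Cs n) Cv)))// II//.
  rewrite mulrCA ler_wpM2l ?(I0 Cv)// (le_trans (IM (Cs n) Cv))//.
  by rewrite ler_wpM2r ?(I0 Cv).
Qed.

(** [Cc] has no unit, so [phi] is not realized by a vector; the vectors [iota a], for all [a] in
    [Cc], take the place of the orbit of a cyclic vector. *)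
Lemma gns : exists (H : hilbertSpace R) (pi : (G -> R[i]) -> H -> H)
    (iota : (G -> R[i]) -> H),
  [/\ is_star_rep lam pi,
      forall b, Cc G b -> (opnorm (pi b) <= Inorm lam b)%E,
      forall a b, Cc G a -> Cc G b ->
        inner (iota a) (iota b) = phi (conv lam (invol b) a) &
      forall a b, Cc G a -> Cc G b -> pi a (iota b) = iota (conv lam a b)].
Proof.
have [H [iota [ilin iiota sep idense ops]]] := hilbert_completion gns_inner.
(* Quantifying over the proof of [Cc G a] inside the existential lets [choice] return one total
   function [pi], with the identity as default off [Cc]. *)
have P a : exists T : H -> H, forall Ca : Cc G a,
    (forall F v, inner (T F) (iota v) = inner F (iota (gns_mul (Cinv Ca) v))) /\
    (forall F, rnorm (T F) <= I a * rnorm F).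
  have [Ca|nCa] := pselect (Cc G a); last by exists id.
  have [T TP] := ops (gns_mul Ca) (gns_mul (Cinv Ca)) (I a) (gns_mul_linear Ca)
    (I0 Ca) (gns_adjoint Ca) (gns_mul_bound Ca).
  by exists T => Ca'; rewrite (Prop_irrelevance Ca' Ca).
have [pi piP] := choice P.
have pE a (Ca : Cc G a) F v :
    inner (pi a F) (iota v) = inner F (iota (gns_mul (Cinv Ca) v)).
  by have [] := piP a Ca.
have pN a (Ca : Cc G a) F : rnorm (pi a F) <= I a * rnorm F.
  by have [] := piP a Ca.
have pI a (Ca : Cc G a) v : pi a (iota v) = iota (gns_mul Ca v).
  by apply: sep => w; rewrite (pE a Ca) !iiota /= gns_adjoint.
have pO a (Ca : Cc G a) : (opnorm (pi a) <= Inorm lam a)%E.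
  by rewrite -(IE Ca); apply: opnorm_le; [exact: I0|exact: pN].
have plin a (Ca : Cc G a) : linear (pi a).
  by move=> k F K; apply: sep => v; rewrite inner_linear !(pE a Ca) inner_linear.
pose i a := iota (if pselect (Cc G a) is left Ca then Cc_mk G_hausdorff Ca else 0).
have iE a (Ca : Cc G a) : i a = iota (Cc_mk G_hausdorff Ca).
  by rewrite /i; case: pselect => // Ca'; congr iota; apply/val_inj.
exists H, pi, i; split.
- split.
  + exact: plin.
  + move=> a Ca; apply: (le_lt_trans (pO a Ca)).
    exact: (Inorm_lty G_hausdorff lam_haar Ca).
  + move=> k a b Ca Cb F; apply: sep => v.
    have Cab := Cc_lin G_hausdorff k Ca Cb.
    rewrite inner_linear (pE _ Cab) (pE _ Ca) (pE _ Cb).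
    have -> : gns_mul (Cinv Cab) v =
        k^*%C *: gns_mul (Cinv Ca) v + gns_mul (Cinv Cb) v.
      apply/val_inj; rewrite /= invol_lin.
      exact: (conv_linl G_hausdorff lam_haar _ (Cinv Ca) (Cinv Cb) (Cc_valP v).1).
    by rewrite ilin inner_linr conjcK.
  + move=> a b Ca Cb F; apply: sep => v.
    rewrite (pE _ (Cconv Ca Cb)) (pE _ Ca) (pE _ Cb) gns_mulM.
    by congr (inner _ (iota _)); apply: gns_mul_eq; rewrite (invM Ca Cb).
  (* The relation is known for [F] in the range of [iota]; both sides are bounded in [F], so density
     extends it. The summand [1] keeps [C] positive. *)
  + move=> a Ca F K; have Ca' := Cinv Ca.
    pose C := I a * rnorm K + rnorm (pi (invol a) K) + 1.
    have C0 : 0 < C.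
      by rewrite ltr_wpDl// addr_ge0 ?rnorm_ge0// mulr_ge0 ?rnorm_ge0// I0.
    apply/eqP; rewrite -subr_eq0; apply/eqP/cabs_eq0/eqP.
    rewrite eq_le cabs_ge0 andbT; apply/ler_addgt0Pr => e e0; rewrite add0r.
    have [v Fv] := idense F _ (divr_gt0 e0 C0).
    have E : inner (pi a (iota v)) K = inner (iota v) (pi (invol a) K).
      rewrite [RHS]inner_conj (pE _ Ca') [LHS]inner_conj (pI _ Ca).
      by congr (_^*%C); congr (inner _ (iota _)); apply: gns_mul_eq; rewrite involK.
    have -> : inner (pi a F) K - inner F (pi (invol a) K) =
        inner (pi a (F - iota v)) K - inner (F - iota v) (pi (invol a) K).
      have -> : pi a (F - iota v) = pi a F - pi a (iota v).
        by have := plin a Ca (-1) (iota v) F; rewrite !scaleN1r (addrC _ F) (addrC _ (pi a F)).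
      by rewrite !innerBl E; ring.
    rewrite (le_trans (cabsD _ _))// cabsN.
    apply: (@le_trans _ _ (rnorm (F - iota v) * C)); last first.
      by rewrite -ler_pdivlMr// ltW.
    rewrite /C mulrDr mulr1 ler_wpDr ?rnorm_ge0// mulrDr lerD//.
      rewrite (le_trans (inner_cauchy_schwarz _ _))// mulrCA mulrA.
      by rewrite ler_wpM2r ?rnorm_ge0// (le_trans (pN _ Ca _))// mulrC.
    exact: inner_cauchy_schwarz.
- exact: pO.
- by move=> a b Ca Cb; rewrite (iE a Ca) (iE b Cb) iiota.
- move=> a b Ca Cb; rewrite (iE _ Cb) (pI _ Ca) (iE _ (Cconv Ca Cb)).
  by congr iota; apply/val_inj.
Qed.

End gns.

(** * The full norm *)

Section full_norm.
Variables (R : realType) (G : topGroupoidType).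
Hypothesis (G_hausdorff : hausdorff_space G) (G_lc : locally_compact [set: G]).
Hypothesis (G_sc : @second_countable G).
Variable lam : G -> {measure set (borel G) -> \bar R}.
Hypothesis lam_haar : is_haar_system lam.
Variables (Gam : groupType) (c : contHom G Gam).
Local Notation Ge := (kergrp c).
Local Notation lame := (haar_restr lam : Ge -> {measure set (borel Ge) -> \bar R}).
Local Notation ext := (@ker_extend R G Gam c).
Local Notation res := (@ker_restrict R G Gam c).
Implicit Types (a b : G -> R[i]) (f g : Ge -> R[i]).

Let Cext f (Cf : Cc Ge f) : Cc G (ext f) := ker_extend_Cc G_hausdorff Cf.
Let Cres a (Ca : Cc G a) : Cc Ge (res a) := Cc_restrict G_hausdorff c Ca.

Lemma Cc_ker_invol f : Cc Ge f -> Cc Ge (invol f).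
Proof. exact: (Cc_invol (@ker_hausdorff G G_hausdorff Gam c)). Qed.

Lemma Cc_ker_conv f g : Cc Ge f -> Cc Ge g -> Cc Ge (conv lame f g).
Proof.
move=> Cf Cg; rewrite -(ker_extendK (conv lame f g)) (ext_conv G_hausdorff lam Cf Cg).
exact: (Cres (conv_Cc G_hausdorff G_lc lam_haar (Cext Cf) (Cext Cg))).
Qed.

(** A representation pulled back along [ext] is still I-norm decreasing, by [Inorm_ext]. *)
Lemma full_norm_ext_le f : Cc Ge f -> (full_norm lam (ext f) <= full_norm lame f)%E.
Proof.
move=> Cf; apply: ge_ereal_sup => _ [H [pi [[pl pb ps pc pv] pI ->]]].
apply: ereal_sup_ubound; exists H, (fun g => pi (ext g)); split=> //; last first.
  move=> g Cg; apply: (le_trans (pI _ (Cext Cg))).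
  exact: (Inorm_ext G_hausdorff lam Cg).
split.
- by move=> g Cg; exact: (pl _ (Cext Cg)).
- by move=> g Cg; exact: (pb _ (Cext Cg)).
- by move=> k g g' Cg Cg' h; rewrite ext_lin; exact: (ps k _ _ (Cext Cg) (Cext Cg')).
- move=> g g' Cg Cg' h; rewrite (ext_conv G_hausdorff lam Cg Cg').
  exact: (pc _ _ (Cext Cg) (Cext Cg')).
- by move=> g Cg h k; rewrite ext_invol; exact: (pv _ (Cext Cg)).
Qed.

Section vector_state.
Variables (H : hilbertSpace R) (pi : (Ge -> R[i]) -> H -> H).
Hypothesis pi_rep : is_star_rep lame pi.
Hypothesis pi_I : forall g, Cc Ge g -> (opnorm (pi g) <= Inorm lame g)%E.
Variable k : H.
Hypothesis k1 : rnorm k <= 1.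

Let phi a : R[i] := inner (pi (res a) k) k.

Let phi_lin (t : R[i]) a b : Cc G a -> Cc G b ->
  phi (fun x => t * a x + b x) = t * phi a + phi b.
Proof.
move=> Ca Cb; rewrite /phi -inner_linear; congr (inner _ _).
exact: (rep_scale_add pi_rep t (Cres Ca) (Cres Cb)).
Qed.

Let phi_bound a : Cc G a -> cabs (phi a) <= fine (Inorm lam a).
Proof.
move=> Ca; rewrite -lee_fin fineK; last exact: (Inorm_fin_num G_hausdorff lam_haar Ca).
apply: le_trans (Inorm_restrict G_hausdorff lam c Ca).
apply: le_trans (pi_I (Cres Ca)).
apply: le_trans (opnorm_ub (pi (res a)) k1); rewrite lee_fin.
rewrite (le_trans (inner_cauchy_schwarz _ _))//.
by rewrite ler_piMr// rnorm_ge0.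
Qed.

Let phi_conj a : Cc G a -> phi (invol a) = (phi a)^*%C.
Proof.
move=> Ca; rewrite /phi restrict_invol [in RHS](rep_invol pi_rep (Cres Ca)).
exact: inner_conj.
Qed.

Let phi_ext f g : Cc Ge f -> Cc Ge g ->
  phi (conv lam (invol (ext g)) (ext f)) = inner (pi f k) (pi g k).
Proof.
move=> Cf Cg; have Cg' := Cc_ker_invol Cg.
rewrite -ext_invol -(ext_conv G_hausdorff lam Cg' Cf) /phi ker_extendK.
by rewrite (rep_conv pi_rep Cg' Cf) (rep_invol pi_rep Cg') involK.
Qed.

Let phi_pos b : Cc G b -> (forall x, ~ kerset c x -> b x = 0) ->
  0 <= phi (conv lam (invol b) b).
Proof.
move=> Cb bk; rewrite -(ker_restrictK bk) phi_ext; try exact: (Cres Cb).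
exact: inner_ge0.
Qed.

(* In the GNS representation of G for [phi], the vectors attached to [ext g] have the
   norm of [pi g k], so [ext f] maps a vector of norm [N = |pi f^* k|] to one of
   norm [|pi f (pi f^* k)|], which is at least [N ^+ 2]. *)
Lemma rep_vector_bound f : Cc Ge f ->
  ((rnorm (pi (invol f) k))%:E <= full_norm lam (ext f))%E.
Proof.
move=> Cf; have Cf' := Cc_ker_invol Cf.
have phi_ker a b : Cc G a -> Cc G b -> (forall x, kerset c x -> a x = b x) ->
    phi a = phi b.
  move=> Ca Cb ab; rewrite /phi (_ : res a = res b)//.
  by apply/funext => x; apply: ab; exact: kerset_val.
have pos := @kernel_positive R G G_hausdorff G_lc G_sc lam lam_haar Gam c phi
  phi_lin phi_bound phi_ker phi_pos.
have [H' [pi' [iota [rep' I' iI ip]]]] :=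
  gns G_hausdorff G_lc G_sc lam_haar phi_lin phi_bound phi_conj pos.
have iE g : Cc Ge g -> rnorm (iota (ext g)) = rnorm (pi g k).
  move=> Cg; apply/eqP; rewrite -(@eqrXn2 _ 2)// ?rnorm_ge0//; apply/eqP/complexI.
  by rewrite -!inner_rnorm (iI _ _ (Cext Cg) (Cext Cg)) phi_ext.
have le1 : (opnorm (pi' (ext f)) <= full_norm lam (ext f))%E.
  by apply: ereal_sup_ubound; exists H', pi'.
apply: le_trans le1; have ob := rep_bounded rep' (Cext Cf).
have o0 : (0 <= opnorm (pi' (ext f)))%E.
  apply: le_trans (opnorm_ub _ (x := 0) _); last by rewrite rnorm0.
  by rewrite lee_fin rnorm_ge0.
have ofin : opnorm (pi' (ext f)) \is a fin_num by rewrite ge0_fin_numE.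
set C := fine (opnorm (pi' (ext f))).
have CE : (C%:E = opnorm (pi' (ext f)))%E by rewrite fineK.
have C0 : 0 <= C by rewrite -lee_fin CE.
rewrite -CE lee_fin.
have oC : (opnorm (pi' (ext f)) <= C%:E)%E by rewrite CE.
have := rnorm_opnorm (iota (ext (invol f))) (rep_linear rep' (Cext Cf)) C0 oC.
rewrite (ip _ _ (Cext Cf) (Cext Cf')) -(ext_conv G_hausdorff lam Cf Cf').
rewrite (iE _ (Cc_ker_conv Cf Cf')) (iE _ Cf') => le2.
set N := rnorm (pi (invol f) k) in le2 *.
have N0 : 0 <= N by exact: rnorm_ge0.
have N2 : N ^+ 2 <= C * N.
  apply: le_trans le2.
  have -> : N ^+ 2 = cabs (inner (pi (conv lame f (invol f)) k) k).
    rewrite (rep_conv pi_rep Cf Cf') (rep_invol pi_rep Cf) inner_rnorm.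
    by rewrite cabs_real ger0_norm// sqr_ge0.
  rewrite (le_trans (inner_cauchy_schwarz _ _))// ler_piMr// rnorm_ge0//.
have [->//|Nn] := eqVneq N 0.
by move: N2; rewrite expr2 ler_pM2r// lt_def Nn.
Qed.

End vector_state.

(** [rep_vector_bound] controls [pi (invol f)] on unit vectors, hence the involution on the left;
    the isometry of the star in the completion removes it. *)
Lemma full_norm_invol_le f : Cc Ge f ->
  (full_norm lame (invol f) <= full_norm lam (ext f))%E.
Proof.
move=> Cf; apply: ge_ereal_sup => _ [H [pi [rep pI ->]]].
by apply: ge_ereal_sup => _ [k k1 <-]; exact: (rep_vector_bound rep pI k1 Cf).
Qed.

End full_norm.

(** * The reduced norm *)

Lemma measurable_within_borel (T T' : ptopologicalType) (D : set T) (f : T -> T') :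
  {within D, continuous f} ->
  measurable_fun (D : set (borel T)) (f : borel T -> borel T').
Proof.
move=> /continuousP cf mD.
apply: (@measurability _ _ (borel T) (borel T') D f (@open T')) => //.
move=> _ [U oU <-]; have /open_subspaceP[V oV VD] := cf _ oU.
rewrite setIC -VD; apply: measurableI => //; exact: sub_sigma_algebra.
Qed.

Lemma cmeasurable_comp (R : realType) d1 d2 (T1 : measurableType d1)
    (T2 : measurableType d2) (D : set T1) (E : set T2) (h : T2 -> R[i]) (f : T1 -> T2) :
  measurable E -> cmeasurable E h -> (forall x, D x -> E (f x)) ->
  measurable_fun D f -> cmeasurable D (h \o f).
Proof.
move=> mE [hr hi] DE mf; have fDE : f @` D `<=` E by move=> _ [x Dx <-]; exact: DE.
by split; [exact: (measurable_comp mE fDE hr mf)|exact: (measurable_comp mE fDE hi mf)].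
Qed.

Lemma eq_cmeasurable (R : realType) d (T : measurableType d) (D : set T)
    (f g : T -> R[i]) : (forall x, D x -> f x = g x) -> cmeasurable D f -> cmeasurable D g.
Proof.
move=> fg [mr mi]; split.
  by apply: eq_measurable_fun mr => x; rewrite inE => /fg ->.
by apply: eq_measurable_fun mi => x; rewrite inE => /fg ->.
Qed.

(* Integrability is not needed: for [0 < t] the junk value [0] occurs on both sides. *)
Lemma Rintegral_scale (R : realType) d (T : measurableType d)
    (mu : {measure set T -> \bar R}) (D : set T) (f : T -> R) (t : R) :
  measurable D -> measurable_fun D f -> 0 < t ->
  \int[mu]_(x in D) (t * f x) = t * \int[mu]_(x in D) f x.
Proof.
move=> mD /measurable_EFinP mf t0; rewrite /Rintegral.
have E : (\int[mu]_(x in D) (t * f x)%:E = t%:E * \int[mu]_(x in D) (f x)%:E)%E.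
  rewrite integralE [X in (_ * X)%E]integralE.
  have -> : (fun x => (t * f x)%:E) = (fun x => t%:E * (EFin \o f) x)%E.
    by apply/funext => x; rewrite EFinM.
  rewrite (ge0_funeposM (EFin \o f) (ltW t0)) (ge0_funenegM (EFin \o f) (ltW t0)).
  rewrite ge0_integralZl ?lee_fin ?ltW//; last exact: measurable_funepos.
  rewrite ge0_integralZl ?lee_fin ?ltW//; last exact: measurable_funeneg.
  have A0 : (0 <= \int[mu]_(x in D) (EFin \o f)^\+ x)%E by exact: integral_ge0.
  have B0 : (0 <= \int[mu]_(x in D) (EFin \o f)^\- x)%E by exact: integral_ge0.
  move: (integral _ _ _) (integral _ _ _) A0 B0 => A B.
  case: A => [a| |] //; case: B => [b| |] // _ _.
  - by rewrite -!EFinM -!EFinB mulrBr.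
  - by rewrite addye// gt0_muley ?lte_fin// -EFinM addye.
  - by rewrite addeNy gt0_muley ?gt0_muleNy ?lte_fin// addeNy.
  - by rewrite addeNy gt0_muley ?gt0_muleNy ?lte_fin// addeNy.
rewrite E; case: (\int[mu]_(x in D) (f x)%:E)%E => [r| |] //=.
  by rewrite gt0_muley ?lte_fin//= mulr0.
by rewrite gt0_muleNy ?lte_fin//= mulr0.
Qed.

(** * Convolution of a continuous function with a measurable one *)

Section measurable_convolution.
Variables (R : realType) (G : topGroupoidType).
Hypothesis (G_hausdorff : hausdorff_space G) (G_lc : locally_compact [set: G]).
Hypothesis (G_sc : @second_countable G).
Variable lam : G -> {measure set (borel G) -> \bar R}.
Hypothesis lam_haar : is_haar_system lam.
Implicit Types (a b h : G -> R[i]) (x y z u : G).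

Let mrf u : measurable (rfiber u : set (borel G)).
Proof. exact: measurable_rfiber. Qed.

Lemma measurable_sfiber u : measurable (sfiber u : set (borel G)).
Proof.
have -> : sfiber u = (ginv : borel G -> borel G) @^-1` rfiber u.
  by apply/seteqP; split=> x; rewrite /rfiber /sfiber /= rng_ginv.
rewrite -[X in measurable X]setTI; exact: (@measurable_ginv G measurableT _ (mrf u)).
Qed.

Let msf u : measurable (sfiber u : set (borel G)) := measurable_sfiber u.

Lemma conv_integrand_measurable a h x : continuous (a : G -> R[i]^o) ->
  cmeasurable (sfiber (src x) : set (borel G)) (h : borel G -> R[i]) ->
  cmeasurable (rfiber (rng x) : set (borel G))
    ((fun y => a y * h (gmul (ginv y) x)) : borel G -> R[i]).
Proof.
move=> ca mh; apply: cmeasurableM => //.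
  exact: (cmeasurable_within (continuous_subspaceT ca)).
have mf := measurable_within_borel (@inv_mul_continuous G x).
have D y : rfiber (rng x) y -> sfiber (src x) (gmul (ginv y) x).
  by move=> yx; rewrite /sfiber /= src_inv_mul.
exact: (@cmeasurable_comp R _ _ (borel G) (borel G) _ _ h _ (msf (src x)) mh D mf).
Qed.

(** After the substitution [y = x w] the measure and the fiber are the same for all [x] with a given
    source, so measurability in [x] becomes that of an integral with a parameter. *)
Lemma conv_fiber a h x : continuous (a : G -> R[i]^o) ->
  cmeasurable (sfiber (src x) : set (borel G)) (h : borel G -> R[i]) ->
  conv lam a h x =
  cintegral (lam (src x)) (rfiber (src x)) (fun w => a (gmul x w) * h (ginv w)).
Proof.
move=> ca mh; rewrite /conv.
rewrite -(haar_invariant_complex G_hausdorff G_lc G_sc lam_haar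
  (conv_integrand_measurable ca mh)).
apply: eq_cintegral => w wx; have wx' : src x = rng w by [].
by rewrite ginv_gmul// -gmulA ?src_ginv ?rng_ginv// gmulVx wx' -src_ginv gmul_src.
Qed.

(** The integrals may diverge for some [x]. Tonelli's theorem treats the positive and negative parts
    separately, and [fine] of their difference is measurable whatever values it takes. *)
Lemma conv_measurable a h u : unit_space G u -> continuous (a : G -> R[i]^o) ->
  cmeasurable (sfiber u : set (borel G)) (h : borel G -> R[i]) ->
  cmeasurable (sfiber u : set (borel G)) (conv lam a h : borel G -> R[i]).
Proof.
move=> uu ca mh.
pose F (p : G * G) : R[i] := a (gmul (ginv p.1) p.2) * h (ginv p.2).
have mF : cmeasurable (rfiber u `*` rfiber u : set (borel G * borel G)%type)
    (F : (borel G * borel G)%type -> R[i]).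
  apply: cmeasurableM.
    have c1 : continuous ((fun=> 1) : G -> R[i]^o) by move=> ?; exact: cvg_cst.
    have mS := measurable_prod_within G_sc (@shear_continuous R G u _ _ c1 ca).
    have mSs : cmeasurable (rfiber u `*` rfiber u : set (borel G * borel G)%type)
        ((fun p : G * G => 1 * a (gmul (ginv p.2) p.1)) \o (fun p : (borel G * borel G)%type => (p.2, p.1))).
      apply: (cmeasurable_comp _ mS); first exact: measurableX.
        by move=> [y z] [].
      exact: measurable_funTS (@measurable_swap _ _ (borel G) (borel G)).
    by apply: eq_cmeasurable mSs => p _; rewrite /= mul1r.
  have mg : measurable_fun (rfiber u `*` rfiber u : set (borel G * borel G)%type)
      (fun p : (borel G * borel G)%type => ginv p.2 : borel G).
    apply: (measurableT_comp (@measurable_ginv G)).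
    exact: measurable_funTS (@measurable_snd _ _ _ _).
  have D (p : (borel G * borel G)%type) : (rfiber u `*` rfiber u) p -> sfiber u (ginv p.2).
    by move=> [_ /= pu]; rewrite /sfiber /= src_ginv.
  exact: (@cmeasurable_comp R _ _ _ (borel G) _ _ h _ (msf u) mh D mg).
have sf := lam_sigma_finite G_hausdorff G_lc G_sc lam_haar uu.
have mI (K : (borel G * borel G)%type -> R) :
    measurable_fun (rfiber u `*` rfiber u : set (borel G * borel G)%type) K ->
    measurable_fun (rfiber u : set (borel G))
      (fun t : borel G => \int[lam u]_(w in rfiber u) K (t, w)).
  move=> /measurable_EFinP mK.
  have -> : (fun t : borel G => \int[lam u]_(w in rfiber u) K (t, w)) =
      fine \o (fun t : borel G => (\int[lam u]_(w in rfiber u) (EFin \o K)^\+ (t, w)) -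
        (\int[lam u]_(w in rfiber u) (EFin \o K)^\- (t, w)))%E.
    apply/funext => t; rewrite /Rintegral integralE /=; congr (fine (_ - _)%E).
      by apply: eq_integral => w _; rewrite !funeposE.
    by apply: eq_integral => w _; rewrite !funenegE.
  apply: measurableT_comp => //; apply: emeasurable_funB.
    exact: (measurable_tonelli_on sf (mrf u) (mrf u) (measurable_funepos mK)
      (fun p => funepos_ge0 (EFin \o K) p)).
  exact: (measurable_tonelli_on sf (mrf u) (mrf u) (measurable_funeneg mK)
      (fun p => funeneg_ge0 (EFin \o K) p)).
pose J (t : G) : R[i] := cintegral (lam u) (rfiber u) (fun w => F (t, w)).
have mJ : cmeasurable (rfiber u : set (borel G)) (J : borel G -> R[i]).
  by case: mF => mr mi; split; [exact: (mI _ mr)|exact: (mI _ mi)].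
apply: (@eq_cmeasurable _ _ (borel G) _ (J \o (ginv : borel G -> borel G))).
  move=> x xu; rewrite conv_fiber; [|exact: ca|by rewrite (xu : src x = u)].
  by rewrite /J /F /= ginvK (xu : src x = u).
apply: (cmeasurable_comp _ mJ); first exact: mrf.
  by move=> x xu; rewrite /rfiber /= rng_ginv.
exact: measurable_funTS (@measurable_ginv G).
Qed.

(** Linearity in [h] could fail where the convolution diverges; positive real scalars pass through
    by [Rintegral_scale], and normalization of vectors asks for no others. *)
Lemma conv_scale a h (t : R) x : 0 < t -> continuous (a : G -> R[i]^o) ->
  cmeasurable (sfiber (src x) : set (borel G)) (h : borel G -> R[i]) ->
  conv lam a (fun y => t%:C * h y) x = t%:C * conv lam a h x.
Proof.
move=> t0 ca mh; have [mr mi] := conv_integrand_measurable ca mh.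
rewrite /conv /cintegral; apply/eqP; rewrite eq_complex /= !mul0r subr0 addr0.
have E y : a y * (t%:C * h (gmul (ginv y) x)) = t%:C * (a y * h (gmul (ginv y) x)).
  by rewrite mulrCA.
have ER (z : R[i]) : complex.Re (t%:C * z) = t * complex.Re z.
  by case: z => p q; simpc.
have EI (z : R[i]) : complex.Im (t%:C * z) = t * complex.Im z.
  by case: z => p q; simpc.
under eq_Rintegral do rewrite E ER.
under [X in _ && (X == _)]eq_Rintegral do rewrite E EI.
by rewrite !Rintegral_scale// !eqxx.
Qed.

Lemma ge0_integral_inv u (D : set G) (F : G -> \bar R) :
  measurable (D : set (borel G)) ->
  measurable_fun (D : set (borel G)) (F : borel G -> \bar R) ->
  (forall x, 0 <= F x)%E ->
  (\int[haar_inv lam u]_(x in D) F x = \int[lam u]_(x in ginv @^-1` D) F (ginv x))%E.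
Proof.
move=> mD mF F0.
pose pm : {measure set (borel G) -> \bar R} :=
  pushforward (lam u) (ginv : borel G -> borel G).
pose mu := pm (@measurable_ginv G).
rewrite (@eq_measure_integral _ _ _ _ mu)//.
by rewrite /mu /pm (ge0_integral_pushforward (@measurable_ginv G)).
Qed.

End measurable_convolution.

Section L2_norm.
Variables (R : realType) (d : measure_display) (T : measurableType d).
Variables (mu : {measure set T -> \bar R}) (D : set T) (h : T -> R[i]).

Definition L2sq : \bar R := \int[mu]_(x in D) ((cabs (h x)) ^+ 2)%:E.

Lemma L2sq_ge0 : (0 <= L2sq)%E.
Proof. by apply: integral_ge0 => x _; rewrite lee_fin sqr_ge0. Qed.

Lemma L2normE : L2norm mu D h = (L2sq `^ 2^-1)%E.
Proof. by []. Qed.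

Lemma L2sqE : L2sq = (L2norm mu D h `^ 2)%E.
Proof.
by rewrite L2normE -poweRrM mulVf ?poweRe1// ?L2sq_ge0// pnatr_eq0.
Qed.

Lemma L2norm_le (M : R) : 0 <= M ->
  (L2norm mu D h <= M%:E)%E = (L2sq <= (M ^+ 2)%:E)%E.
Proof.
move=> M0; apply/idP/idP => H.
  rewrite L2sqE -powR_mulrn// -poweR_EFin.
  by apply: gt0_ler_poweR => //; rewrite in_itv/= leey andbT ?L2normE ?poweR_ge0 ?lee_fin.
have -> : M%:E = ((M ^+ 2)%:E `^ 2^-1)%E.
  by rewrite poweR_EFin powR12_sqrt ?sqr_ge0// sqrtr_sqr ger0_norm.
rewrite L2normE; apply: gt0_ler_poweR => //.
  by rewrite in_itv/= leey andbT L2sq_ge0.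
by rewrite in_itv/= leey andbT lee_fin sqr_ge0.
Qed.

Lemma L2norm_lty : (L2norm mu D h < +oo)%E = (L2sq < +oo)%E.
Proof.
apply/idP/idP => H; last by rewrite L2normE poweR_lty.
by rewrite L2sqE poweR_lty.
Qed.

End L2_norm.

(** * Right translation from the fibers of G_e onto cosets *)

Section translation.
Variables (R : realType) (G : topGroupoidType).
Hypothesis (G_hausdorff : hausdorff_space G) (G_lc : locally_compact [set: G]).
Hypothesis (G_sc : @second_countable G).
Variable lam : G -> {measure set (borel G) -> \bar R}.
Hypothesis lam_haar : is_haar_system lam.
Variables (Gam : groupType) (c : contHom G Gam).
Local Notation Ge := (kergrp c).
Local Notation lame := (haar_restr lam : Ge -> {measure set (borel Ge) -> \bar R}).
Local Notation ext := (@ker_extend R G Gam c).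
Implicit Types (h : G -> R[i]) (f : Ge -> R[i]) (x y z u : G) (v w : Ge).

Let mrf u : measurable (rfiber u : set (borel G)).
Proof. exact: measurable_rfiber. Qed.

Let msf u : measurable (sfiber u : set (borel G)) := measurable_sfiber G_hausdorff u.

Let Ge_hausdorff : hausdorff_space Ge := @ker_hausdorff G G_hausdorff Gam c.

Definition coset (g : Gam) : set G := [set x | c x = g].

Lemma measurable_coset g : measurable (coset g : set (borel G)).
Proof.
apply: sub_sigma_algebra; have /continuousP := @hom_continuous _ _ c.
by move=> /(_ [set g]); apply; exact: discrete_open.
Qed.

Lemma translate_continuous v z : val v = rng z ->
  {within sfiber v, continuous (fun w : Ge => gmul (val w) z)}.
Proof.
move=> vz; apply: gmul_within.
- by apply: continuous_subspaceT; exact: val_ker_continuous.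
- by apply: (@continuous_subspaceT Ge G _ (fun=> z)) => w; exact: (@cvg_cst G z Ge (nbhs w)).
- by move=> w wv; rewrite -vz -(wv : src w = v).
Qed.

Lemma translate_measurable v z : val v = rng z ->
  measurable_fun (sfiber v : set (borel Ge))
    ((fun w : Ge => gmul (val w) z) : borel Ge -> borel G).
Proof. by move=> vz; exact: (measurable_within_borel (translate_continuous vz)). Qed.

Lemma translate_sfiber v z w : val v = rng z -> sfiber v w ->
  sfiber (src z) (gmul (val w) z).
Proof.
move=> vz wv; rewrite /sfiber /= src_gmul//.
by rewrite -vz -(wv : src w = v).
Qed.

(* Right translation by [z] identifies the fiber of G_e at [rng z] with the part of
   the fiber of G at [src z] lying in the coset of [z]. *)
Lemma ge0_integral_translate v z (F : G -> \bar R) : val v = rng z ->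
  measurable_fun (sfiber (src z) : set (borel G)) (F : borel G -> \bar R) ->
  (forall x, 0 <= F x)%E ->
  (\int[haar_inv lame v]_(w in sfiber v) F (gmul (val w) z) =
   \int[haar_inv lam (src z)]_(x in sfiber (src z) `&` coset (c z)) F x)%E.
Proof.
move=> vz mF F0; set u := src z in mF *.
have mFz : measurable_fun (sfiber v : set (borel Ge))
    ((fun w : Ge => F (gmul (val w) z)) : borel Ge -> \bar R).
  have sub : (fun w : Ge => gmul (val w) z) @` sfiber v `<=` sfiber u.
    by move=> _ [w wv <-]; exact: (translate_sfiber vz wv).
  exact: (@measurable_comp _ _ _ (borel Ge) (borel G) _ _ F _ _ (msf u) sub mF
    (translate_measurable vz)).
rewrite (ge0_integral_inv lame v (measurable_sfiber Ge_hausdorff v) mFz)//.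
have -> : (ginv : Ge -> Ge) @^-1` sfiber v = rfiber v.
  by apply/seteqP; split=> x; rewrite /rfiber /sfiber /= src_ginv.
have mFi : measurable_fun (rfiber (rng z) : set (borel G))
    ((fun y => F (gmul (ginv y) z)) : borel G -> \bar R).
  have sub : (fun y : G => gmul (ginv y) z) @` rfiber (rng z) `<=` sfiber u.
    by move=> _ [y yz <-]; rewrite /sfiber /= src_inv_mul.
  exact: (@measurable_comp _ _ _ (borel G) (borel G) _ _ F _ _ (msf u) sub mF
    (measurable_within_borel (@inv_mul_continuous G z))).
have mFk : measurable_fun (val @` rfiber v : set (borel G))
    ((fun y => F (gmul (ginv y) z)) : borel G -> \bar R).
  rewrite val_rfiber vz; exact: (measurable_funS (mrf (rng z)) (@subIsetl _ _ _) mFi).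
have := @ge0_integral_haar_restr R G Gam c lam v (rfiber v)
  (fun y => F (gmul (ginv y) z)) (measurable_ker_rfiber G_hausdorff v) mFk
  (fun y => F0 _).
move=> ->; rewrite val_rfiber vz.
have mc : measurable (sfiber u `&` coset (c z) : set (borel G)).
  by apply: measurableI; [exact: msf|exact: measurable_coset].
rewrite ge0_integral_inv//; last first.
  exact: (measurable_funS (msf u) (@subIsetl _ _ _) mF).
have -> : (ginv : G -> G) @^-1` (sfiber u `&` coset (c z)) =
    rfiber u `&` [set t | c (ginv t) = c z].
  by apply/seteqP; split=> x; rewrite /rfiber /sfiber /coset /= src_ginv.
rewrite integral_mkcondr [RHS]integral_mkcondr.
have mci : measurable ([set t | c (ginv t) = c z] : set (borel G)).
  rewrite -[X in measurable X]setTI.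
  exact: (@measurable_ginv G measurableT _ (measurable_coset (c z))).
set Q := [set t | c (ginv t) = c z] in mci *.
have mFp : measurable_fun (rfiber u : set (borel G))
    (((fun t => F (ginv t)) \_ Q) : borel G -> \bar R).
  have sub : (ginv : G -> G) @` rfiber u `<=` sfiber u.
    by move=> _ [y yz <-]; rewrite /sfiber /= src_ginv.
  have mFu : measurable_fun (rfiber u : set (borel G)) (F \o ginv : borel G -> \bar R).
    exact: (@measurable_comp _ _ _ (borel G) (borel G) _ _ F _ _ (msf u) sub mF
      (measurable_funTS (@measurable_ginv G))).
  apply/(measurable_restrict (D := Q : set (borel G)) _ mci (mrf u)).
  exact: (measurable_funS (mrf u) (@subIsetl _ _ _) mFu).
have Fp0 y : (0 <= ((fun t => F (ginv t)) \_ Q) y)%E.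
  by rewrite /patch; case: ifP.
have := @haar_invariant R G G_hausdorff G_lc G_sc lam lam_haar (ginv z) _ _ Fp0.
rewrite src_ginv rng_ginv => /(_ mFp) <-.
apply: eq_integral => y; rewrite inE => yz.
have zy : src (ginv z) = rng y by rewrite src_ginv.
have gE : ginv (gmul (ginv z) y) = gmul (ginv y) z by rewrite ginv_gmul// ginvK.
rewrite /patch gE.
(* After the shift by [z^-1] the condition of lying in the coset of [z] reads [c y^-1 c z = c z],
   that is, [y] is in G_e. *)
have -> : (gmul (ginv z) y \in Q) = (y \in kerset c).
  apply/idP/idP; rewrite !inE /Q /kerset /= gE hom_inv_mul//.
    move=> /(congr1 (fun t => t * (c z)^-1)%g); rewrite mulgK mulgV.
    by move=> /(congr1 (fun t => t^-1)%g); rewrite invgK invg1.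
  by move=> ->; rewrite invg1 mul1g.
by [].
Qed.

(** Convolution by [ext f] sees only [y] in G_e, and [(y^-1 w) z = y^-1 (w z)] matches the
    integrands pointwise, so the equality survives divergent integrals. *)
Lemma ker_conv_translate f h z w : Cc Ge f -> src (val w) = rng z ->
  cmeasurable (sfiber (src z) : set (borel G)) (h : borel G -> R[i]) ->
  conv lame f (fun w' => h (gmul (val w') z)) w = conv lam (ext f) h (gmul (val w) z).
Proof.
move=> Cf wz mh; have [cf _] := ker_extend_Cc G_hausdorff Cf.
set x := gmul (val w) z.
have sx : src x = src z by rewrite /x src_gmul.
have rx : rng x = rng (val w) by rewrite /x rng_gmul.
have mh' : cmeasurable (sfiber (src x) : set (borel G)) (h : borel G -> R[i]).
  by rewrite sx.
have [mr mi] := conv_integrand_measurable G_hausdorff cf mh'.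
rewrite rx in mr mi.
rewrite /conv rx -(@cintegral_mkcond R G Gam c lam); last first.
  by move=> y _ ny; rewrite (ker_extend_out f ny) mul0r.
rewrite -[rng (val w)]/(val (rng w)) -val_rfiber in mr mi *.
have sub : val @` rfiber (rng w) `<=` rfiber (val (rng w)).
  by rewrite val_rfiber; exact: subIsetl.
have E (y : Ge) : rfiber (rng w) y -> f y * h (gmul (val (gmul (ginv y) w)) z) =
    ext f (val y) * h (gmul (ginv (val y)) x).
  move=> yw; have yw' : rng (val y) = rng (val w) := congr1 val (yw : rng y = rng w).
  rewrite ker_extend_val val_ker_gmul /=; last by rewrite src_ginv.
  by rewrite /x gmulA// src_ginv.
congr (_ +i* _).
  rewrite -(@integral_haar_restr R G Gam c lam (rng w) _
    (fun y => complex.Re (ext f y * h (gmul (ginv y) x))))//.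
  - by apply: eq_Rintegral => y; rewrite inE => /E ->.
  - exact: measurable_ker_rfiber.
  - exact: (measurable_funS (mrf _) sub mr).
rewrite -(@integral_haar_restr R G Gam c lam (rng w) _
  (fun y => complex.Im (ext f y * h (gmul (ginv y) x))))//.
- by apply: eq_Rintegral => y; rewrite inE => /E ->.
- exact: measurable_ker_rfiber.
- exact: (measurable_funS (mrf _) sub mi).
Qed.

End translation.

Section reduced_norm.
Variables (R : realType) (G : topGroupoidType).
Hypothesis (G_hausdorff : hausdorff_space G) (G_lc : locally_compact [set: G]).
Hypothesis (G_sc : @second_countable G).
Variable lam : G -> {measure set (borel G) -> \bar R}.
Hypothesis lam_haar : is_haar_system lam.
Variables (Gam : groupType) (c : contHom G Gam).
Local Notation Ge := (kergrp c).
Local Notation lame := (haar_restr lam : Ge -> {measure set (borel Ge) -> \bar R}).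
Local Notation ext := (@ker_extend R G Gam c).
Implicit Types (h : G -> R[i]) (f : Ge -> R[i]) (x y z u : G) (v w : Ge).

Let msf u : measurable (sfiber u : set (borel G)) := measurable_sfiber G_hausdorff u.

Let msc u (g : Gam) : measurable (sfiber u `&` coset c g : set (borel G)).
Proof. by apply: measurableI; [exact: msf|exact: measurable_coset]. Qed.

Lemma measurable_cabs_sqr d (T : measurableType d) (D : set T) (h : T -> R[i]) :
  cmeasurable D h -> measurable_fun D (fun t => ((cabs (h t)) ^+ 2)%:E).
Proof. by move=> mh; apply/measurable_EFinP/measurable_funX/cmeasurable_cabs. Qed.

Lemma ext_measurable v (k : Ge -> R[i]) :
  cmeasurable (sfiber v : set (borel Ge)) (k : borel Ge -> R[i]) ->
  cmeasurable (sfiber (val v) : set (borel G)) (ext k : borel G -> R[i]).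
Proof.
have H (j : R[i] -> R) : j 0 = 0 ->
    measurable_fun (sfiber v : set (borel Ge)) (j \o k : borel Ge -> R) ->
    measurable_fun (sfiber (val v) : set (borel G)) (j \o ext k : borel G -> R).
  move=> j0 mk _ Y mY.
  have mkY := mk (measurable_sfiber (@ker_hausdorff G G_hausdorff Gam c) v) Y mY.
  have mI := measurable_val_image mkY.
  (* The extension is [0] off G_e, so the preimage of [Y] gains the rest of the fiber exactly when
     [0] is in [Y]. *)
  have -> : sfiber (val v) `&` (j \o ext k) @^-1` Y =
      (val @` (sfiber v `&` (j \o k) @^-1` Y)) `|`
      (if `[< Y 0 >] then sfiber (val v) `\` coset c 1%g else set0).
    apply/seteqP; split=> [x [xv xY]|x [[w [wv wY] <-]|]].
    - have [cx|cx] := pselect (kerset c x).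
        left; exists (to_ker (mem_set cx)); last by [].
        split; first exact: val_inj.
        by move: xY; rewrite /= -[X in ext k X]/(val (to_ker (mem_set cx))) ker_extend_val.
      right; move: xY; rewrite /= ker_extend_out// j0 => Y0.
      by rewrite asboolT.
    - split; first exact: (congr1 val wv).
      by rewrite /= ker_extend_val.
    - case: asboolP => // Y0 [xv cx]; split=> //.
      by rewrite /= ker_extend_out// j0.
  apply: measurableU => //; case: asboolP => // _.
  by apply: measurableD; [exact: msf|exact: measurable_coset].
by move=> [mr mi]; split; [exact: (H (@complex.Re R))|exact: (H (@complex.Im R))].
Qed.

Lemma ker_unit v : unit_space Ge v -> src (val v) = val v /\ rng (val v) = val v.
Proof.
by move=> /unit_val uv; split; [exact: src_unit|exact: rng_unit].
Qed.

Lemma ker_translate_unit v w : sfiber v w -> gmul (val w) (val v) = val w.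
Proof.
by move=> wv; rewrite -(wv : src w = v) /= gmul_src.
Qed.

Lemma L2norm_mono d d' (T : measurableType d) (T' : measurableType d')
    (mu : {measure set T -> \bar R}) (mu' : {measure set T' -> \bar R})
    (D : set T) (D' : set T') (h : T -> R[i]) (h' : T' -> R[i]) :
  (L2sq mu D h <= L2sq mu' D' h')%E -> (L2norm mu D h <= L2norm mu' D' h')%E.
Proof.
move=> H; rewrite !L2normE; apply: gt0_ler_poweR => //;
  by rewrite in_itv/= leey andbT L2sq_ge0.
Qed.

(** The case [z = val v] of translation identifies the fiber of G_e with the identity coset in the
    fiber of [G]. Extension by zero preserves the norm of [h], and the old convolution is the part
    of the new one on that coset, so its norm is no larger. *)
Lemma reduced_norm_le_ext f : Cc Ge f ->
  (reduced_norm lame f <= reduced_norm lam (ext f))%E.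
Proof.
move=> Cf; have [cf _] := ker_extend_Cc G_hausdorff Cf.
apply: ge_ereal_sup => _ [v uv <-].
have [sz rz] := ker_unit uv.
apply: (@le_trans _ _ (reg_norm lam (val v) (ext f))); last first.
  by apply: ereal_sup_ubound; exists (val v) => //; exact: unit_val.
apply: ge_ereal_sup => _ [h [[mr mi hoo] h1] <-].
have mh : cmeasurable (sfiber (val v) : set (borel G)) (ext h : borel G -> R[i]).
  exact: ext_measurable.
have uz : unit_space G (val v) by exact: unit_val.
have hE w : sfiber v w -> ext h (gmul (val w) (val v)) = h w.
  by move=> wv; rewrite (ker_translate_unit wv) ker_extend_val.
have cz : c (val v) = 1%g by have := kerset_val v.
have TE (k : G -> R[i]) : cmeasurable (sfiber (val v) : set (borel G)) (k : borel G -> R[i]) ->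
    L2sq (haar_inv lame v) (sfiber v) (fun w => k (gmul (val w) (val v))) =
    (\int[haar_inv lam (val v)]_(x in sfiber (val v) `&` coset c 1%g)
      ((cabs (k x)) ^+ 2)%:E)%E.
  move=> mk; have := @ge0_integral_translate R G G_hausdorff G_lc G_sc lam lam_haar
    Gam c v (val v) (fun x => ((cabs (k x)) ^+ 2)%:E) (esym rz).
  rewrite sz cz /L2sq => -> //; first exact: measurable_cabs_sqr.
  by move=> x; rewrite lee_fin sqr_ge0.
have L2h : L2sq (haar_inv lame v) (sfiber v) h =
    L2sq (haar_inv lam (val v)) (sfiber (val v)) (ext h).
  rewrite -[LHS](_ : L2sq (haar_inv lame v) (sfiber v)
    (fun w => ext h (gmul (val w) (val v))) = _); last first.
    by apply: eq_integral => w; rewrite inE => wv; rewrite hE.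
  rewrite TE// integral_mkcondr; apply: eq_integral => x _.
  rewrite /patch; case: ifPn => //; rewrite notin_setE => cx.
  by rewrite ker_extend_out// cabs0 expr0n.
apply: (@le_trans _ _ (L2norm (haar_inv lam (val v)) (sfiber (val v))
    (conv lam (ext f) (ext h)))).
  apply: L2norm_mono.
  have mc := conv_measurable G_hausdorff G_lc G_sc lam_haar uz cf mh.
  have -> : L2sq (haar_inv lame v) (sfiber v) (conv lame f h) =
      L2sq (haar_inv lame v) (sfiber v)
        (fun w => conv lam (ext f) (ext h) (gmul (val w) (val v))).
    apply: eq_integral => w; rewrite inE => wv.
    have wz : src (val w) = rng (val v) by rewrite rz -(wv : src w = v).
    have mh' : cmeasurable (sfiber (src (val v)) : set (borel G)) (ext h : borel G -> R[i]).
      by rewrite sz.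
    rewrite -(ker_conv_translate G_hausdorff lam Cf wz mh').
    congr ((cabs _ ^+ 2)%:E); apply: eq_cintegral => y yw.
    have sw : sfiber v (gmul (ginv y) w).
      by rewrite /sfiber /= -(wv : src w = v); exact: src_inv_mul.
    by rewrite (hE _ sw).
  rewrite (TE _ mc); apply: ge0_subset_integral.
  - exact: msc.
  - exact: msf.
  - exact: measurable_cabs_sqr.
  - by move=> x _; rewrite lee_fin sqr_ge0.
  - exact: subIsetl.
apply: ereal_sup_ubound; exists (ext h) => //; split.
  by case: mh => mr' mi'; split=> //; rewrite L2norm_lty -L2h -L2norm_lty.
by rewrite (L2norm_le _ _ _ ler01) -L2h -L2norm_le.
Qed.

Section upper_bound.
Variables (f : Ge -> R[i]) (M : R).
Hypothesis (Cf : Cc Ge f) (M0 : 0 <= M).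
Hypothesis fM : (reduced_norm lame f <= M%:E)%E.

Lemma reduced_L2_bound v : unit_space Ge v ->
  forall k : Ge -> R[i], cmeasurable (sfiber v : set (borel Ge)) (k : borel Ge -> R[i]) ->
  (L2sq (haar_inv lame v) (sfiber v) k <= 1)%E ->
  (L2sq (haar_inv lame v) (sfiber v) (conv lame f k) <= (M ^+ 2)%:E)%E.
Proof.
move=> uv k [mr mi] k1; rewrite -L2norm_le//; apply: le_trans fM.
apply: (@le_trans _ _ (reg_norm lame v f)); last by apply: ereal_sup_ubound; exists v.
apply: ereal_sup_ubound; exists k => //; split.
  by split=> //; rewrite L2norm_lty (le_lt_trans k1)// ltey.
by rewrite (L2norm_le _ _ _ ler01) expr1n.
Qed.

(** Translation by any point [z] of the coset carries [h] to a fiber of G_e, where the reduced norm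
    applies; if the coset misses the fiber, both sides vanish. *)
Lemma coset_L2_bound u (g : Gam) h : unit_space G u ->
  cmeasurable (sfiber u : set (borel G)) (h : borel G -> R[i]) ->
  (L2sq (haar_inv lam u) (sfiber u `&` coset c g) h < +oo)%E ->
  (L2sq (haar_inv lam u) (sfiber u `&` coset c g) (conv lam (ext f) h) <=
   (M ^+ 2)%:E * L2sq (haar_inv lam u) (sfiber u `&` coset c g) h)%E.
Proof.
move=> uu mh hoo; have [cf _] := ker_extend_Cc G_hausdorff Cf.
have [[z [zu zg]]|ne] := pselect (exists z, (sfiber u `&` coset c g) z); last first.
  have -> : sfiber u `&` coset c g = set0.
    by rewrite -subset0 => z zP; apply: ne; exists z.
  by rewrite /L2sq !integral_set0 mule0.
move: zu zg => /= zu zg; rewrite -zu -zg in mh hoo uu *.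
pose nrm (k : borel G -> R[i]) :=
  L2sq (haar_inv lam (src z)) (sfiber (src z) `&` coset c (c z)) k.
pose S := nrm h; pose X := nrm (conv lam (ext f) h).
rewrite -[L2sq _ _ _]/S in hoo; rewrite -[(_ <= _)%E]/(X <= (M ^+ 2)%:E * S)%E.
have S0 : (0 <= S)%E by exact: L2sq_ge0.
have X0 : (0 <= X)%E by exact: L2sq_ge0.
have Sfin : S \is a fin_num by rewrite ge0_fin_numE.
set s := fine S; have sE : S = s%:E by rewrite fineK.
have s0 : 0 <= s by rewrite fine_ge0.
pose v : Ge := to_ker (kerset_rng c z).
have vz : val v = rng z by [].
have uv : unit_space Ge v by exists v => //; apply: val_inj; exact: rng_rng.
have mc := conv_measurable G_hausdorff G_lc G_sc lam_haar uu cf mh.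
have TE (t : R) (k : G -> R[i]) : 0 < t ->
    cmeasurable (sfiber (src z) : set (borel G)) (k : borel G -> R[i]) ->
    L2sq (haar_inv lame v) (sfiber v) (fun w => t%:C * k (gmul (val w) z)) =
    ((t ^+ 2)%:E * nrm k)%E.
  move=> t0 mk.
  have mk2 : measurable_fun (sfiber (src z) : set (borel G))
    ((fun x => ((t ^+ 2)%:E * ((cabs (k x)) ^+ 2)%:E)%E) : borel G -> \bar R).
    by apply: measurable_funeM; exact: measurable_cabs_sqr.
  have := @ge0_integral_translate R G G_hausdorff G_lc G_sc lam lam_haar
    Gam c v z _ vz mk2 _.
  rewrite (@ge0_integralZl _ (borel G) R (haar_inv lam (src z)) _ (msc _ _)
    (fun x => ((cabs (k x)) ^+ 2)%:E)); first last.
  - by rewrite lee_fin sqr_ge0.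
  - by move=> x _; rewrite lee_fin sqr_ge0.
  - exact: (measurable_funS (msf (src z)) (@subIsetl _ _ _) (measurable_cabs_sqr mk)).
  move=> <-; last by move=> x; rewrite -EFinM lee_fin mulr_ge0// sqr_ge0.
  apply: eq_integral => w _.
  by rewrite cabsM cabs_real (gtr0_norm t0) exprMn EFinM.
(* Normalizing by [s' > s], and not by [s], covers the case [s = 0]; afterwards [s'] tends to
   [s]. *)
have key (s' : R) : s < s' -> (X <= (M ^+ 2 * s')%:E)%E.
  move=> ss'; have s'0 : 0 < s' := le_lt_trans s0 ss'.
  pose t := (Num.sqrt s')^-1.
  have t0 : 0 < t by rewrite invr_gt0 sqrtr_gt0.
  have t2 : t ^+ 2 = s'^-1 by rewrite exprVn sqr_sqrtr// ltW.
  pose k w := t%:C * h (gmul (val w) z).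
  have mk : cmeasurable (sfiber v : set (borel Ge)) (k : borel Ge -> R[i]).
    apply: cmeasurableM.
      by split=> /=; exact: measurable_cst.
    exact: (@cmeasurable_comp R _ _ (borel Ge) (borel G) _ _ h _ (msf (src z)) mh
      (fun w => @translate_sfiber G Gam c v z w vz) (translate_measurable vz)).
  have k1 : (L2sq (haar_inv lame v) (sfiber v) k <= 1)%E.
    rewrite (TE _ _ t0 mh) -/S sE -EFinM lee_fin t2 mulrC ler_pdivrMr// mul1r.
    exact: ltW.
  have := reduced_L2_bound uv mk k1.
  have -> : L2sq (haar_inv lame v) (sfiber v) (conv lame f k) =
      L2sq (haar_inv lame v) (sfiber v)
        (fun w => t%:C * conv lam (ext f) h (gmul (val w) z)).
    apply: eq_integral => w; rewrite inE => wv.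
    have wz : src (val w) = rng z by rewrite -vz -(wv : src w = v).
    rewrite -(conv_scale G_hausdorff lam t0 cf); last by rewrite src_gmul.
    rewrite -(ker_conv_translate G_hausdorff lam Cf wz)//.
    by apply: cmeasurableM.
  rewrite (TE _ _ t0 mc) -/X t2 => H.
  by rewrite EFinM -lee_pdivrMr// muleC.
apply/lee_addgt0Pr => e e0.
have M1 : 0 < M ^+ 2 + 1 by rewrite ltr_wpDl// sqr_ge0.
have /key/le_trans : s < s + e / (M ^+ 2 + 1) by rewrite ltrDl divr_gt0.
apply; rewrite sE -EFinM -EFinD lee_fin mulrDr lerD2l mulrCA ler_piMr ?(ltW e0)//.
by rewrite ler_pdivrMr// mul1r lerDl.
Qed.

(** Every point has a basic neighbourhood on which [c] is constant, and one chosen point of each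
    basic set reveals that constant; so [c] has countably many values. *)
Lemma coset_cover : exists g : nat -> Gam, forall x, exists n, c x = g n.
Proof.
have [e [eo eb]] := second_countable_enum G_sc.
have /choice[p pP] : forall n, exists y, forall x, e n x -> e n y.
  move=> n; have [[y ey]|ne] := pselect (exists y, e n y); first by exists y.
  by exists point => x ex; exfalso; apply: ne; exists x.
exists (c \o p) => x; have [n [ex en]] := eb x _ (near_coset c x).
by exists n => /=; rewrite (en _ (pP n x ex)).
Qed.

Lemma reduced_norm_ext_le : (reduced_norm lam (ext f) <= M%:E)%E.
Proof.
have [cf _] := ker_extend_Cc G_hausdorff Cf.
apply: ge_ereal_sup => _ [u uu <-]; apply: ge_ereal_sup => _ [h [[mr mi hoo] h1] <-].
have mh : cmeasurable (sfiber u : set (borel G)) (h : borel G -> R[i]) by split.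
have mc := conv_measurable G_hausdorff G_lc G_sc lam_haar uu cf mh.
rewrite (L2norm_le _ _ _ M0); have [g gP] := coset_cover.
(* The sequence [g] may repeat values; keeping the first index of each makes the pieces disjoint. *)
pose P n := [set x | c x = g n /\ forall m, (m < n)%N -> g m <> g n].
have PE n : P n = coset c (g n) \/ P n = set0.
  have [H|H] := pselect (forall m, (m < n)%N -> g m <> g n).
    by left; apply/seteqP; split=> [x []|x cx].
  by right; rewrite -subset0 => x [_ /H].
have mP n : measurable (sfiber u `&` P n : set (borel G)).
  by have [->|->] := PE n; [exact: msc|rewrite setI0; exact: measurable0].
have tP : trivIset setT (fun n => sfiber u `&` P n).
  apply/trivIsetP => i j _ _; rewrite -subset0 neq_lt => /orP[ij|ji] x [[_ [xi iP]] [_ [xj jP]]].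
    by apply: (jP i ij); rewrite -xi -xj.
  by apply: (iP j ji); rewrite -xi -xj.
have UP : \bigcup_n (sfiber u `&` P n) = sfiber u.
  apply/seteqP; split=> [x [n _ []]//|x xu].
  have ex : exists n, c x == g n by have [n cn] := gP x; exists n; apply/eqP.
  case: (ex_minnP ex) => n /eqP cn nmin; exists n => //; split=> //; split=> // m mn gmn.
  have := nmin m; rewrite cn gmn eqxx => /(_ isT); rewrite leqNgt mn//.
have dec (k : G -> R[i]) : cmeasurable (sfiber u : set (borel G)) (k : borel G -> R[i]) ->
    L2sq (haar_inv lam u) (sfiber u) k =
    (\sum_(0 <= n <oo) L2sq (haar_inv lam u) (sfiber u `&` P n) k)%E.
  move=> mk; rewrite /L2sq -{1}UP ge0_integral_bigcup//.
  - by rewrite UP; exact: measurable_cabs_sqr.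
  - by move=> x _; rewrite lee_fin sqr_ge0.
have h2 : (L2sq (haar_inv lam u) (sfiber u) h <= 1)%E.
  by move: h1; rewrite (L2norm_le _ _ _ ler01) expr1n.
apply: (@le_trans _ _ ((M ^+ 2)%:E * L2sq (haar_inv lam u) (sfiber u) h)%E); last first.
  by rewrite -[leRHS]mule1 lee_wpmul2l// lee_fin sqr_ge0.
rewrite (dec _ mc) (dec _ mh) -nneseriesZl; last by move=> n _; exact: L2sq_ge0.
apply: lee_nneseries => n _; first by move=> _; exact: L2sq_ge0.
have [->|->] := PE n; last by rewrite setI0 /L2sq !integral_set0 mule0.
apply: coset_L2_bound => //; apply: le_lt_trans (ltey 1).
apply: le_trans h2; apply: ge0_subset_integral.
- exact: msc.
- exact: msf.
- exact: measurable_cabs_sqr.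
- by move=> x _; rewrite lee_fin sqr_ge0.
- exact: subIsetl.
Qed.

End upper_bound.
End reduced_norm.

(** * Assembly of the two extensions *)

Section kernel_extension.
Variables (R : realType) (G : topGroupoidType).
Hypothesis (G_hausdorff : hausdorff_space G) (G_lc : locally_compact [set: G]).
Variable lam : G -> {measure set (borel G) -> \bar R}.
Hypothesis lam_haar : is_haar_system lam.
Variables (Gam : groupType) (c : contHom G Gam).
Local Notation Ge := (kergrp c).
Local Notation lame := (haar_restr lam : Ge -> {measure set (borel Ge) -> \bar R}).
Local Notation ext := (@ker_extend R G Gam c).
Variables (ne : (Ge -> R[i]) -> \bar R) (n : (G -> R[i]) -> \bar R).
Variables (Ae A : cstarAlgebra R) (je : (Ge -> R[i]) -> Ae) (j : (G -> R[i]) -> A).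
Hypothesis (compl_e : is_completion lame ne je) (compl : is_completion lam n j).

(** Density and the compatibility of [ext] with the operations are common to both completions, so
    only the equality of norms remains for each of them. *)
Lemma kernel_extension : (forall f, Cc Ge f -> rnorm (je f) = rnorm (j (ext f))) ->
  exists i : Ae -> A, [/\ is_star_hom i, injective i &
    forall f, Cc Ge f -> i (je f) = j (ext f)].
Proof.
move=> iso; have Cext f (Cf : Cc Ge f) : Cc G (ext f) := ker_extend_Cc G_hausdorff Cf.
apply: (@cstar_extension R _ (Cc Ge) Ae A je (j \o ext)).
- exact: (compl_dense compl_e).
- move=> k a b Ca Cb; exists (fun x => k * a x + b x); split.
  + exact: (Cc_lin (@ker_hausdorff G G_hausdorff Gam c) k Ca Cb).
  + exact: (compl_scale_add compl_e k Ca Cb).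
  + by rewrite /= ext_lin (compl_scale_add compl k (Cext a Ca) (Cext b Cb)).
- move=> a b Ca Cb; exists (conv lame a b); split.
  + exact: (Cc_ker_conv G_hausdorff G_lc lam_haar Ca Cb).
  + exact: (compl_conv compl_e Ca Cb).
  + rewrite /= (ext_conv G_hausdorff lam Ca Cb).
    exact: (compl_conv compl (Cext a Ca) (Cext b Cb)).
- move=> a Ca; exists (invol a); split.
  + exact: (Cc_ker_invol G_hausdorff Ca).
  + exact: (compl_invol compl_e Ca).
  + by rewrite /= ext_invol (compl_invol compl (Cext a Ca)).
- exact: iso.
Qed.

End kernel_extension.

Theorem theorem1p1 (R : realType) (G : topGroupoidType)
    (G_hausdorff : hausdorff_space G) (G_lc : locally_compact [set: G])
    (G_sc : @second_countable G)
    (lam : G -> {measure set (borel G) -> \bar R}) (lam_haar : is_haar_system lam)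
    (Gam : groupType) (c : contHom G Gam) :
  (forall (Ae A : cstarAlgebra R)
      (je : (kergrp c -> R[i]) -> Ae) (j : (G -> R[i]) -> A),
    is_completion (haar_restr lam : kergrp c -> _) (full_norm (haar_restr lam)) je ->
    is_completion lam (full_norm lam) j ->
    exists i_f : Ae -> A,
      [/\ is_star_hom i_f, injective i_f &
          forall f, Cc (kergrp c) f -> i_f (je f) = j (ker_extend f)])
  /\
  (forall (Be B : cstarAlgebra R)
      (je : (kergrp c -> R[i]) -> Be) (j : (G -> R[i]) -> B),
    is_completion (haar_restr lam : kergrp c -> _) (reduced_norm (haar_restr lam)) je ->
    is_completion lam (reduced_norm lam) j ->
    exists i_r : Be -> B,
      [/\ is_star_hom i_r, injective i_r &
          forall f, Cc (kergrp c) f -> i_r (je f) = j (ker_extend f)]).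
Proof.
split=> Ae A je j compl_e compl;
  apply: (kernel_extension G_hausdorff G_lc lam_haar compl_e compl) => f Cf;
  have Cext := ker_extend_Cc G_hausdorff Cf;
  apply/eqP; rewrite eq_le -!lee_fin.
  (* The lower bound is available for [invol f], so the norm of [je f] is first replaced by that of
     its star, which is [je (invol f)]. *)
  rewrite -(rnorm_cstar (je f)) -(compl_invol compl_e Cf).
  have Cf' := Cc_ker_invol G_hausdorff Cf.
  rewrite (compl_norm compl_e Cf') (compl_norm compl Cext).
  apply/andP; split.
    exact: (full_norm_invol_le G_hausdorff G_lc G_sc lam_haar Cf).
  rewrite -(compl_norm compl_e Cf') (compl_invol compl_e Cf) (rnorm_cstar (je f)).
  rewrite (compl_norm compl_e Cf).
  exact: (full_norm_ext_le G_hausdorff lam Cf).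
apply/andP; split.
  rewrite (compl_norm compl_e Cf) (compl_norm compl Cext).
  exact: (reduced_norm_le_ext G_hausdorff G_lc G_sc lam_haar Cf).
rewrite (compl_norm compl Cext).
(* The real bound [M] is the norm of [je f], whose existence already contains the finiteness of the
   reduced norm of [f]. *)
apply: (reduced_norm_ext_le G_hausdorff G_lc G_sc lam_haar Cf (rnorm_ge0 _)).
by rewrite (compl_norm compl_e Cf).
Qed.
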